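(* Let $\omega=e^{2\pi i/3}$, let $N$ be a positive integer, $c=4\operatorname{Im}\omega/N$, $r>0$, and let $\Gamma_c := \langle\Lambda_{\omega,c},\ (\omega/2,\ c/3+\operatorname{Im}\omega/6)\,\mu(\omega)\rangle\subset\mathbb{H}\rtimes S^1$, assumed to be a Heisenberg Bieberbach group. Let $M=\Gamma_c\backslash\mathbb{H}$, equipped with the CR structure induced from $\mathbb{H}$ and the contact form $r\theta_{\mathbb{H}}$, and let $\Delta_b$ and $T$ be its sub-Laplacian and Reeb vector field. For $n\in\mathbb{Z}\setminus\{0\}$ and $k\in\mathbb{Z}_{\ge0}$, the multiplicity $m_{n,k}$ of $$\sigma_{n,k}=\left(\frac{(4k+2)\pi|n|}{cr},\frac{2\pi n}{cr}\right)$$ in the joint spectrum of $\Delta_b$ and $i^{-1}T$ on $M$ is given by $$m_{n,k}=\frac13\left(|n|N+\frac{4}{\sqrt3}\cos\left(\frac{2\pi(|n|-k)}{3}+\frac{\pi}{6}\right)+\frac{2}{\sqrt3}\cos\left(\frac{2\pi(|n|-k-|n|N)}{3}+\frac{\pi}{6}\right)\right).$$ Moreover, for any $\kappa>0$, the multiplicity of $(\kappa,0)$ in the joint spectrum is equal to $\#E_\kappa/3$, where $E_\kappa=\{\zeta\in L_\omega' : \pi^2|\zeta|^2/r=\kappa\}$.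
   Context: The Heisenberg group is $\mathbb{H} = \mathbb{C}\times\mathbb{R}$ with multiplication $(z,t)\cdot(z',t') = (z+z', t+t'+2\operatorname{Im}(z\bar z'))$. For $\lambda\in\mathbb{C}^*$ let $\mu(\lambda)(z,t)=(\lambda z,|\lambda|^2t)$. $\mathbb{H}\rtimes\mathbb{C}^*$ has multiplication $(g,\lambda)\cdot(h,\nu)=(g\cdot\mu(\lambda)(h),\lambda\nu)$ and acts on $\mathbb{H}$ by $(g,\lambda)h=g\cdot\mu(\lambda)(h)$; $(g,\lambda)$ is also written $g\,\mu(\lambda)$, $\mathbb{H}$ is identified with the elements $(g,1)$, and $\mathbb{H}\rtimes S^1$ is the subgroup with $|\lambda|=1$. A Heisenberg Bieberbach group is a discrete torsion-free subgroup $\Gamma\subset\mathbb{H}\rtimes S^1$ with $\Gamma\backslash\mathbb{H}$ compact. For $4\operatorname{Im}\tau/c\in\mathbb{Z}_{>0}$, $\Lambda_{\tau,c}=\langle(1,0),(\tau,0),(0,c)\rangle\subset\mathbb{H}$; here $\tau=\omega$, and $N=4\operatorname{Im}\omega/c=\#(Z(\Lambda_{\omega,c})/[\Lambda_{\omega,c},\Lambda_{\omega,c}])$. $L_\omega=\mathbb{Z}+\mathbb{Z}\omega$, and $L_\omega'=\{\zeta\in\mathbb{C} : \operatorname{Re}(\zeta\bar z)\in\mathbb{Z}\text{ for all }z\in L_\omega\}$ is its dual lattice. The CR structure on $\mathbb{H}$ is spanned by $Z=\partial_z+i\bar z\,\partial_t$, and $\theta_{\mathbb{H}}=dt+i(z\,d\bar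 z-\bar z\,dz)$; both are invariant under $\mathbb{H}\rtimes S^1$ and so descend to the quotient. Functions on $M$ are identified with $\Gamma_c$-invariant functions on $\mathbb{H}$. With respect to $r\theta_{\mathbb{H}}$, the sub-Laplacian is $\Delta_b=-\frac{1}{2r}(Z\bar Z+\bar ZZ)$ and the Reeb vector field is $T=\frac1r\partial_t$. The multiplicity of $(a,b)\in\mathbb{R}^2$ in the joint spectrum is the complex dimension of $\{f\in C^\infty(M;\mathbb{C}) : \Delta_bf=af,\ i^{-1}Tf=bf\}$ (zero if $(a,b)$ is not a joint eigenvalue). *)

(* Defs.v *)
From HB Require Import structures.
From mathcomp Require Import all_boot all_order all_algebra.
From mathcomp Require Import all_classical all_reals all_analysis.
From mathcomp Require Import complex.
From mathcomp Require Import ring.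

Set Warnings "-redundant-canonical-projection,-projection-no-head-constant".

Set Implicit Arguments.
Unset Strict Implicit.
Unset Printing Implicit Defensive.

Import Order.TTheory GRing.Theory Num.Theory.
Import numFieldNormedType.Exports.

Local Open Scope classical_set_scope.
Local Open Scope ring_scope.
Local Open Scope complex_scope.
Local Open Scope quotient_scope.

(* The usual topology and normed space structure on [R[i]], seen as a
   one-dimensional space over itself. *)
HB.instance Definition _ (R : rcfType) := GRing.ComAlgebra.copy R[i] R[i]^o.
HB.instance Definition _ (R : rcfType) := Vector.copy R[i] R[i]^o.
HB.instance Definition _ (R : rcfType) := NormedModule.copy R[i] R[i]^o.

Definition heis (R : realType) : Type := (R[i] * R)%type.

HB.instance Definition _ (R : realType) := Choice.on (heis R).
HB.instance Definition _ (R : realType) := Topological.on (heis R).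

Section HeisenbergGroup.
Context {R : realType}.
Implicit Types p q : heis R.

Definition heis_mul p q : heis R :=
  (p.1 + q.1, p.2 + q.2 + 2 * complex.Im (p.1 * (q.1^*)%C)).
Definition heis_one : heis R := (0, 0).
Definition heis_inv p : heis R := (- p.1, - p.2).

Fact heis_mulA : associative heis_mul.
Proof.
by move=> [[a b] s] [[c d] t] [[e f] u]; rewrite /heis_mul /=; congr pair;
  [congr (_ +i* _) |]; ring.
Qed.

Fact heis_mul1g : left_id heis_one heis_mul.
Proof.
by move=> [[a b] s]; rewrite /heis_mul /=; congr pair; [congr (_ +i* _) |]; ring.
Qed.

Fact heis_mulg1 : right_id heis_one heis_mul.
Proof.
by move=> [[a b] s]; rewrite /heis_mul /=; congr pair; [congr (_ +i* _) |]; ring.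
Qed.

Fact heis_mulVg : left_inverse heis_one heis_inv heis_mul.
Proof.
by move=> [[a b] s]; rewrite /heis_mul /=; congr pair; [congr (_ +i* _) |]; ring.
Qed.

Fact heis_mulgV : right_inverse heis_one heis_inv heis_mul.
Proof.
by move=> [[a b] s]; rewrite /heis_mul /=; congr pair; [congr (_ +i* _) |]; ring.
Qed.

End HeisenbergGroup.

HB.instance Definition _ (R : realType) := isGroup.Build (heis R)
  heis_mulA heis_mul1g heis_mulg1 heis_mulVg heis_mulgV.

Definition Cstar (R : realType) : Type := {l : R[i] | l != 0}.

HB.instance Definition _ (R : realType) := SubType.on (Cstar R).
HB.instance Definition _ (R : realType) := Choice.on (Cstar R).
HB.instance Definition _ (R : realType) :=
  Topological.copy (Cstar R) (initial_topology (val : Cstar R -> R[i])).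

Section CstarGroup.
Context {R : realType}.
Implicit Types l m : Cstar R.

Definition Cstar_mul l m : Cstar R :=
  exist _ (val l * val m) (mulf_neq0 (valP l) (valP m)).
Definition Cstar_one : Cstar R := exist _ 1 (oner_neq0 R[i]).

Fact Cstar_inv_subproof l : (val l)^-1 != 0.
Proof. by rewrite invr_eq0 (valP l). Qed.

Definition Cstar_inv l : Cstar R := exist _ (val l)^-1 (Cstar_inv_subproof l).

Fact Cstar_mulA : associative Cstar_mul.
Proof. by move=> x y z; apply: val_inj; rewrite /= mulrA. Qed.

Fact Cstar_mul1g : left_id Cstar_one Cstar_mul.
Proof. by move=> x; apply: val_inj; rewrite /= mul1r. Qed.

Fact Cstar_mulg1 : right_id Cstar_one Cstar_mul.
Proof. by move=> x; apply: val_inj; rewrite /= mulr1. Qed.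

Fact Cstar_mulVg : left_inverse Cstar_one Cstar_inv Cstar_mul.
Proof. by move=> x; apply: val_inj => /=; exact: (mulVf (valP x)). Qed.

Fact Cstar_mulgV : right_inverse Cstar_one Cstar_inv Cstar_mul.
Proof. by move=> x; apply: val_inj => /=; exact: (mulfV (valP x)). Qed.

End CstarGroup.

HB.instance Definition _ (R : realType) := isGroup.Build (Cstar R)
  Cstar_mulA Cstar_mul1g Cstar_mulg1 Cstar_mulVg Cstar_mulgV.

(* |l|^2 as an element of [R]; the library norm [`|l|] lives in [R[i]]. *)
Definition sqnorm {R : realType} (l : R[i]) : R :=
  complex.Re l ^+ 2 + complex.Im l ^+ 2.

Definition mu {R : realType} (l : Cstar R) (p : heis R) : heis R :=
  (val l * p.1, sqnorm (val l) * p.2).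

(* The underlying type of the semidirect product of [heis R] by [Cstar R]; it
   carries the product topology but not the direct product group law. *)
Definition heisC (R : realType) : Type := (heis R * Cstar R)%type.

HB.instance Definition _ (R : realType) := Choice.on (heisC R).
HB.instance Definition _ (R : realType) := Topological.on (heisC R).

Section SemidirectProduct.
Context {R : realType}.
Implicit Types (g h : heisC R) (l m : Cstar R) (p q : heis R).

Lemma mu1 p : mu 1%g p = p.
Proof.
case: p => [[a b] s]; rewrite /mu /sqnorm /=; congr pair;
  [congr (_ +i* _) |]; ring.
Qed.

Lemma muM l m p : mu (l * m)%g p = mu l (mu m p).
Proof.
case: l m p => [[a b] ?] [[c d] ?] [[e f] s]; rewrite /mu /sqnorm /=.
by congr pair; [congr (_ +i* _) |]; ring.
Qed.

Lemma mu_morph l p q : mu l (p * q)%g = (mu l p * mu l q)%g.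
Proof.
rewrite -[LHS]/(mu l (heis_mul p q)) -[RHS]/(heis_mul (mu l p) (mu l q)).
case: l p q => [[a b] ?] [[c d] s] [[e f] t]; rewrite /mu /sqnorm /heis_mul /=.
by congr pair; [congr (_ +i* _) |]; ring.
Qed.

Lemma mu_one l : mu l 1%g = 1%g.
Proof. by rewrite /mu /= !mulr0. Qed.

Definition heisC_mul g h : heisC R := ((g.1 * mu g.2 h.1)%g, (g.2 * h.2)%g).
Definition heisC_one : heisC R := (1%g, 1%g).
Definition heisC_inv g : heisC R := (mu (g.2^-1)%g (g.1^-1)%g, (g.2^-1)%g).

Fact heisC_mulA : associative heisC_mul.
Proof. by move=> x y z; rewrite /heisC_mul /= mu_morph muM !mulgA. Qed.

Fact heisC_mul1g : left_id heisC_one heisC_mul.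
Proof. by move=> [x l]; rewrite /heisC_mul /= mu1 !mul1g. Qed.

Fact heisC_mulg1 : right_id heisC_one heisC_mul.
Proof. by move=> [x l]; rewrite /heisC_mul /= mu_one !mulg1. Qed.

Fact heisC_mulVg : left_inverse heisC_one heisC_inv heisC_mul.
Proof.
by move=> [x l]; rewrite /heisC_mul /= -mu_morph !mulVg mu_one.
Qed.

Fact heisC_mulgV : right_inverse heisC_one heisC_inv heisC_mul.
Proof.
by move=> [x l]; rewrite /heisC_mul /= -muM !mulgV mu1 mulgV.
Qed.

End SemidirectProduct.

HB.instance Definition _ (R : realType) := isGroup.Build (heisC R)
  heisC_mulA heisC_mul1g heisC_mulg1 heisC_mulVg heisC_mulgV.

Definition act {R : realType} (g : heisC R) (p : heis R) : heis R :=
  (g.1 * mu g.2 p)%g.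

Lemma act1 {R : realType} (p : heis R) : act 1%g p = p.
Proof. by rewrite /act /= mu1 mul1g. Qed.

Lemma actM {R : realType} (g h : heisC R) (p : heis R) :
  act (g * h)%g p = act g (act h p).
Proof. by rewrite /act /= mu_morph muM mulgA. Qed.

Section GeneratedSubgroup.
Context {G : groupType}.

(* The subgroup generated by [S]. *)
Definition gen (S : set G) : {pred G} :=
  [in smallest [set A : set G | group_closed [in A]] S].

Variable S : set G.

Fact gen_group_closed : group_closed (gen S).
Proof.
split; first by apply/mem_set => A [[A1 _] _]; rewrite inE in A1.
move=> x y /set_mem xS /set_mem yS; apply/mem_set => A AS.
have := AS.1.2 x y (mem_set (xS A AS)) (mem_set (yS A AS)).
by rewrite inE.
Qed.

HB.instance Definition _ :=
  isMulClosed.Build G (gen S) (group_closedM gen_group_closed).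
HB.instance Definition _ := isMul1Closed.Build G (gen S) gen_group_closed.1.
HB.instance Definition _ :=
  isInvClosed.Build G (gen S) (group_closedV gen_group_closed).

End GeneratedSubgroup.

Section OrbitSpace.
Context {R : realType} (Gamma : groupClosed (heisC R)).

Definition orbit_rel (p q : heis R) : bool :=
  `[< exists2 g, g \in Gamma & act g p = q >].

Fact orbit_rel_refl : reflexive orbit_rel.
Proof. by move=> p; apply/asboolP; exists 1%g; rewrite ?gpred1 ?act1. Qed.

Fact orbit_rel_sym : symmetric orbit_rel.
Proof.
suff H p q : orbit_rel p q -> orbit_rel q p by move=> p q; apply/idP/idP; exact: H.
move=> /asboolP [g gG <-]; apply/asboolP; exists (g^-1)%g; first by rewrite gpredV.
by rewrite -actM mulVg act1.
Qed.

Fact orbit_rel_trans : transitive orbit_rel.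
Proof.
move=> q p s /asboolP [g gG <-] /asboolP [h hG <-]; apply/asboolP.
by exists (h * g)%g; [rewrite gpredM | rewrite actM].
Qed.

Canonical orbit_equiv :=
  EquivRel orbit_rel orbit_rel_refl orbit_rel_sym orbit_rel_trans.

Definition orbit_space : topologicalType :=
  quotient_topology {eq_quot orbit_equiv}.

End OrbitSpace.

Record heisenberg_bieberbach {R : realType} (Gamma : groupClosed (heisC R)) :
    Prop := HeisenbergBieberbach {
  bieberbach_isometric : forall g, g \in Gamma -> `|val g.2| = 1;
  bieberbach_discrete : [set` Gamma] `<=` isolated [set` Gamma];
  bieberbach_torsion_free : forall g (n : nat),
    g \in Gamma -> (0 < n)%N -> (g ^+ n = 1)%g -> g = 1%g;
  bieberbach_cocompact : compact [set: orbit_space Gamma] }.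

Section Lattices.
Context {R : realType}.

(* e^(i x) *)
Definition expi (x : R) : R[i] := cos x +i* sin x.

Fact expi_neq0 (x : R) : expi x != 0.
Proof.
apply/eqP => -[c0 s0]; have := cos2Dsin2 x.
by rewrite c0 s0 expr0n addr0 => /esym/eqP; rewrite oner_eq0.
Qed.

Definition omega : R[i] := expi (2 * pi / 3).
Definition omegaS : Cstar R := exist _ omega (expi_neq0 _).

Definition Lambda (tau : R[i]) (c : R) : {pred heis R} :=
  gen [set p : heis R | [\/ p = (1, 0), p = (tau, 0) | p = (0, c)]].

Definition Gamma (c : R) : {pred heisC R} :=
  gen [set g : heisC R | (exists2 p, p \in Lambda omega c & g = (p, 1%g))
     \/ g = ((omega / 2, c / 3 + complex.Im omega / 6), omegaS)].

HB.instance Definition _ (c : R) := GroupClosed.on (Gamma c).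

Definition Lomega : set R[i] :=
  [set z | exists a b : int, z = a%:~R + b%:~R * omega].

Definition Lomega_dual : set R[i] :=
  [set zeta | forall z, Lomega z -> complex.Re (zeta * (z^*)%C) \is a Num.int].

Definition Ekappa (r kappa : R) : set R[i] :=
  [set zeta | Lomega_dual zeta /\ pi ^+ 2 * sqnorm zeta / r = kappa].

End Lattices.

Section Operators.
Context {R : realType}.
Implicit Types (f : heis R -> R[i]) (p : heis R).

(* The real coordinates (x, y, t) of the point (x + iy, t). *)
Inductive axis := axis_x | axis_y | axis_t.

Definition get_coord (v : axis) p : R :=
  match v with
  | axis_x => complex.Re p.1
  | axis_y => complex.Im p.1
  | axis_t => p.2
  end.

Definition set_coord (v : axis) p (s : R) : heis R :=
  match v with
  | axis_x => (s +i* complex.Im p.1, p.2)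
  | axis_y => (complex.Re p.1 +i* s, p.2)
  | axis_t => (p.1, s)
  end.

Definition partial (v : axis) f : heis R -> R[i] := fun p =>
  derive1 (fun s => complex.Re (f (set_coord v p s))) (get_coord v p)
  +i* derive1 (fun s => complex.Im (f (set_coord v p s))) (get_coord v p).

Definition has_partial (v : axis) f : Prop := forall p,
  derivable (fun s => complex.Re (f (set_coord v p s))) (get_coord v p) 1 /\
  derivable (fun s => complex.Im (f (set_coord v p s))) (get_coord v p) 1.

Definition smooth f : Prop := forall w : seq axis,
  continuous (foldr partial f w) /\ forall v, has_partial v (foldr partial f w).

Definition d_z f : heis R -> R[i] := fun p =>
  (partial axis_x f p - 'i%C * partial axis_y f p) / 2.
Definition d_zbar f : heis R -> R[i] := fun p =>
  (partial axis_x f p + 'i%C * partial axis_y f p) / 2.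

Definition Zop f : heis R -> R[i] := fun p =>
  d_z f p + 'i%C * (p.1^*)%C * partial axis_t f p.
Definition Zbarop f : heis R -> R[i] := fun p =>
  d_zbar f p - 'i%C * p.1 * partial axis_t f p.

Definition sublaplacian (r : R) f : heis R -> R[i] := fun p =>
  - ((2 * r)%:C)^-1 * (Zop (Zbarop f) p + Zbarop (Zop f) p).

Definition reeb (r : R) f : heis R -> R[i] := fun p =>
  (r%:C)^-1 * partial axis_t f p.

(* Functions on the quotient of [heis R] by [G] are [G]-invariant functions. *)
Definition joint_eigenspace (G : {pred heisC R}) (r a b : R) :
    set (heis R -> R[i]) := [set f |
  [/\ smooth f,
      forall g p, g \in G -> f (act g p) = f p,
      forall p, sublaplacian r f p = a%:C * f p
    & forall p, ('i%C)^-1 * reeb r f p = b%:C * f p]].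

End Operators.

(* [E] is a subspace of [V] with a basis of [m] vectors. *)
Definition has_dim (K : fieldType) (V : lmodType K) (E : set V) (m : nat) :
    Prop := exists e : 'I_m -> V,
  [/\ E = [set v | exists a : 'I_m -> K, v = \sum_i a i *: e i]
    & forall a : 'I_m -> K, \sum_i a i *: e i = 0 -> forall i, a i = 0].

Definition multiplicity {R : realType} (G : {pred heisC R}) (r a b : R)
    (m : nat) : Prop :=
  has_dim (joint_eigenspace G r a b : set (heis R -> R[i])) m.

(* Main.v *)
Require Import Defs.
From HB Require Import structures.
From mathcomp Require Import all_boot all_order all_algebra.
From mathcomp Require Import all_classical all_reals all_analysis.
From mathcomp Require Import complex.
From mathcomp Require Import ring lra zify.

(** Write [A], [B] for the translations by [1] and [omega], and [G] for the
    screw motion that generates [Gamma c] together with the lattice.  The vertical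
    element is central, so invariant functions are studied one vertical
    frequency [b] at a time.

    Frequency [b = 2 pi n / c] with [n > 0].  The commutator of [Z] and [Zbar] is
    a multiple of the vertical derivative, hence the scalar [2 b] on functions of
    frequency [b].  As for the harmonic oscillator, [Zbar] maps the [k]-th
    eigenspace isomorphically onto the one below, and since [G] rotates by
    [omega], each step down multiplies the eigenvalue of [G] by [omega]
    ([landau_level_dim]).  At the bottom [Zbar f = 0]: a function [Zbar f] with
    [Z (Zbar f) = 0] has Fourier coefficients that grow like Gaussians, which no
    bounded function allows ([theta_negative]).  It remains to find the
    eigenvalues of [G] on lattice-invariant solutions of [Zbar f = 0].

    These are sections of a line bundle of degree [D = n N] on the elliptic curve
    [C / L_omega].  Fourier expansion along the period [1] determines them by [D]
    coefficients ([theta_unique]).  After moving the fixed point of [A * G] to the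
    origin ([gG_recenter]), [G] acts by rotation by [omega] times a constant, and
    a basis of rotation eigenvectors is explicit.  Let [theta] be the odd theta
    function of [C / L_omega]; it vanishes at the origin to first order and is an
    eigenvector for [omega] ([theta_rot]).  Its translates by the other two fixed
    points of the rotation on the curve are rotation invariant and nonzero at the
    origin.  A product of [a0], [a1], [a2] copies of these three functions is a
    section when [a0 + a1 + a2 = D] and [a1 = a2 mod 3], and has eigenvalue
    [omega ^+ a0].  The exponent [a0] takes each of the [D] values
    [0, ..., D - 2, D] once, and the orders of vanishing being distinct, these
    products form a basis ([theta_space_rot_dim]).  The multiplicity is the number
    of such [a0] in a class modulo three, and the cosines in the formula are the
    values of a function of period three ([cos_chi3]).  Negative [n] follow by
    complex conjugation.

    Frequency [0].  The functions live on the torus [C / L_omega] and the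
    operator is a multiple of the flat Laplacian, so an eigenspace is spanned by
    the exponentials whose frequencies lie in [L_omega'] on a given circle.  [G]
    permutes these exponentials up to signs, through the rotation by a third of
    a turn, with free orbits that have trivial total sign; the invariant functions
    are the signed orbit sums, one for each orbit of three frequencies
    ([flat_has_dim]).

    Fourier analysis is needed for continuous functions only, and the mean over
    a period is taken to be the increment of a primitive.  Smoothness of products,
    exponentials, substitutions and series is proved by coinduction: it suffices to
    exhibit a class of continuous functions that is closed under the three partial
    derivatives ([smooth_coind], [smooth_alg]). *)

Set Implicit Arguments.
Unset Strict Implicit.
Unset Printing Implicit Defensive.

Import Order.TTheory GRing.Theory Num.Theory.
Import numFieldNormedType.Exports.

Local Open Scope classical_set_scope.
Local Open Scope ring_scope.
Local Open Scope complex_scope.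

Local Notation Re := (@complex.Re _).
Local Notation Im := (@complex.Im _).

(** * Curves in the complex plane and the exponential *)

Section ComplexCurves.
Context {R : realType}.
Local Notation C := R[i].

Lemma normc_leD (z : C) : `|z| <= (`|Re z| + `|Im z|)%:C.
Proof.
rewrite normc_def lecR.
have h : 0 <= `|Re z| + `|Im z| by rewrite addr_ge0.
rewrite -(ger0_norm h) -sqrtr_sqr ler_wsqrtr // sqrrD !real_normK ?num_real //.
by rewrite lerD2r lerDl mulrn_wge0 // mulr_ge0.
Qed.

Lemma normc_geIm (z : C) : `|Im z|%:C <= `|z|.
Proof.
rewrite normc_def lecR -sqrtr_sqr ler_wsqrtr // lerDr sqr_ge0 //.
Qed.

Lemma cvg_complexP (T : Type) (F : set_system T) {FF : Filter F} (f : T -> C) (l : C) :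
  (f x @[x --> F] --> l) <->
  ((Re (f x) @[x --> F] --> Re l) /\ (Im (f x) @[x --> F] --> Im l)).
Proof.
split.
  move=> /cvgrPdist_lt fl; split; apply/cvgrPdist_lt => e e0.
    have /fl : 0 < e%:C by rewrite ltcR.
    apply: filterS => x; rewrite -ltcR; apply: le_lt_trans.
    by rewrite -raddfB; exact: normc_ge_Re.
  have /fl : 0 < e%:C by rewrite ltcR.
  apply: filterS => x; rewrite -ltcR; apply: le_lt_trans.
  by rewrite -raddfB; exact: normc_geIm.
move=> [] /cvgrPdist_lt fr /cvgrPdist_lt fi; apply/cvgrPdist_lt => e.
rewrite ltcE /= => /andP[/eqP ie0 e0].
have -> : e = (Re e)%:C by case: e ie0 {e0} => a b /= ->.
have e2 : 0 < Re e / 2 by rewrite divr_gt0.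
apply: filterS2 (fr _ e2) (fi _ e2) => x h1 h2.
apply: le_lt_trans (normc_leD _) _; rewrite ltcR (splitr (Re e)).
by rewrite !raddfB; exact: ltrD h1 h2.
Qed.

Lemma complex_ext (z w : C) : Re z = Re w -> Im z = Im w -> z = w.
Proof. by case: z w => [a b] [c d] /= -> ->. Qed.

Lemma cRe_mul (z w : C) : Re (z * w) = Re z * Re w - Im z * Im w.
Proof. by case: z w => [a b] [c d]. Qed.

Lemma cIm_mul (z w : C) : Im (z * w) = Re z * Im w + Im z * Re w.
Proof. by case: z w => [a b] [c d]. Qed.

Lemma cRe_add (z w : C) : Re (z + w) = Re z + Re w. Proof. by case: z w => [a b] [c d]. Qed.
Lemma cIm_add (z w : C) : Im (z + w) = Im z + Im w. Proof. by case: z w => [a b] [c d]. Qed.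
Lemma cRe_opp (z : C) : Re (- z) = - Re z. Proof. by case: z. Qed.
Lemma cIm_opp (z : C) : Im (- z) = - Im z. Proof. by case: z. Qed.
Lemma cRe_conj (z : C) : Re (z^*) = Re z. Proof. by case: z. Qed.
Lemma cIm_conj (z : C) : Im (z^*) = - Im z. Proof. by case: z. Qed.

Implicit Types (x : R) (u v : R -> C) (z w : C).

(** Rewriting with these reduces an identity between complex expressions to
    identities of real polynomials. *)
Definition creimE := (cRe_mul, cIm_mul, cRe_add, cIm_add, cRe_opp, cIm_opp, cRe_conj, cIm_conj).

(** Real and imaginary parts are differentiated separately, so that the theory
    of [is_derive] for real functions of a real variable applies. *)
Definition cder (u : R -> C) (x : R) (l : C) : Prop :=
  is_derive x 1 (fun s => Re (u s)) (Re l) /\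
  is_derive x 1 (fun s => Im (u s)) (Im l).

Lemma is_derive_ext (f g : R -> R) (x l l' : R) :
  (forall s, f s = g s) -> l = l' -> is_derive x 1 f l -> is_derive x 1 g l'.
Proof. by move=> /funext -> ->. Qed.

Lemma is_derive_extf (f g : R -> R) (x l : R) :
  (forall s, f s = g s) -> is_derive x 1 f l -> is_derive x 1 g l.
Proof. by move=> /funext ->. Qed.

Lemma is_derive_unique (f : R -> R) (x l l' : R) :
  is_derive x 1 f l -> is_derive x 1 f l' -> l = l'.
Proof. by move=> /@derive_val <- /@derive_val <-. Qed.

Lemma cder_ext (u v : R -> C) x l l' :
  (forall s, u s = v s) -> l = l' -> cder u x l -> cder v x l'.
Proof. by move=> /funext -> ->. Qed.

Lemma cder_unique u x l l' : cder u x l -> cder u x l' -> l = l'.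
Proof.
move=> [ur ui] [vr vi]; apply: complex_ext.
  exact: is_derive_unique ur vr.
exact: is_derive_unique ui vi.
Qed.

(** Only the germ matters; this is how the vanishing of a function near a point
    contradicts a nonzero derivative there. *)
Lemma cder_near u v x l : (\forall s \near x, u s = v s) ->
  cder u x l -> cder v x l.
Proof.
move=> uv [ur ui]; split.
  by apply: near_eq_is_derive ur; apply: filterS uv => s ->.
by apply: near_eq_is_derive ui; apply: filterS uv => s ->.
Qed.

Lemma cder_real (f : R -> R) x d : is_derive x 1 f d ->
  cder (fun s => (f s)%:C) x d%:C.
Proof. by move=> fd; split => //=; exact: is_derive_cst. Qed.

Lemma cder_cst (a : C) x : cder (fun=> a) x 0.
Proof. by split; exact: is_derive_cst. Qed.

Lemma cderD u v x a b : cder u x a -> cder v x b ->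
  cder (fun s => u s + v s) x (a + b).
Proof.
move=> [ur ui] [vr vi]; split.
  by apply: is_derive_ext (is_deriveD ur vr) => [s|]; rewrite cRe_add.
by apply: is_derive_ext (is_deriveD ui vi) => [s|]; rewrite cIm_add.
Qed.

Lemma cderM u v x a b : cder u x a -> cder v x b ->
  cder (fun s => u s * v s) x (a * v x + u x * b).
Proof.
move=> [ur ui] [vr vi]; split.
  apply: is_derive_ext (is_deriveB (is_deriveM ur vr) (is_deriveM ui vi)) => [s|].
    by rewrite cRe_mul.
  by rewrite !creimE /GRing.scale /=; ring.
apply: is_derive_ext (is_deriveD (is_deriveM ur vi) (is_deriveM ui vr)) => [s|].
  by rewrite cIm_mul.
by rewrite !creimE /GRing.scale /=; ring.
Qed.

Lemma cderZ (k : C) u x a : cder u x a -> cder (fun s => k * u s) x (k * a).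
Proof.
move=> ua; apply: cder_ext (cderM (cder_cst k x) ua) => //.
by rewrite mul0r add0r.
Qed.

Lemma cderN u x a : cder u x a -> cder (fun s => - u s) x (- a).
Proof.
by move=> ua; apply: cder_ext (cderZ (-1) ua) => [s|]; rewrite mulN1r.
Qed.

Lemma cderB u v x a b : cder u x a -> cder v x b ->
  cder (fun s => u s - v s) x (a - b).
Proof. by move=> ua vb; exact: cderD ua (cderN vb). Qed.

Lemma cderJ u x a : cder u x a -> cder (fun s => (u s)^*) x (a^*).
Proof.
move=> [ur ui]; split.
  by apply: is_derive_ext ur => [s|]; rewrite cRe_conj.
apply: (@is_derive_extf (- (fun s => Im (u s)))).
- by move=> s; rewrite cIm_conj.
- by rewrite cIm_conj; apply: is_derive_eq.
Qed.

Lemma cder_comp u (g : R -> R) x l d : cder u (g x) l -> is_derive x 1 g d ->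
  cder (fun s => u (g s)) x (d%:C * l).
Proof.
move=> [ur ui] gd; split.
  apply: (is_derive_ext _ _ (is_derive1_comp ur gd)) => //.
  by rewrite !creimE /=; ring.
apply: (is_derive_ext _ _ (is_derive1_comp ui gd)) => //.
by rewrite !creimE /=; ring.
Qed.

Lemma is_derive_affine (k a x : R) : is_derive x 1 (fun s => k * s + a) k.
Proof.
apply: (@is_derive_extf (k \*: id + cst a)) => //.
by apply: is_derive_eq; rewrite /GRing.scale /= mulr1 addr0.
Qed.

Lemma cder_affine u k a x l : cder u (k * x + a) l ->
  cder (fun s => u (k * s + a)) x (k%:C * l).
Proof. by move=> ul; exact: (@cder_comp u (fun s => k * s + a) x l k ul (is_derive_affine k a x)). Qed.

Lemma cder_shift u a x l : cder u (x + a) l -> cder (fun s => u (s + a)) x l.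
Proof.
move=> ul; have : cder u (1 * x + a) l by rewrite mul1r.
move=> /cder_affine; apply: cder_ext => [s|]; by rewrite mul1r.
Qed.

Definition cexp (z : C) : C := (expR (Re z))%:C * expi (Im z).

Lemma expiD (a b : R) : expi (a + b) = expi a * expi b.
Proof.
by apply: complex_ext; rewrite !creimE /expi /= ?cosD ?sinD ?mulrN; ring.
Qed.

Lemma expi0 : expi 0 = 1 :> C. Proof. by rewrite /expi cos0 sin0. Qed.

Lemma cexpD z w : cexp (z + w) = cexp z * cexp w.
Proof. by rewrite /cexp !creimE expRD expiD rmorphM /=; ring. Qed.

Lemma cexp0 : cexp 0 = 1. Proof. by rewrite /cexp /= expR0 expi0 mul1r. Qed.

Lemma cexp_neq0 z : cexp z != 0.
Proof.
apply/eqP => z0; have := cexpD z (- z); rewrite subrr z0 mul0r cexp0.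
by move/eqP; rewrite oner_eq0.
Qed.

Lemma cexpN z : cexp (- z) = (cexp z)^-1.
Proof.
apply: (mulIf (cexp_neq0 z)); rewrite -cexpD addNr cexp0 mulVf //.
exact: cexp_neq0.
Qed.

Lemma cexpMn z n : cexp (z *+ n) = cexp z ^+ n.
Proof.
by elim: n => [|n IH]; rewrite ?mulr0n ?cexp0 // mulrS cexpD IH exprS.
Qed.

Lemma cexp_i (a : R) : cexp ('i * a%:C) = expi a.
Proof.
by rewrite /cexp !creimE /= !(mul0r, mul1r, mulr0, subr0, addr0, add0r) oppr0 expR0 mul1r.
Qed.

Lemma cder_cexp u x l : cder u x l ->
  cder (fun s => cexp (u s)) x (l * cexp (u x)).
Proof.
move=> [ur ui].
have e1 := cder_real (is_derive1_comp (is_derive_expR (Re (u x))) ur).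
have e2 : cder expi (Im (u x)) ('i * expi (Im (u x))).
  split => /=.
    apply: is_derive_ext (is_derive_cos _) => //; ring.
  apply: is_derive_ext (is_derive_sin _) => //; ring.
have e3 := cder_comp e2 ui.
apply: cder_ext (cderM e1 e3) => //=.
rewrite /cexp; apply: complex_ext; rewrite !creimE /=; ring.
Qed.

Lemma norm_expi a : `|expi a| = 1 :> C.
Proof. by rewrite normc_def /= cos2Dsin2 sqrtr1. Qed.

Lemma cder_cont u x l : cder u x l -> {for x, continuous u}.
Proof.
move=> [ur ui]; apply/cvg_complexP; split.
  by apply: differentiable_continuous; apply/derivable1_diffP; case: ur.
by apply: differentiable_continuous; apply/derivable1_diffP; case: ui.
Qed.

Lemma cder0_cst u : (forall x, cder u x 0) -> forall x y, u x = u y.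
Proof.
move=> h x y; apply: complex_ext.
  by apply: (@is_derive_0_is_cst _ (fun s => Re (u s))) => z; case: (h z).
by apply: (@is_derive_0_is_cst _ (fun s => Im (u s))) => z; case: (h z).
Qed.

Lemma is_derive_bound (f df : R -> R) a b M : a <= b ->
  (forall x, a <= x <= b -> is_derive x 1 f (df x)) ->
  (forall x, a <= x <= b -> `|df x| <= M) ->
  `|f b - f a| <= M * (b - a).
Proof.
move=> ab fd dM; have [c cab ->] : exists2 c, c \in `[a, b] &
    f b - f a = df c * (b - a).
  apply: MVT_segment => // [x xab|].
    by apply: fd; move: xab; rewrite in_itv /= => /andP[/ltW-> /ltW->].
  apply: derivable_within_continuous => x xab.
  have [] // := fd x; by move: xab; rewrite in_itv.
rewrite normrM (ger0_norm (_ : 0 <= b - a)) ?subr_ge0 //.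
by apply: ler_wpM2r; rewrite ?subr_ge0 // dM // ; move: cab; rewrite in_itv.
Qed.

End ComplexCurves.

(** * Primitives and means over a period *)

Section Primitives.
Context {R : realType}.
Local Notation C := R[i].
Implicit Types (x : R) (u v : R -> C) (z w : C).

Lemma primitive_right (f : R -> R) (a : R) : continuous f ->
  exists F, forall x, a < x -> is_derive x 1 F (f x).
Proof.
move=> cf.
pose F x : R := (\int[@lebesgue_measure R]_(t in [set` `[a, x]]) (f t))%R.
exists F => x ax.
have int_f : (@lebesgue_measure R).-integrable `[a, x + 1] (EFin \o f).
  apply: continuous_compact_integrable; first exact: segment_compact.
  exact: continuous_subspaceT.
have [dF F'] := @continuous_FTC1_closed _ f a x (x + 1)
  (ltr_pwDr ltr01 (lexx x)) int_f ax (cf x).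
by rewrite -F' derive1E; exact: derivableP.
Qed.

(** Integration from a base point gives a primitive to the right of it only.
    Primitives with base points that tend to minus infinity, normalized to vanish
    at [0], agree where both are defined, and so glue. *)
Lemma ex_primitive (f : R -> R) : continuous f ->
  exists F, forall x, is_derive x 1 F (f x).
Proof.
move=> cf.
have /choice[G GP] : forall a : R, exists F : R -> R,
    F 0 = 0 /\ (forall x, - `|a| - 1 < x -> is_derive x 1 F (f x)).
  move=> a; have [F FP] := primitive_right (- `|a| - 1) cf.
  exists (fun x => F x - F 0); split; first by rewrite subrr.
  move=> x /FP Fx; apply: (@is_derive_extf _ (F - cst (F 0))) => //.
  by apply: is_derive_eq; rewrite subr0.
have GE a b x : `|a| <= `|b| -> - `|a| - 1 < x -> G a x = G b x.
  move=> ab ax; have [Ga0 Ga] := GP a; have [Gb0 Gb] := GP b.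
  have dd y : - `|a| - 1 < y -> is_derive y 1 (G a - G b) 0.
    move=> ay; have := Ga _ ay; have yb : - `|b| - 1 < y by lra.
    have := Gb _ yb => d1 d2; apply: is_derive_eq; rewrite subrr //.
  have a1 : 0 <= `|a| := normr_ge0 a.
  suff : `|(G a - G b) x - (G a - G b) 0| <= 0.
    rewrite normr_le0 /= !fctE Ga0 Gb0 subr0 subr0 subr_eq0 => /eqP //.
  have [x0|x0] := leP 0 x.
    have := @is_derive_bound _ (G a - G b) (cst 0) 0 x 0 x0.
    rewrite mul0r; apply.
      by move=> y /andP[y0 _]; apply: dd; lra.
    by move=> y _; rewrite normr0.
  have := @is_derive_bound _ (G a - G b) (cst 0) x 0 0 (ltW x0).
  rewrite mul0r distrC; apply.
    by move=> y /andP[y0 _]; apply: dd; lra.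
  by move=> y _; rewrite normr0.
exists (fun x => G x x) => x.
pose b := `|x| + 1.
have nb : `|b| = `|x| + 1 by rewrite ger0_norm // addr_ge0.
have xx : - `|x| <= x by rewrite lerNl -normrN ler_norm.
apply: (@near_eq_is_derive _ _ _ (G b)); last first.
  by have [_] := GP b; apply; rewrite nb; lra.
near=> s.
have sx : `|x - s| < 1.
  by near: s; apply: (@cvgr_dist_lt _ _ _ (nbhs x)) => //; exact: cvg_id.
have ss : - `|s| <= s by rewrite lerNl -normrN ler_norm.
rewrite (GE s b) //; last lra.
rewrite nb; have := ler_normD (s - x) x; rewrite subrK => h.
apply: le_trans h _; rewrite addrC lerD2l distrC; exact: ltW.
Unshelve. all: by end_near.
Qed.

Lemma ex_cprimitive u : continuous u -> exists U, forall x, cder U x (u x).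
Proof.
move=> cu.
have [F FP] : exists F, forall x, is_derive x 1 F (Re (u x)).
  by apply: ex_primitive => x; case/cvg_complexP : (cu x).
have [G GP] : exists F, forall x, is_derive x 1 F (Im (u x)).
  by apply: ex_primitive => x; case/cvg_complexP : (cu x).
by exists (fun x => F x +i* G x) => x; split; [exact: FP | exact: GP].
Qed.

Definition cprim u : R -> C := xget (fun=> 0) [set U | forall x, cder U x (u x)].

Lemma cprimP u : continuous u -> forall x, cder (cprim u) x (u x).
Proof. by case/ex_cprimitive => U UP; rewrite /cprim; case: xgetP => // /(_ U). Qed.

(** The mean over [[0, 1]] as the increment of a primitive: linearity, invariance
    under translation and bounds all follow by differentiation. *)
Definition mean u : C := cprim u 1 - cprim u 0.

Lemma mean_eq u U : (forall x, cder U x (u x)) -> mean u = U 1 - U 0.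
Proof.
move=> UP; have cP : forall x, cder (cprim u) x (u x).
  by rewrite /cprim; case: xgetP => // /(_ U).
rewrite /mean; apply/eqP; rewrite -subr_eq0; apply/eqP.
transitivity ((cprim u 1 - U 1) - (cprim u 0 - U 0)); first by ring.
apply/eqP; rewrite subr_eq0; apply/eqP.
apply: (@cder0_cst _ (fun s => cprim u s - U s)) => x.
by apply: cder_ext (cderB (cP x) (UP x)); rewrite ?subrr.
Qed.

Lemma meanD u v : continuous u -> continuous v ->
  mean (fun x => u x + v x) = mean u + mean v.
Proof.
move=> cu cv; rewrite (@mean_eq _ (fun x => cprim u x + cprim v x)).
  by rewrite /mean; ring.
by move=> x; apply: cderD; exact: cprimP.
Qed.

Lemma meanZ (k : C) u : continuous u -> mean (fun x => k * u x) = k * mean u.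
Proof.
move=> cu; rewrite (@mean_eq _ (fun x => k * cprim u x)).
  by rewrite /mean; ring.
by move=> x; apply: cderZ; exact: cprimP.
Qed.

Lemma mean_period u x : continuous u -> (forall y, u (y + 1) = u y) ->
  cprim u (x + 1) - cprim u x = mean u.
Proof.
move=> cu pu; rewrite /mean -[X in cprim u X - cprim u 0]add0r.
apply: (@cder0_cst _ (fun x => cprim u (x + 1) - cprim u x)) => y.
apply: cder_ext (cderB (cder_shift (cprimP cu (y + 1))) (cprimP cu y)) => //.
by rewrite pu subrr.
Qed.

Lemma mean_shift u a : continuous u -> (forall y, u (y + 1) = u y) ->
  mean (fun x => u (x + a)) = mean u.
Proof.
move=> cu pu; rewrite -(mean_period a cu pu).
rewrite (@mean_eq _ (fun x => cprim u (x + a))); last first.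
  by move=> x; apply: cder_shift; exact: cprimP.
by rewrite add0r [1 + a]addrC.
Qed.

Lemma mean_bound u M : continuous u ->
  (forall x, 0 <= x <= 1 -> `|Re (u x)| <= M /\ `|Im (u x)| <= M) ->
  `|Re (mean u)| <= M /\ `|Im (mean u)| <= M.
Proof.
move=> cu uM; rewrite /mean !creimE; split.
  have := @is_derive_bound _ (fun s => Re (cprim u s)) (fun s => Re (u s)) 0 1 M.
  rewrite subr0 mulr1; apply=> //.
    by move=> x _; case: (cprimP cu x).
  by move=> x /uM[].
have := @is_derive_bound _ (fun s => Im (cprim u s)) (fun s => Im (u s)) 0 1 M.
rewrite subr0 mulr1; apply=> //.
  by move=> x _; case: (cprimP cu x).
by move=> x /uM[].
Qed.

End Primitives.

(** * Fourier coefficients determine a continuous periodic function *)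

Section CContinuity.
Context {R : realType}.
Local Notation C := R[i].

Section Filter.
Context {T : Type} (F : set_system T) {FF : Filter F}.
Implicit Types (f g : T -> C).

Lemma cvg_cM f g (k l : C) : f x @[x --> F] --> k -> g x @[x --> F] --> l ->
  f x * g x @[x --> F] --> k * l.
Proof.
move=> /cvg_complexP[fr fi] /cvg_complexP[gr gi]; apply/cvg_complexP; split.
  rewrite cRe_mul; under eq_fun do rewrite cRe_mul.
  by apply: cvgB; apply: cvgM.
rewrite cIm_mul; under eq_fun do rewrite cIm_mul.
by apply: cvgD; apply: cvgM.
Qed.

Lemma cvg_cD f g (k l : C) : f x @[x --> F] --> k -> g x @[x --> F] --> l ->
  f x + g x @[x --> F] --> k + l.
Proof.
move=> /cvg_complexP[fr fi] /cvg_complexP[gr gi]; apply/cvg_complexP; split.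
  by rewrite cRe_add; under eq_fun do rewrite cRe_add; apply: cvgD.
by rewrite cIm_add; under eq_fun do rewrite cIm_add; apply: cvgD.
Qed.

Lemma cvg_creal (f : T -> R) (l : R) : f x @[x --> F] --> l ->
  (f x)%:C @[x --> F] --> l%:C.
Proof. by move=> fl; apply/cvg_complexP; split => //=; exact: cvg_cst. Qed.

Lemma cvg_cexpi (f : T -> R) (l : R) : f x @[x --> F] --> l ->
  expi (f x) @[x --> F] --> expi l.
Proof.
move=> fl; apply/cvg_complexP; split => /=.
  by apply: (@continuous_cvg _ _ _ _ _ f (@cos R)) fl; exact: continuous_cos.
by apply: (@continuous_cvg _ _ _ _ _ f (@sin R)) fl; exact: continuous_sin.
Qed.

Lemma cvg_ccexp f (l : C) : f x @[x --> F] --> l ->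
  cexp (f x) @[x --> F] --> cexp l.
Proof.
move=> /cvg_complexP[fr fi]; apply: cvg_cM; last exact: cvg_cexpi.
by apply: cvg_creal; apply: (@continuous_cvg _ _ _ _ _ (fun x => Re (f x)) (@expR R)) fr; exact: continuous_expR.
Qed.

Lemma cvg_cJ f (l : C) : f x @[x --> F] --> l -> (f x)^* @[x --> F] --> l^*.
Proof.
move=> /cvg_complexP[fr fi]; apply/cvg_complexP; split.
  by rewrite cRe_conj; under eq_fun do rewrite cRe_conj.
by rewrite cIm_conj; under eq_fun do rewrite cIm_conj; exact: cvgN.
Qed.

End Filter.

Implicit Types (x : R) (u v : R -> C).

Lemma mean_lin3 (a b c : C) u v (w : R -> C) :
  continuous u -> continuous v -> continuous w ->
  mean (fun x => (a * u x + b * v x) + c * w x) =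
  (a * mean u + b * mean v) + c * mean w.
Proof.
move=> cu cv cw.
have cz (k : C) (f : R -> C) : continuous f -> continuous (fun x => k * f x).
  by move=> cf x; apply: cvg_cM; [exact: cvg_cst|exact: cf].
rewrite (@meanD _ (fun x => a * u x + b * v x) (fun x => c * w x)).
- rewrite (@meanD _ (fun x => a * u x) (fun x => b * v x)); try exact: cz.
  by rewrite (meanZ _ cu) (meanZ _ cv) (meanZ _ cw).
- by move=> x; apply: cvg_cD; exact: cz.
- exact: cz.
Qed.

Lemma continuous_shift u (a : R) : continuous u -> continuous (fun x => u (x + a)).
Proof.
move=> cu x; apply: (@continuous_comp _ _ _ (fun x => x + a) u); last exact: cu.
by apply: cvgD; [exact: cvg_id | exact: cvg_cst].
Qed.

Lemma is_derive_ge (f df : R -> R) a b M : a <= b ->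
  (forall x, a <= x <= b -> is_derive x 1 f (df x)) ->
  (forall x, a <= x <= b -> M <= df x) ->
  M * (b - a) <= f b - f a.
Proof.
move=> ab fd dM; have [c cab ->] : exists2 c, c \in `[a, b] &
    f b - f a = df c * (b - a).
  apply: MVT_segment => // [x xab|].
    by apply: fd; move: xab; rewrite in_itv /= => /andP[/ltW-> /ltW->].
  apply: derivable_within_continuous => x xab.
  have [] // := fd x; by move: xab; rewrite in_itv.
by apply: ler_wpM2r; rewrite ?subr_ge0 // dM //; move: cab; rewrite in_itv.
Qed.

Lemma continuous_linear (k : R) : continuous (fun x : R => k * x).
Proof. by move=> x; apply: cvgM; [exact: cvg_cst | exact: cvg_id]. Qed.

Lemma continuous_expi (k : R) : continuous (fun x : R => expi (k * x) : C).
Proof. by move=> x; apply: cvg_cexpi; exact: continuous_linear. Qed.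

Lemma expi_2pi (m : int) : expi (2 * pi * m%:~R) = 1 :> C.
Proof.
have h n : expi (2 * pi * n%:R) = 1 :> C.
  rewrite -[X in expi X]add0r /expi.
  have -> : 2 * pi * n%:R = (pi *+ 2) *+ n :> R by rewrite -mulr_natr -[pi *+ 2]mulr_natr; ring.
  by rewrite (periodicn (@cosD2pi R)) (periodicn (@sinD2pi R)) cos0 sin0.
case: m => n; first exact: h.
rewrite NegzE mulrNz mulrN; apply: (mulIf (expi_neq0 (2 * pi * n.+1%:~R))).
by rewrite -expiD addNr expi0 mul1r h.
Qed.

Definition fmode (m : int) x : C := expi (2 * pi * m%:~R * x).

Lemma fmode_period m x : fmode m (x + 1) = fmode m x.
Proof. by rewrite /fmode mulrDr mulr1 expiD expi_2pi mulr1. Qed.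

Lemma fmodeD m n x : fmode (m + n) x = fmode m x * fmode n x.
Proof. by rewrite /fmode -expiD; congr expi; rewrite intrD; ring. Qed.

Lemma fmode_cont m : continuous (fmode m).
Proof. exact: continuous_expi. Qed.

Lemma cos_fmode x : (cos (2 * pi * x))%:C = (fmode 1 x + fmode (-1) x) / 2 :> C.
Proof.
rewrite /fmode; have -> : 2 * pi * (-1)%:~R * x = - (2 * pi * x) :> R by ring.
have -> : 2 * pi * 1%:~R * x = 2 * pi * x :> R by ring.
have -> : expi (- (2 * pi * x)) = (expi (2 * pi * x))^* :> C.
  by rewrite /expi cosN sinN.
have h2 (a : C) : (2 * a) / 2 = a by field.
rewrite addcJ; exact: esym (h2 _).
Qed.

Section Uniqueness.
Variable u : R -> C.
Hypothesis cu : continuous u.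
Hypothesis pu : forall x, u (x + 1) = u x.
Hypothesis u0 : forall m, mean (fun x => fmode m x * u x) = 0.

Let Tk (c : R) x := cos (2 * pi * x) + c.

Let Tk_cont c : continuous (Tk c).
Proof.
move=> x; apply: cvgD; last exact: cvg_cst.
by apply: (@continuous_cvg _ _ _ _ _ ( *%R (2 * pi)) (@cos R)); [exact: continuous_cos | exact: continuous_linear].
Qed.

Let TkX_cont c n : continuous (fun x => Tk c x ^+ n).
Proof.
move=> x; elim: n => [|n IH].
  have -> : (fun x => Tk c x ^+ 0) = (fun=> 1) by apply/funext => y; rewrite expr0.
  exact: cvg_cst.
have -> : (fun x => Tk c x ^+ n.+1) = (fun x => Tk c x * Tk c x ^+ n).
  by apply/funext => y; rewrite exprS.
by apply: cvgM IH; exact: Tk_cont.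
Qed.

Let Tk_period c x : Tk c (x + 1) = Tk c x.
Proof.
rewrite /Tk mulrDr mulr1; have -> : 2 * pi = pi *+ 2 :> R by rewrite mulr_natl.
by rewrite cosD2pi.
Qed.

Let cont_term c n m : continuous (fun x => fmode m x * ((Tk c x ^+ n)%:C * u x)).
Proof.
move=> x; apply: cvg_cM; first exact: fmode_cont.
by apply: cvg_cM; [apply: cvg_creal; exact: TkX_cont | exact: cu].
Qed.

Let mean_Tk c n m : mean (fun x => fmode m x * ((Tk c x ^+ n)%:C * u x)) = 0.
Proof.
elim: n m => [|n IH] m.
  by rewrite -[RHS](u0 m); congr mean; apply/funext => x; rewrite expr0 mul1r.
have -> : (fun x => fmode m x * ((Tk c x ^+ n.+1)%:C * u x)) =
  (fun x => (2^-1 * (fmode (m + 1) x * ((Tk c x ^+ n)%:C * u x)) +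
            2^-1 * (fmode (m - 1) x * ((Tk c x ^+ n)%:C * u x))) +
            c%:C * (fmode m x * ((Tk c x ^+ n)%:C * u x))).
  apply/funext => x; rewrite exprS rmorphM /= {1}/Tk rmorphD /= cos_fmode !fmodeD.
  by field.
rewrite (mean_lin3 _ _ _ (@cont_term c n (m + 1)) (@cont_term c n (m - 1)) (@cont_term c n m)).
by rewrite !IH !mulr0 !addr0.
Qed.

(** The trigonometric polynomial [T] with value [cos (2 pi x) + 1 - cos (2 pi d)]
    exceeds [1] exactly for [x] within [d] of an integer, and [u * T ^+ n] has mean
    zero for every [n].  If [Re u] were positive near [0], the part of the mean near
    [0] would grow geometrically in [n] while the rest stays bounded. *)
Lemma fourier_Re_le0 : Re (u 0) <= 0.
Proof.
rewrite leNgt; apply/negP => u_gt0.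
have cRe : continuous (fun x => Re (u x)) by move=> x; have /cvg_complexP[] := cu (x:=x).
pose e := Re (u 0) / 2; have e0 : 0 < e by rewrite divr_gt0.
have /cvgr_dist_lt/(_ e e0)/nbhs_ballP[d0 /= d0_gt0 near0] := cRe 0.
(* [Re u] is at least half its value at [0] within [d] of [0]; the bound [1 / 8] keeps
   the cosine monotone on the range in question. *)
pose d := Num.min (d0 / 2) (1 / 8).
have d_gt0 : 0 < d by rewrite lt_min !divr_gt0.
have dd0 : d < d0 by rewrite /d gt_min; apply/orP; left; lra.
have d8 : d <= 1 / 8 by rewrite /d ge_min lexx orbT.
have eu x : `|x| <= d -> e <= Re (u x).
  move=> xd; have := near0 x; rewrite /ball /= sub0r normrN => /(_ (le_lt_trans xd dd0)).
  rewrite ltr_norml => /andP[h1 h2]; have : Re (u 0) = e + e by rewrite /e -splitr.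
  lra.
have [B B0 uB] : exists2 B, 0 < B & forall x, 0 <= x <= 1 -> `|Re (u x)| <= B.
  have ab : continuous (fun x => `|Re (u x)|).
    by move=> x; apply: cvg_norm; exact: cRe.
  have [c _ cm] := EVT_max ler01 (continuous_subspaceT ab).
  exists (`|Re (u c)| + 1); first by rewrite ltr_wpDl.
  by move=> x x01; apply: le_trans (cm x _) _; rewrite ?in_itv // lerDl.
pose c := 1 - cos (2 * pi * d).
have pi2 : 0 < 2 * pi :> R by rewrite mulr_gt0 // pi_gt0.
have twopi_itv (z : R) : 0 <= z -> z <= 1 / 2 -> 2 * pi * z \in `[0, pi].
  move=> z0 z1; rewrite in_itv /= mulr_ge0 ?(ltW pi2) //=.
  have -> : 2 * pi * z = pi * (2 * z) by ring.
  by apply: ler_piMr; [exact: pi_ge0 | lra].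
have cos_le (x y : R) : 0 <= x -> x <= y -> y <= 1/2 -> cos (2 * pi * y) <= cos (2 * pi * x) :> R.
  move=> x0 xy y1; have [->|xny] := eqVneq x y; first exact: lexx.
  have x1 : x <= 1 / 2 by exact: le_trans y1.
  have y0 : 0 <= y by exact: le_trans xy.
  have hx := @twopi_itv x x0 x1; have hy := @twopi_itv y y0 y1.
  apply/ltW; rewrite (ltr_cos hx hy).
  by rewrite ltr_pM2l // lt_neqAle xny.
pose q := cos (2 * pi * (d / 2)) - cos (2 * pi * d).
have q_gt0 : 0 < q.
  have h1 : 2 * pi * d \in `[0, pi] by apply: twopi_itv; lra.
  have h2 : 2 * pi * (d / 2) \in `[0, pi] by apply: twopi_itv; lra.
  by rewrite subr_gt0 (ltr_cos h2 h1) ltr_pM2l //; lra.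
have cosE (x : R) : cos (2 * pi * x) = cos (2 * pi * `|x|) :> R.
  have [x0|x0] := leP 0 x; first by rewrite ger0_norm.
  by rewrite ltr0_norm // mulrN cosN.
have T1 x : `|x| <= d -> 1 <= Tk c x.
  move=> xd; rewrite /Tk cosE /c.
  have := cos_le `|x| d (normr_ge0 _) xd; lra.
have Tq x : `|x| <= d / 2 -> 1 + q <= Tk c x.
  move=> xd; rewrite /Tk cosE /c /q.
  have := cos_le `|x| (d / 2) (normr_ge0 _) xd; lra.
have TB x : d <= x <= 1 - d -> `|Tk c x| <= 1.
  move=> /andP[dx xd]; have := cos_geN1 (2 * pi * x); have := cos_le1 (2 * pi * d).
  move=> k1 k2.
  have h : cos (2 * pi * x) <= cos (2 * pi * d) :> R.
    have [x2|x2] := leP x (1/2); first by apply: cos_le => //; exact: ltW.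
    rewrite -(cosN (2 * pi * x)) -(cosD2pi (- (2 * pi * x))).
    have -> : - (2 * pi * x) + pi *+ 2 = 2 * pi * (1 - x) :> R.
      by rewrite -mulr_natl; ring.
    by apply: cos_le; lra.
  by rewrite ler_norml /Tk /c; apply/andP; split; lra.
pose U n := cprim (fun x => fmode 0 x * ((Tk c x ^+ n)%:C * u x)).
(* [W n] is a primitive of [T ^+ n * Re u], whose increment over a period is zero. *)
pose W n x := Re (U n x).
have dW n x : is_derive x 1 (W n) (Tk c x ^+ n * Re (u x)).
  have [+ _] := cprimP (@cont_term c n 0) x.
  rewrite {2}/fmode !(mulr0z, mulr0, mul0r) expi0 mul1r cRe_mul /= mul0r subr0; exact.
have pW n : W n (1 - d) = W n (- d).
  have := @mean_period _ _ (- d) (@cont_term c n 0).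
  rewrite mean_Tk => h; rewrite /W; apply/eqP; rewrite -subr_eq0.
  rewrite -cRe_opp -cRe_add [1 - d]addrC /U h // => y.
  by rewrite fmode_period Tk_period pu.
have up n : - B <= W n (1 - d) - W n d.
  have := @is_derive_bound _ (W n) _ d (1 - d) B _ (fun x _ => dW n x).
  have -> : d <= 1 - d by lra.
  move=> /(_ isT) h; have {}h : `|W n (1 - d) - W n d| <= B * (1 - d - d).
    apply: h => x xd; rewrite normrM normrX -[leRHS]mul1r ler_pM ?exprn_ge0 //.
      by apply: exprn_ile1 => //; exact: TB.
    by apply: uB; lra.
  have : B * (1 - d - d) <= B by rewrite ler_piMr ?(ltW B0) //; lra.
  by move: h; rewrite ler_norml => /andP[h _]; lra.
have pos n a b : - d <= a -> a <= b -> b <= d -> 0 <= W n b - W n a.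
  move=> da ab bd; have := @is_derive_ge (W n) _ a b 0 ab (fun x _ => dW n x).
  rewrite mul0r; apply=> x /andP[ax xb].
  have xd : `|x| <= d by rewrite ler_norml; apply/andP; split; lra.
  rewrite mulr_ge0 ?exprn_ge0 //; first by apply: le_trans ler01 _; exact: T1.
  by apply: le_trans (ltW e0) _; exact: eu.
have big n : (1 + q) ^+ n * e * d <= W n (d / 2) - W n (- (d / 2)).
  have h1 : - (d / 2) <= d / 2 by lra.
  have := @is_derive_ge (W n) _ _ _ ((1 + q) ^+ n * e) h1 (fun x _ => dW n x).
  have -> : d / 2 - - (d / 2) = d by lra.
  apply=> x /andP[x1 x2].
  have xd : `|x| <= d / 2 by rewrite ler_norml; apply/andP; split; lra.
  have q1 : 0 <= 1 + q by lra.
  rewrite ler_pM ?exprn_ge0 ?(ltW e0) //.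
    by apply: lerXn2r; rewrite ?nnegrE ?Tq //; apply: le_trans (Tq _ xd).
  by apply: eu; lra.
have bern n : 1 + n%:R * q <= (1 + q) ^+ n.
  elim: n => [|n IH]; first by rewrite mul0r addr0 expr0.
  rewrite exprS; have : (1 + q) * (1 + n%:R * q) <= (1 + q) * (1 + q) ^+ n.
    by apply: ler_wpM2l => //; lra.
  have : 0 <= n%:R * q * q by rewrite !mulr_ge0 ?(ltW q_gt0).
  rewrite -natr1; nra.
(* Bernoulli: the growth is at least linear in [n], against the fixed bound [B]. *)
have fin n : n%:R * (q * e * d) <= B.
  have := big n; have := pos n (- d) (- (d / 2)); have := pos n (d / 2) d.
  have := up n; rewrite pW.
  have : 0 <= e * d by rewrite mulr_ge0 ?ltW.
  move=> ed u1 u2 u3 u4.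
  have : n%:R * q * (e * d) <= (1 + q) ^+ n * (e * d).
    by apply: ler_wpM2r => //; have := bern n; lra.
  have := u2 ltac:(lra) ltac:(lra) ltac:(lra).
  have := u3 ltac:(lra) ltac:(lra) ltac:(lra).
  rewrite !mulrA in u4 *; lra.
have k0 : 0 < q * e * d by rewrite !mulr_gt0.
have := fin (Num.bound (B / (q * e * d))).
have := archi_boundP (ltW (divr_gt0 B0 k0)).
by rewrite ltr_pdivrMr // => /lt_le_trans h /h; rewrite ltxx.
Qed.

End Uniqueness.

(** [fourier_Re_le0], applied to the translates of [k * u], bounds [Re (k * u a)] by
    zero for [k = 1, -1, i, -i]. *)
Theorem fourier_unique u : continuous u -> (forall x, u (x + 1) = u x) ->
  (forall m, mean (fun x => fmode m x * u x) = 0) -> forall x, u x = 0.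
Proof.
move=> cu pu u0 a.
have main (k : C) : Re (k * u a) <= 0.
  have cs : continuous (fun x => u (x + a)).
    exact: continuous_shift.
  have ck : continuous (fun x => k * u (x + a)).
    by move=> x; apply: cvg_cM; [exact: cvg_cst|exact: cs].
  have := @fourier_Re_le0 (fun x => k * u (x + a)) ck.
  rewrite add0r; apply=> [x|m].
    by rewrite addrAC pu.
  have -> : (fun x => fmode m x * (k * u (x + a))) =
     (fun x => (k * fmode m (- a)) * ((fun x => fmode m x * u x) (x + a))).
    apply/funext => x /=; rewrite -[fmode m x](_ : fmode m (x + a) * fmode m (- a) = _).
      by ring.
    by rewrite /fmode -expiD; congr expi; ring.
  have cm : continuous (fun x => fmode m x * u x).
    by move=> x; apply: cvg_cM; [exact: fmode_cont|exact: cu].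
  rewrite (meanZ _ (@continuous_shift _ a cm)).
  rewrite (mean_shift a cm) ?u0 ?mulr0 // => y.
  by rewrite fmode_period pu.
have := main 1; have := main (-1); have := main 'i; have := main (- 'i).
rewrite !creimE /= !(mul1r, mul0r, oppr0, sub0r, opprK, mulN1r, subr0) => h1 h2 h3 h4.
apply: complex_ext => /=; lra.
Qed.

End CContinuity.

(** * Differentiation under the mean *)

Section MeanDerivative.
Context {R : realType}.
Local Notation C := R[i].
Implicit Types (x : R) (u v : R -> C).

(** Being an inequality, a quadratic error bound passes to means and to sums of
    series; this is how derivatives are taken under both. *)
Lemma is_derive_quad (f : R -> R) x l M :
  (forall h, `|h| <= 1 -> `|f (x + h) - f x - h * l| <= M * h ^+ 2) ->
  is_derive x 1 f l.
Proof.
move=> fM.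
have M0 : 0 <= M.
  by have := fM 1; rewrite normr1 expr1n mulr1 => /(_ (lexx _)); apply: le_trans.
suff fl : h^-1 *: (f (h *: (1 : R) + x) - f x) @[h --> (0 : R)^'] --> l.
  by apply: DeriveDef; [exact: cvgP fl | exact: cvg_lim fl].
apply/cvgrPdist_le => e e0; near=> h.
have h0 : h != 0 by near: h; exact: nbhs_dnbhs_neq.
have h1 : `|h| <= 1.
  by near: h; apply: (@cvgr0_norm_le _ _ _ (0 : R)^' _ id) => //; exact: nbhs_dnbhs.
have hM : `|h| <= e / (M + 1).
  near: h; apply: (@cvgr0_norm_le _ _ _ (0 : R)^' _ id); first exact: nbhs_dnbhs.
  by rewrite divr_gt0 // ltr_wpDl.
have -> : l - h^-1 *: (f (h *: 1 + x) - f x) = - h^-1 * (f (x + h) - f x - h * l).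
  have -> : h *: 1 + x = x + h by rewrite /GRing.scale /= mulr1 addrC.
  by rewrite /GRing.scale /=; field.
rewrite normrM normrN normrV ?unitfE // mulrC ler_pdivrMr ?normr_gt0 //.
apply: le_trans (fM _ h1) _; rewrite -[h ^+ 2]real_normK ?num_real // expr2 mulrA.
apply: ler_wpM2r => //; move: hM; rewrite ler_pdivlMr; last by rewrite ltr_wpDl.
apply: le_trans; rewrite mulrC ler_wpM2l // lerDl //.
Unshelve. all: by end_near. Qed.

Lemma cder_quad u x l M :
  (forall h, `|h| <= 1 -> `|Re (u (x + h) - u x - h%:C * l)| <= M * h ^+ 2 /\
     `|Im (u (x + h) - u x - h%:C * l)| <= M * h ^+ 2) ->
  cder u x l.
Proof.
move=> uM; split; apply: (@is_derive_quad _ _ _ M) => h /uM[].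
  have -> : Re (u (x + h) - u x - h%:C * l) = Re (u (x + h)) - Re (u x) - h * Re l.
    by rewrite !creimE /=; ring.
  by [].
have -> : Im (u (x + h) - u x - h%:C * l) = Im (u (x + h)) - Im (u x) - h * Im l.
  by rewrite !creimE /=; ring.
by [].
Qed.

(** The bound holds with the supremum of the second derivative, so that it is
    uniform in a parameter. *)
Lemma taylor_quad (f f' f'' : R -> R) x M h : `|h| <= 1 ->
  (forall y, `|y - x| <= 1 -> is_derive y 1 f (f' y)) ->
  (forall y, `|y - x| <= 1 -> is_derive y 1 f' (f'' y)) ->
  (forall y, `|y - x| <= 1 -> `|f'' y| <= M) ->
  `|f (x + h) - f x - h * f' x| <= M * h ^+ 2.
Proof.
move=> h1 df df' fM.
have M0 : 0 <= M.
  by apply: le_trans (normr_ge0 _) (fM x _); rewrite subrr normr0.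
have near1 y : `|y - x| <= `|h| -> `|y - x| <= 1 by move=> /le_trans; apply.
have d1 y : `|y - x| <= `|h| -> `|f' y - f' x| <= M * `|h|.
  move=> yh; have [xy|yx] := leP x y.
    have sub z : x <= z <= y -> `|z - x| <= 1.
      move=> /andP[xz zy]; apply: near1; apply: le_trans yh.
      by rewrite !ger0_norm ?subr_ge0 // lerD2r.
    apply: le_trans (is_derive_bound xy (fun z zz => df' z (sub z zz))
      (fun z zz => fM z (sub z zz))) _.
    by apply: ler_wpM2l => //; apply: le_trans yh; exact: ler_norm.
  have sub z : y <= z <= x -> `|z - x| <= 1.
    move=> /andP[yz zx]; apply: near1; apply: le_trans yh.
    by rewrite distrC (distrC y) !ger0_norm ?subr_ge0 ?lerD2l ?lerN2 // ltW.
  rewrite distrC; apply: le_trans (is_derive_bound (ltW yx) (fun z zz => df' z (sub z zz))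
      (fun z zz => fM z (sub z zz))) _.
  by apply: ler_wpM2l => //; apply: le_trans yh; rewrite distrC; exact: ler_norm.
pose g := fun s => f s - f' x * s.
have dg y : `|y - x| <= `|h| -> is_derive y 1 g (f' y - f' x).
  move=> yh; have := df y (near1 _ yh) => dfy.
  apply: (@is_derive_extf _ (f - f' x \*: id)) => //.
  by apply: is_derive_eq; rewrite /GRing.scale /= mulr1.
have -> : f (x + h) - f x - h * f' x = g (x + h) - g x by rewrite /g; ring.
have hh : M * h ^+ 2 = M * `|h| * `|h|.
  by rewrite -mulrA -expr2 real_normK // num_real.
rewrite hh; have [h0|h0] := leP 0 h.
  have sub z : x <= z <= x + h -> `|z - x| <= `|h|.
    move=> /andP[xz zy]; rewrite !ger0_norm ?subr_ge0 //.
    by rewrite lerBlDl.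
  have xh : x <= x + h by rewrite lerDl.
  apply: le_trans (is_derive_bound xh (fun z zz => dg z (sub z zz))
      (fun z zz => d1 z (sub z zz))) _.
  by rewrite [x + h]addrC addrK; apply: ler_wpM2l; rewrite ?mulr_ge0 // ler_norm.
have sub z : x + h <= z <= x -> `|z - x| <= `|h|.
  move=> /andP[xz zy]; rewrite distrC ger0_norm ?subr_ge0 // ltr0_norm //.
  by rewrite lerBlDl lerBrDr.
have xh : x + h <= x by rewrite gerDl ltW.
rewrite distrC; apply: le_trans (is_derive_bound xh (fun z zz => dg z (sub z zz))
    (fun z zz => d1 z (sub z zz))) _.
by rewrite opprD addrA subrr sub0r; apply: ler_wpM2l; rewrite ?mulr_ge0 // -normrN ler_norm.
Qed.

Lemma bounded_strip (F : R -> R -> R) (y : R) :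
  continuous (fun p : R * R => F p.1 p.2) ->
  exists2 M, 0 <= M & forall x s, 0 <= x <= 1 -> `|s - y| <= 1 -> `|F x s| <= M.
Proof.
move=> cF; have cK : compact (`[(0 : R), 1] `*` `[y - 1, y + 1]).
  by apply: compact_setX; exact: segment_compact.
have cN : continuous (fun p : R * R => `|F p.1 p.2|).
  by move=> p; apply: cvg_norm; exact: cF.
have ne : (`[(0 : R), 1] `*` `[y - 1, y + 1]) !=set0.
  by exists (0, y); split => /=; rewrite in_itv /=; apply/andP; split; lra.
have [c _ cm] := compact_EVT_max ne cK (continuous_subspaceT cN).
exists `|F c.1 c.2| => // x s x01 sy; apply: (cm (x, s)); rewrite inE; split => /=.
  by rewrite in_itv.
by rewrite in_itv /=; move: sy; rewrite ler_norml => /andP[h1 h2]; apply/andP; split; lra.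
Qed.

Lemma mean_derive (K K1 K2 : R -> R -> C) (y : R) :
  (forall x s, cder (K x) s (K1 x s)) ->
  (forall x s, cder (K1 x) s (K2 x s)) ->
  (forall s, continuous (fun x => K x s)) ->
  (forall s, continuous (fun x => K1 x s)) ->
  continuous (fun p : R * R => K2 p.1 p.2) ->
  cder (fun s => mean (fun x => K x s)) y (mean (fun x => K1 x y)).
Proof.
move=> dK dK1 cK cK1 cK2.
have [M1 M10 M1P] : exists2 M, 0 <= M &
    forall x s, 0 <= x <= 1 -> `|s - y| <= 1 -> `|Re (K2 x s)| <= M.
  apply: (bounded_strip (F := fun x s => Re (K2 x s))) => p.
  by have /cvg_complexP[] := cK2 p.
have [M2 M20 M2P] : exists2 M, 0 <= M &
    forall x s, 0 <= x <= 1 -> `|s - y| <= 1 -> `|Im (K2 x s)| <= M.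
  apply: (bounded_strip (F := fun x s => Im (K2 x s))) => p.
  by have /cvg_complexP[] := cK2 p.
apply: (@cder_quad _ _ _ (M1 + M2)) => h h1.
have -> : mean (fun x => K x (y + h)) - mean (fun x => K x y) -
   h%:C * mean (fun x => K1 x y) =
   mean (fun x => (1 * K x (y + h) + (-1) * K x y) + (- h%:C) * K1 x y).
  by rewrite (mean_lin3 _ _ _ (cK (y + h)) (cK y) (cK1 y)); ring.
apply: mean_bound.
  have cz (k : C) (u : R -> C) : continuous u -> continuous (fun x => k * u x).
    by move=> cu x; apply: cvg_cM; [exact: cvg_cst | exact: cu].
  by move=> x; apply: cvg_cD; [apply: cvg_cD|]; apply: cz; [exact: cK | exact: cK | exact: cK1].
move=> x x01; split.
  apply: (@le_trans _ _ (M1 * h ^+ 2)); last first.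
    by apply: ler_wpM2r; rewrite ?sqr_ge0 // lerDl; exact: M20.
  have -> : Re (1 * K x (y + h) + -1 * K x y + - h%:C * K1 x y) =
      Re (K x (y + h)) - Re (K x y) - h * Re (K1 x y).
    by rewrite !creimE /=; ring.
  apply: (@taylor_quad (fun s => Re (K x s)) (fun s => Re (K1 x s))
    (fun s => Re (K2 x s)) y M1 h h1).
  - by move=> s _; case: (dK x s).
  - by move=> s _; case: (dK1 x s).
  - by move=> s; exact: M1P.
apply: (@le_trans _ _ (M2 * h ^+ 2)); last first.
  by apply: ler_wpM2r; rewrite ?sqr_ge0 // lerDr; exact: M10.
have -> : Im (1 * K x (y + h) + -1 * K x y + - h%:C * K1 x y) =
    Im (K x (y + h)) - Im (K x y) - h * Im (K1 x y).
  by rewrite !creimE /=; ring.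
apply: (@taylor_quad (fun s => Im (K x s)) (fun s => Im (K1 x s))
  (fun s => Im (K2 x s)) y M2 h h1).
- by move=> s _; case: (dK x s).
- by move=> s _; case: (dK1 x s).
- by move=> s; exact: M2P.
Qed.

End MeanDerivative.

(** * Smooth functions on the Heisenberg group *)

Section HeisCalculus.
Context {R : realType}.
Local Notation C := R[i].
Implicit Types (f g : heis R -> C) (p : heis R) (v w : axis).

(** Recording the derivative as a function makes it computable by the rules
    below, whereas [partial] is defined by a limit. *)
Definition pder v f g : Prop :=
  forall p, cder (fun s => f (set_coord v p s)) (get_coord v p) (g p).

Lemma set_get v p : set_coord v p (get_coord v p) = p.
Proof. by case: v; case: p => [[a b] c]. Qed.

Lemma get_set v p s : get_coord v (set_coord v p s) = s.
Proof. by case: v. Qed.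

Lemma set_set v p s s' : set_coord v (set_coord v p s) s' = set_coord v p s'.
Proof. by case: v. Qed.

Lemma pder_unique v f g g' : pder v f g -> pder v f g' -> g = g'.
Proof. by move=> h h'; apply/funext => p; exact: cder_unique (h p) (h' p). Qed.

Lemma pder_partial v f : has_partial v f -> pder v f (partial v f).
Proof.
move=> fv p; have [h1 h2] := fv p; split; rewrite /partial /= derive1E;
  exact: derivableP.
Qed.

Lemma pder_has_partial v f g : pder v f g -> has_partial v f.
Proof. by move=> fg p; have [h1 h2] := fg p; split; [case: h1 | case: h2]. Qed.

Lemma partialE v f g : pder v f g -> partial v f = g.
Proof.
by move=> fg; exact: pder_unique (pder_partial (pder_has_partial fg)) fg.
Qed.

Lemma foldr_partial v (ws : seq axis) f : foldr partial (partial v f) ws = foldr partial f (rcons ws v).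
Proof. by rewrite foldr_rcons. Qed.

Lemma smooth_cont f : smooth f -> continuous f.
Proof. by move=> /(_ [::])[]. Qed.

Lemma smooth_pder v f : smooth f -> pder v f (partial v f).
Proof. by move=> /(_ [::])[_ /(_ v)]; exact: pder_partial. Qed.

Lemma smooth_partial v f : smooth f -> smooth (partial v f).
Proof. by move=> sf w; rewrite foldr_partial; exact: sf. Qed.

(** Smoothness quantifies over all iterated partial derivatives, which stay in
    any class closed under differentiation. *)
Lemma smooth_coind (S : set (heis R -> C)) :
  (forall f, S f -> continuous f /\ forall v, exists2 g, S g & pder v f g) ->
  forall f, S f -> smooth f.
Proof.
move=> SP f Sf w; have Sw : S (foldr partial f w).
  elim: w => //= v w /SP[_ /(_ v)[g Sg /partialE ->]] //.
have [cw pw] := SP _ Sw; split => // v.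
by have [g _ /pder_has_partial] := pw v.
Qed.

(** Derivatives of products and of compositions are sums of products, so the
    classes to which [smooth_coind] applies are algebras. *)
Inductive fun_alg (S : set (heis R -> C)) : set (heis R -> C) :=
| fun_alg_gen f : S f -> fun_alg S f
| fun_alg_cst (k : C) : fun_alg S (fun=> k)
| fun_alg_add f g : fun_alg S f -> fun_alg S g -> fun_alg S (fun p => f p + g p)
| fun_alg_mul f g : fun_alg S f -> fun_alg S g -> fun_alg S (fun p => f p * g p).

Lemma pder_add v f g f' g' : pder v f f' -> pder v g g' ->
  pder v (fun p => f p + g p) (fun p => f' p + g' p).
Proof. by move=> hf hg p; exact: cderD (hf p) (hg p). Qed.

Lemma pder_mul v f g f' g' : pder v f f' -> pder v g g' ->
  pder v (fun p => f p * g p) (fun p => f' p * g p + f p * g' p).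
Proof. by move=> hf hg p; apply: cder_ext (cderM (hf p) (hg p)) => //; rewrite set_get. Qed.

Lemma pder_cst v k : pder v (fun=> k) (fun=> 0).
Proof. by move=> p; exact: cder_cst. Qed.

(** It suffices that the derivatives of the generators lie in the algebra, by
    the rule for products. *)
Lemma smooth_alg (S : set (heis R -> C)) :
  (forall f, S f -> continuous f /\ forall v, exists2 g, fun_alg S g & pder v f g) ->
  forall f, fun_alg S f -> smooth f.
Proof.
move=> SP; apply: smooth_coind => f; elim => {f}.
- exact: SP.
- move=> k; split; first exact: cst_continuous.
  by move=> v; exists (fun=> 0); [exact: fun_alg_cst | exact: pder_cst].
- move=> f g Sf [cf df] Sg [cg dg]; split.
    by move=> p; apply: cvg_cD; [exact: cf | exact: cg].
  move=> v; have [f' Sf' ff'] := df v; have [g' Sg' gg'] := dg v.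
  by exists (fun p => f' p + g' p); [exact: fun_alg_add | exact: pder_add].
- move=> f g Sf [cf df] Sg [cg dg]; split.
    by move=> p; apply: cvg_cM; [exact: cf | exact: cg].
  move=> v; have [f' Sf' ff'] := df v; have [g' Sg' gg'] := dg v.
  exists (fun p => f' p * g p + f p * g' p); last exact: pder_mul.
  by apply: fun_alg_add; apply: fun_alg_mul.
Qed.

Lemma fun_alg_smooth f : fun_alg smooth f -> smooth f.
Proof.
apply: smooth_alg => {}f sf; split; first exact: smooth_cont.
move=> v; exists (partial v f); last exact: smooth_pder.
by apply: fun_alg_gen; exact: smooth_partial.
Qed.

Lemma smooth_cst k : smooth (fun _ : heis R => k).
Proof. by apply: fun_alg_smooth; exact: fun_alg_cst. Qed.

Lemma smooth_add f g : smooth f -> smooth g -> smooth (fun p => f p + g p).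
Proof.
by move=> sf sg; apply: fun_alg_smooth; apply: fun_alg_add; exact: fun_alg_gen.
Qed.

Lemma smooth_mul f g : smooth f -> smooth g -> smooth (fun p => f p * g p).
Proof.
by move=> sf sg; apply: fun_alg_smooth; apply: fun_alg_mul; exact: fun_alg_gen.
Qed.

Lemma smooth_scale k f : smooth f -> smooth (fun p => k * f p).
Proof. by move=> sf; exact: smooth_mul (smooth_cst k) sf. Qed.

Lemma smooth_sum (I : Type) (s : seq I) (F : I -> heis R -> C) :
  (forall i, smooth (F i)) -> smooth (fun p => \sum_(i <- s) F i p).
Proof.
move=> sF; elim: s => [|i s IH].
  by under eq_fun do rewrite big_nil; exact: smooth_cst.
have -> : (fun p => \sum_(j <- i :: s) F j p) = (fun p => F i p + \sum_(j <- s) F j p).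
    by apply/funext => p; rewrite big_cons.
  exact: smooth_add (sF i) IH.
Qed.

Lemma smooth_exp f n : smooth f -> smooth (fun p => f p ^+ n).
Proof.
move=> sf; elim: n => [|n IH].
  by under eq_fun do rewrite expr0; exact: smooth_cst.
by under eq_fun do rewrite exprS; exact: smooth_mul.
Qed.

Lemma smooth_conj f : smooth f -> smooth (fun p => (f p)^*).
Proof.
move=> sf; apply: (@smooth_coind [set h | exists2 f, smooth f & h = fun p => (f p)^*]).
  move=> _ [{}f {}sf ->]; split.
    by move=> p; apply: cvg_cJ; exact: smooth_cont.
  move=> v; exists (fun p => (partial v f p)^*).
    by exists (partial v f); [exact: smooth_partial | ].
  by move=> p; apply: cderJ; exact: smooth_pder.
by exists f.
Qed.

Lemma pder_conj v f f' : pder v f f' -> pder v (fun p => (f p)^*) (fun p => (f' p)^*).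
Proof. by move=> ff' p; exact: cderJ (ff' p). Qed.

Lemma pder_scale v (k : C) f f' : pder v f f' -> pder v (fun p => k * f p) (fun p => k * f' p).
Proof. by move=> ff' p; exact: cderZ (ff' p). Qed.

Lemma smooth_cexp f : smooth f -> smooth (fun p => cexp (f p)).
Proof.
move=> sf; apply: (@smooth_alg ([set h | exists2 f, smooth f & h = fun p => cexp (f p)] `|` smooth)).
  move=> h [[{}f {}sf ->]|sh].
    split; first by move=> p; apply: cvg_ccexp; exact: smooth_cont.
    move=> v; exists (fun p => partial v f p * cexp (f p)).
      apply: fun_alg_mul; apply: fun_alg_gen; last by left; exists f.
      by right; exact: smooth_partial.
    move=> p; have := cder_cexp (@smooth_pder v f sf p).
    by rewrite set_get.
  split; first exact: smooth_cont sh.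
  move=> v; exists (partial v h); last exact: smooth_pder.
  by apply: fun_alg_gen; right; exact: smooth_partial.
by apply: fun_alg_gen; left; exists f.
Qed.

Lemma pder_cexp v f f' : pder v f f' ->
  pder v (fun p => cexp (f p)) (fun p => f' p * cexp (f p)).
Proof. by move=> ff' p; have := cder_cexp (ff' p); rewrite set_get. Qed.

Lemma continuous_pairP (T : Type) (F : set_system T) {FF : Filter F}
    (x y t : T -> R) (x0 y0 t0 : R) :
  x s @[s --> F] --> x0 -> y s @[s --> F] --> y0 -> t s @[s --> F] --> t0 ->
  ((x s +i* y s, t s) : heis R) @[s --> F] --> ((x0 +i* y0, t0) : heis R).
Proof.
move=> hx hy ht; apply: (@cvg_pair _ _ _ F (nbhs (x0 +i* y0)) (nbhs t0)) => //.
by apply/cvg_complexP.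
Qed.

Lemma get_coord_continuous v : continuous (@get_coord R v).
Proof.
move=> [z t]; case: v => /=.
- have : fst p @[p --> ((z, t) : heis R)] --> z by exact: cvg_fst.
  by move=> /cvg_complexP[].
- have : fst p @[p --> ((z, t) : heis R)] --> z by exact: cvg_fst.
  by move=> /cvg_complexP[].
- by exact: cvg_snd.
Qed.

Definition axis_eq (v w : axis) : bool :=
  match v, w with axis_x, axis_x | axis_y, axis_y | axis_t, axis_t => true | _, _ => false end.

Lemma pder_coord v w : pder v (fun p => (get_coord w p)%:C) (fun=> (axis_eq v w)%:R).
Proof.
move=> p; case: v; case: w => /=; first [exact: cder_cst |
  by apply: cder_real; exact: is_derive_id].
Qed.

Lemma smooth_coord w : smooth (fun p => (get_coord w p)%:C).
Proof.
apply: (@smooth_alg [set h | h = fun p => (get_coord w p)%:C]); last exact: fun_alg_gen.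
move=> _ ->; split; first by move=> p; apply: cvg_creal; exact: get_coord_continuous.
by move=> v; exists (fun=> (axis_eq v w)%:R); [exact: fun_alg_cst | exact: pder_coord].
Qed.

End HeisCalculus.

(** * Chain rule, affine substitutions and symmetry of mixed partials *)

Section ChainRule.
Context {R : realType}.
Local Notation C := R[i].
Implicit Types (f g : heis R -> C) (p : heis R) (v w : axis).

Lemma MVT_between (f df : R -> R) (a b : R) :
  (forall x : R, is_derive x 1 f (df x)) ->
  exists c, `|c - a| <= `|b - a| /\ f b - f a = df c * (b - a).
Proof.
move=> fd; have fc (u1 u2 : R) : {within `[u1, u2], continuous f}.
  by apply: derivable_within_continuous => x _; have [] := fd x.
have [ab|ba] := leP a b.
  have [c cab E] := MVT_segment ab (fun x _ => fd x) (fc _ _).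
  exists c; split => //; move: cab; rewrite in_itv /= => /andP[ac cb].
  by rewrite !ger0_norm ?subr_ge0 // lerD2r.
have [c cab E] := MVT_segment (ltW ba) (fun x _ => fd x) (fc _ _).
exists c; split; last by rewrite -[LHS]opprB E; ring.
move: cab; rewrite in_itv /= => /andP[ac cb].
by rewrite distrC (distrC b) !ger0_norm ?subr_ge0 ?lerD2l ?lerN2 // ltW.
Qed.

Lemma cvg_between (T : Type) (F : set_system T) {FF : Filter F} (x xi : T -> R) (a : R) :
  x s @[s --> F] --> a -> (forall s, `|xi s - a| <= `|x s - a|) ->
  xi s @[s --> F] --> a.
Proof.
move=> xa h; apply/cvgrPdist_lt => e e0.
move/cvgrPdist_lt : xa => /(_ e e0); apply: filterS => s.
by rewrite distrC => xs; rewrite distrC; exact: le_lt_trans (h s) xs.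
Qed.

Definition mkpt (x y t : R) : heis R := (x +i* y, t).

(** The increment of [F] is split into three increments along the axes; the mean
    value theorem on each gives a slope that is continuous at [s0]. *)
Lemma chain_real (F Fx Fy Ft : heis R -> R) (x y t : R -> R) (s0 x' y' t' : R) :
  (forall x y t : R, is_derive x 1 (fun s => F (mkpt s y t)) (Fx (mkpt x y t))) ->
  (forall x y t : R, is_derive y 1 (fun s => F (mkpt x s t)) (Fy (mkpt x y t))) ->
  (forall x y t : R, is_derive t 1 (fun s => F (mkpt x y s)) (Ft (mkpt x y t))) ->
  continuous Fx -> continuous Fy -> continuous Ft ->
  is_derive s0 1 x x' -> is_derive s0 1 y y' -> is_derive s0 1 t t' ->
  let p0 := mkpt (x s0) (y s0) (t s0) in
  is_derive s0 1 (fun s => F (mkpt (x s) (y s) (t s)))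
    (x' * Fx p0 + y' * Fy p0 + t' * Ft p0).
Proof.
move=> dx dy dt cx cy ct hx hy ht p0.
have cc (u : R -> R) u' : is_derive s0 1 u u' -> u s @[s --> s0] --> u s0.
  by case=> du _; apply: differentiable_continuous; apply/derivable1_diffP.
have cvx := cc _ _ hx; have cvy := cc _ _ hy; have cvt := cc _ _ ht.
move/is_derive1_caratheodory : (hx) => [gx [gxE gxc gx0]].
move/is_derive1_caratheodory : (hy) => [gy [gyE gyc gy0]].
move/is_derive1_caratheodory : (ht) => [gt [gtE gtc gt0]].
have /choice[xi xiP] : forall s, exists c, `|c - x s0| <= `|x s - x s0| /\
    F (mkpt (x s) (y s) (t s)) - F (mkpt (x s0) (y s) (t s)) =
    Fx (mkpt c (y s) (t s)) * (x s - x s0).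
  by move=> s; apply: (@MVT_between (fun u => F (mkpt u (y s) (t s)))
     (fun u => Fx (mkpt u (y s) (t s)))).
have /choice[eta etaP] : forall s, exists c, `|c - y s0| <= `|y s - y s0| /\
    F (mkpt (x s0) (y s) (t s)) - F (mkpt (x s0) (y s0) (t s)) =
    Fy (mkpt (x s0) c (t s)) * (y s - y s0).
  by move=> s; apply: (@MVT_between (fun u => F (mkpt (x s0) u (t s)))
     (fun u => Fy (mkpt (x s0) u (t s)))).
have /choice[tau tauP] : forall s, exists c, `|c - t s0| <= `|t s - t s0| /\
    F (mkpt (x s0) (y s0) (t s)) - F (mkpt (x s0) (y s0) (t s0)) =
    Ft (mkpt (x s0) (y s0) c) * (t s - t s0).
  by move=> s; apply: (@MVT_between (fun u => F (mkpt (x s0) (y s0) u))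
     (fun u => Ft (mkpt (x s0) (y s0) u))).
have at0 (u c : R -> R) : (forall s, `|c s - u s0| <= `|u s - u s0|) -> c s0 = u s0.
  by move=> /(_ s0); rewrite subrr normr0 normr_le0 subr_eq0 => /eqP.
have xi0 := at0 x xi (fun s => (xiP s).1).
have eta0 := at0 y eta (fun s => (etaP s).1).
have tau0 := at0 t tau (fun s => (tauP s).1).
have xic := cvg_between cvx (fun s => (xiP s).1).
have etac := cvg_between cvy (fun s => (etaP s).1).
have tauc := cvg_between cvt (fun s => (tauP s).1).
apply/is_derive1_caratheodory.
exists (fun s => gx s * Fx (mkpt (xi s) (y s) (t s)) + gy s * Fy (mkpt (x s0) (eta s) (t s))
  + gt s * Ft (mkpt (x s0) (y s0) (tau s))); split.
- move=> s; rewrite mulrDl mulrDl.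
  rewrite ![_ * _ * (s - s0)]mulrAC -gxE -gyE -gtE.
  rewrite ![(_ - _) * _]mulrC -(xiP s).2 -(etaP s).2 -(tauP s).2.
  by ring.
- have comp (G : heis R -> R) (a b c : R -> R) : continuous G ->
    a s @[s --> s0] --> a s0 -> b s @[s --> s0] --> b s0 -> c s @[s --> s0] --> c s0 ->
    G (mkpt (a s) (b s) (c s)) @[s --> s0] --> G (mkpt (a s0) (b s0) (c s0)).
    move=> cG ha hb hc.
    apply: (@continuous_cvg _ _ _ _ _ (fun s => mkpt (a s) (b s) (c s)) G); first exact: cG.
    exact: continuous_pairP.
  have kx := comp Fx xi y t cx; rewrite xi0 in kx.
  have ky := comp Fy (fun=> x s0) eta t cy; rewrite eta0 in ky.
  have kt := comp Ft (fun=> x s0) (fun=> y s0) tau ct; rewrite tau0 in kt.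
  rewrite /prop_for /continuous_at xi0 eta0 tau0.
  have lx : Fx (mkpt (xi s) (y s) (t s)) @[s --> s0] --> Fx (mkpt (x s0) (y s0) (t s0)).
    by apply: kx => //; exact: xic.
  have ly : Fy (mkpt (x s0) (eta s) (t s)) @[s --> s0] --> Fy (mkpt (x s0) (y s0) (t s0)).
    by apply: ky => //; [exact: cvg_cst | exact: etac].
  have lt : Ft (mkpt (x s0) (y s0) (tau s)) @[s --> s0] --> Ft (mkpt (x s0) (y s0) (t s0)).
    by apply: kt => //; [exact: cvg_cst | exact: cvg_cst | exact: tauc].
  exact: (cvgD (cvgD (cvgM gxc lx) (cvgM gyc ly)) (cvgM gtc lt)).
- by rewrite xi0 eta0 tau0 gx0 gy0 gt0.
Qed.

Lemma chain_rule f (x y t : R -> R) (s0 x' y' t' : R) : smooth f ->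
  is_derive s0 1 x x' -> is_derive s0 1 y y' -> is_derive s0 1 t t' ->
  let p0 := mkpt (x s0) (y s0) (t s0) in
  cder (fun s => f (mkpt (x s) (y s) (t s))) s0
    (x'%:C * partial axis_x f p0 + y'%:C * partial axis_y f p0 +
     t'%:C * partial axis_t f p0).
Proof.
move=> sf hx hy ht p0.
have reZ (k : R) (z : C) : Re (k%:C * z) = k * Re z by rewrite cRe_mul mul0r subr0.
have imZ (k : R) (z : C) : Im (k%:C * z) = k * Im z by rewrite cIm_mul mul0r addr0.
have dp v (q : heis R) : cder (fun s => f (set_coord v q s)) (get_coord v q) (partial v f q).
  exact: smooth_pder.
have cp v := smooth_cont (smooth_partial v sf).
have dx a b c : cder (fun s => f (mkpt s b c)) a (partial axis_x f (mkpt a b c)).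
  exact: (dp axis_x (mkpt a b c)).
have dy a b c : cder (fun s => f (mkpt a s c)) b (partial axis_y f (mkpt a b c)).
  exact: (dp axis_y (mkpt a b c)).
have dt a b c : cder (fun s => f (mkpt a b s)) c (partial axis_t f (mkpt a b c)).
  exact: (dp axis_t (mkpt a b c)).
have cr v q : Re (partial v f q') @[q' --> q] --> Re (partial v f q).
  by have /cvg_complexP[] := cp v q.
have ci v q : Im (partial v f q') @[q' --> q] --> Im (partial v f q).
  by have /cvg_complexP[] := cp v q.
split.
  have h := (@chain_real (fun q => Re (f q)) _ _ _ x y t s0 _ _ _
    (fun a b c => (dx a b c).1) (fun a b c => (dy a b c).1)
    (fun a b c => (dt a b c).1) (cr axis_x) (cr axis_y) (cr axis_t) hx hy ht).
  apply: (is_derive_eq h).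
  by rewrite !cRe_add !reZ.
have h := (@chain_real (fun q => Im (f q)) _ _ _ x y t s0 _ _ _
  (fun a b c => (dx a b c).2) (fun a b c => (dy a b c).2)
  (fun a b c => (dt a b c).2) (ci axis_x) (ci axis_y) (ci axis_t) hx hy ht).
apply: (is_derive_eq h).
by rewrite !cIm_add !imZ.
Qed.

(** The slope [d v i] of the coordinate [i] along the axis [v] does not depend on
    the point, so partial derivatives of [f] after an affine map are combinations
    of those of [f] with constant coefficients. *)
Definition affine_map (A : heis R -> heis R) (d : axis -> axis -> R) : Prop :=
  forall v i p s, get_coord i (A (set_coord v p s)) =
    d v i * s + (get_coord i (A p) - d v i * get_coord v p).

Lemma mkptE p : mkpt (get_coord axis_x p) (get_coord axis_y p) (get_coord axis_t p) = p.
Proof. by case: p => [[a b] c]. Qed.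

Lemma affine_cont A d : affine_map A d -> continuous A.
Proof.
move=> Ad p.
have AE i q : get_coord i (A q) = get_coord i (A (mkpt 0 0 0)) +
   d axis_x i * get_coord axis_x q + d axis_y i * get_coord axis_y q
   + d axis_t i * get_coord axis_t q.
  have -> : q = set_coord axis_t (set_coord axis_y (set_coord axis_x (mkpt 0 0 0)
     (get_coord axis_x q)) (get_coord axis_y q)) (get_coord axis_t q).
    by case: q => [[a b] c].
  by rewrite !Ad /=; ring.
have cA i : get_coord i (A q) @[q --> p] --> get_coord i (A p).
  have -> : (fun q => get_coord i (A q)) = (fun q => get_coord i (A (mkpt 0 0 0)) +
   d axis_x i * get_coord axis_x q + d axis_y i * get_coord axis_y q
   + d axis_t i * get_coord axis_t q) by apply/funext => q; exact: AE.
  rewrite (AE i p).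
  by apply: cvgD; first apply: cvgD; first apply: cvgD; try exact: cvg_cst;
    (apply: cvgM; [exact: cvg_cst | exact: get_coord_continuous]).
have -> : A = (fun q => mkpt (get_coord axis_x (A q)) (get_coord axis_y (A q)) (get_coord axis_t (A q))).
  by apply/funext => q; rewrite mkptE.
by apply: continuous_pairP; exact: cA.
Qed.

Lemma pder_affine A d v f : affine_map A d -> smooth f ->
  pder v (fun p => f (A p)) (fun p => (d v axis_x)%:C * partial axis_x f (A p) +
    (d v axis_y)%:C * partial axis_y f (A p) + (d v axis_t)%:C * partial axis_t f (A p)).
Proof.
move=> Ad sf p.
have h i : is_derive (get_coord v p) 1 (fun s => get_coord i (A (set_coord v p s))) (d v i).
  have -> : (fun s => get_coord i (A (set_coord v p s))) =
   (fun s => d v i * s + (get_coord i (A p) - d v i * get_coord v p)).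
    by apply/funext => s; exact: Ad.
  exact: is_derive_affine.
have := chain_rule sf (h axis_x) (h axis_y) (h axis_t).
rewrite set_get !mkptE; apply: cder_ext => // s; by rewrite mkptE.
Qed.

(** The functions [g] after [A], for smooth [g], generate an algebra that contains
    their derivatives. *)
Lemma smooth_affine A d f : affine_map A d -> smooth f -> smooth (fun p => f (A p)).
Proof.
move=> Ad sf; apply: (@smooth_alg _ [set h | exists2 g, smooth g & h = fun p => g (A p)]).
  move=> _ [g sg ->]; split.
    move=> p; apply: (@continuous_comp _ _ _ A g); first exact: affine_cont Ad _.
    exact: smooth_cont.
  move=> v; eexists; last exact: pder_affine Ad sg.
  have ht i : fun_alg [set h | exists2 g, smooth g & h = fun p => g (A p)]
     (fun p => (d v i)%:C * partial i g (A p)).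
    apply: fun_alg_mul; first exact: fun_alg_cst.
    by apply: fun_alg_gen; exists (partial i g); [exact: smooth_partial | ].
  by apply: fun_alg_add; first apply: fun_alg_add; exact: ht.
by apply: fun_alg_gen; exists f.
Qed.

(** The second difference of [F] over a square of side [h] equals [h ^+ 2] times a
    value of either mixed derivative at a point of the square. *)
Lemma schwarz_real (F F1 F2 F12 F21 : R -> R -> R) (a b : R) :
  (forall x y : R, is_derive x 1 (fun s => F s y) (F1 x y)) ->
  (forall x y : R, is_derive y 1 (fun s => F x s) (F2 x y)) ->
  (forall x y : R, is_derive y 1 (fun s => F1 x s) (F12 x y)) ->
  (forall x y : R, is_derive x 1 (fun s => F2 s y) (F21 x y)) ->
  (forall e, 0 < e -> exists2 h, 0 < h & forall x y, `|x - a| <= h -> `|y - b| <= h ->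
     `|F12 x y - F12 a b| < e) ->
  (forall e, 0 < e -> exists2 h, 0 < h & forall x y, `|x - a| <= h -> `|y - b| <= h ->
     `|F21 x y - F21 a b| < e) ->
  F12 a b = F21 a b.
Proof.
move=> d1 d2 d12 d21 c12 c21; apply/eqP; rewrite -subr_eq0 -normr_le0.
apply/ler_addgt0Pr => e e0; rewrite add0r.
have e2 : 0 < e / 2 by rewrite divr_gt0.
have [h1 h10 H1] := c12 _ e2; have [h2 h20 H2] := c21 _ e2.
pose h := Num.min h1 h2.
have h0 : 0 < h by rewrite lt_min h10.
have hh1 : h <= h1 by rewrite ge_min lexx.
have hh2 : h <= h2 by rewrite ge_min lexx orbT.
have hn : `|h| = h by rewrite ger0_norm // ltW.
have dB (u w du dw : R -> R) (x : R) : is_derive x 1 u (du x) -> is_derive x 1 w (dw x) ->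
    is_derive x 1 (fun s => u s - w s) (du x - dw x).
  by move=> hu hw; apply: (@is_derive_extf _ (u - w)).
have [xi [xiP xiE]] := @MVT_between (fun s => F s (b + h) - F s b)
  (fun s => F1 s (b + h) - F1 s b) a (a + h)
  (fun x => dB (fun s => F s (b + h)) (fun s => F s b)
    (fun s => F1 s (b + h)) (fun s => F1 s b) x (d1 x (b + h)) (d1 x b)).
have [eta [etaP etaE]] := @MVT_between (fun s => F1 xi s) (fun s => F12 xi s) b (b + h) (d12 xi).
have [ta [taP taE]] := @MVT_between (fun s => F (a + h) s - F a s)
  (fun s => F2 (a + h) s - F2 a s) b (b + h)
  (fun x => dB (fun s => F (a + h) s) (fun s => F a s)
    (fun s => F2 (a + h) s) (fun s => F2 a s) x (d2 (a + h) x) (d2 a x)).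
have [ze [zeP zeE]] := @MVT_between (fun s => F2 s ta) (fun s => F21 s ta) a (a + h) (fun x => d21 x ta).
rewrite [a + h]addrC addrK ?hn in xiP xiE zeP zeE.
rewrite [b + h]addrC addrK ?hn in etaP etaE taP taE.
rewrite [h + a]addrC [h + b]addrC in xiE zeE etaE taE.
have E : F12 xi eta = F21 ze ta.
  apply: (mulIf (lt0r_neq0 h0)); apply: (mulIf (lt0r_neq0 h0)).
  rewrite -etaE -zeE -xiE -taE; ring.
have := H1 xi eta (le_trans xiP hh1) (le_trans etaP hh1).
have := H2 ze ta (le_trans zeP hh2) (le_trans taP hh2).
rewrite E distrC => k2 k1; rewrite (splitr e).
have -> : F12 a b - F21 a b = (F12 a b - F21 ze ta) + (F21 ze ta - F21 a b) by ring.
apply: le_trans (ler_normD _ _) _.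
apply: lerD; rewrite distrC; [exact: ltW k1 | exact: ltW k2].
Qed.

Lemma set_coordC v w p a b : axis_eq v w = false ->
  set_coord v (set_coord w p b) a = set_coord w (set_coord v p a) b.
Proof. by case: v; case: w. Qed.

Lemma get_set_neq v w p a : axis_eq v w = false ->
  get_coord v (set_coord w p a) = get_coord v p.
Proof. by case: v; case: w. Qed.

Lemma axis_eqP v w : reflect (v = w) (axis_eq v w).
Proof. by case: v; case: w; constructor. Qed.

Lemma axis_eqC v w : axis_eq v w = axis_eq w v.
Proof. by case: v; case: w. Qed.

Lemma near_coord (G : heis R -> R) v w p e : continuous G -> axis_eq v w = false -> 0 < e ->
  exists2 h, 0 < h & forall x y, `|x - get_coord v p| <= h -> `|y - get_coord w p| <= h ->
    `|G (set_coord v (set_coord w p y) x) - G p| < e.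
Proof.
move=> cG vw e0.
pose H (q : R * R) := set_coord v (set_coord w p q.2) q.1.
have cH : H q @[q --> (get_coord v p, get_coord w p)] --> H (get_coord v p, get_coord w p).
  have ci i : get_coord i (H q) @[q --> (get_coord v p, get_coord w p)] -->
      get_coord i (H (get_coord v p, get_coord w p)).
    have [/axis_eqP ->|/negbTE iv] := boolP (axis_eq i v).
      by rewrite get_set; under eq_fun do rewrite get_set; exact: cvg_fst.
    have [/axis_eqP iw|/negbTE iw] := boolP (axis_eq i w).
      have wv : axis_eq w v = false by rewrite -iw.
      rewrite iw (get_set_neq _ _ wv) get_set.
      by under eq_fun do rewrite (get_set_neq _ _ wv) get_set; exact: cvg_snd.
    rewrite (get_set_neq _ _ iv) (get_set_neq _ _ iw).
    by under eq_fun do rewrite (get_set_neq _ _ iv) (get_set_neq _ _ iw); exact: cvg_cst.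
  have -> : H = (fun q => mkpt (get_coord axis_x (H q)) (get_coord axis_y (H q)) (get_coord axis_t (H q))).
    by apply/funext => q; rewrite mkptE.
  by apply: continuous_pairP; exact: ci.
have H0 : H (get_coord v p, get_coord w p) = p by rewrite /H /= set_get set_get.
have : G (H q) @[q --> (get_coord v p, get_coord w p)] --> G p.
  apply: (@continuous_cvg _ _ _ _ _ H G); first exact: cG.
  by rewrite -[X in _ --> X]H0.
move=> /cvgrPdist_lt/(_ e e0)/nbhs_ballP[h /= h0 hP].
exists (h / 2); first by rewrite divr_gt0.
move=> x y xh yh; have := hP (x, y); rewrite distrC; apply.
have h2 : h / 2 < h by lra.
by split => /=; rewrite /ball /= distrC; [exact: le_lt_trans xh h2 | exact: le_lt_trans yh h2].
Qed.

Lemma partialC v w f : smooth f -> partial v (partial w f) = partial w (partial v f).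
Proof.
move=> sf; have [/axis_eqP ->//|/negbTE vw] := boolP (axis_eq v w).
have wv : axis_eq w v = false by rewrite axis_eqC.
have sv := smooth_partial v sf; have sw := smooth_partial w sf.
have cvw := smooth_cont (smooth_partial v sw).
have cwv := smooth_cont (smooth_partial w sv).
apply/funext => p.
pose P x y := set_coord v (set_coord w p y) x.
have PE : P (get_coord v p) (get_coord w p) = p by rewrite /P !set_get.
have dv (g : heis R -> C) (sg : smooth g) x y : cder (fun s => g (P s y)) x (partial v g (P x y)).
  have := @smooth_pder _ v g sg (P x y); rewrite /P get_set.
  by apply: cder_ext => // s; rewrite set_set.
have dw (g : heis R -> C) (sg : smooth g) x y : cder (fun s => g (P x s)) y (partial w g (P x y)).
  have := @smooth_pder _ w g sg (P x y); rewrite /P (get_set_neq _ _ wv) get_set.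
  by apply: cder_ext => // s; rewrite -(set_coordC _ _ _ vw) set_set.
have part (pr : C -> R) (cpr : forall (g : heis R -> C), continuous g -> continuous (fun q => pr (g q)))
   (dpr : forall u x l, cder u x l -> is_derive x 1 (fun s => pr (u s)) (pr l)) :
   pr (partial v (partial w f) p) = pr (partial w (partial v f) p).
  apply/esym; rewrite -{1 2}PE.
  apply: (@schwarz_real (fun x y => pr (f (P x y))) (fun x y => pr (partial v f (P x y)))
    (fun x y => pr (partial w f (P x y))) (fun x y => pr (partial w (partial v f) (P x y)))
    (fun x y => pr (partial v (partial w f) (P x y)))).
  - by move=> x y; apply: dpr; exact: dv.
  - by move=> x y; apply: dpr; exact: dw.
  - by move=> x y; apply: dpr; exact: dw.
  - by move=> x y; apply: dpr; exact: dv.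
  - by move=> e e0; rewrite PE; exact: (near_coord _ (cpr _ cwv)).
  - by move=> e e0; rewrite PE; exact: (near_coord _ (cpr _ cvw)).
apply: complex_ext; apply: part.
- by move=> g cg q; have /cvg_complexP[] := cg q.
- by move=> u x l [].
- by move=> g cg q; have /cvg_complexP[] := cg q.
- by move=> u x l [].
Qed.

End ChainRule.

(** * The operators Z and Zbar *)

Section Operators.
Context {R : realType}.
Local Notation C := R[i].
Implicit Types (f g : heis R -> C) (p : heis R) (v w : axis).

Definition dz_axis v : C :=
  match v with axis_x => 1 | axis_y => 'i%C | axis_t => 0 end.

Lemma pder_eq v f g g' : (forall p, g p = g' p) -> pder v f g -> pder v f g'.
Proof. by move=> /funext ->. Qed.

Lemma pder_z v : pder v (fun p => p.1) (fun=> dz_axis v).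
Proof.
have -> : (fun p : heis R => p.1) =
    (fun p => (get_coord axis_x p)%:C + 'i%C * (get_coord axis_y p)%:C).
  by apply/funext => -[[a b] c]; apply: complex_ext; rewrite /= ?creimE /=; ring.
apply: pder_eq (pder_add (pder_coord v axis_x) (pder_scale 'i%C (pder_coord v axis_y))).
by move=> _; case: v => /=; ring.
Qed.

Definition dzbar_axis v : C :=
  match v with axis_x => 1 | axis_y => - 'i%C | axis_t => 0 end.

Definition zbar p : C := (p.1)^*.

Lemma pder_zbar v : pder v zbar (fun=> dzbar_axis v).
Proof.
apply: pder_eq (pder_conj (pder_z v)) => _.
by case: v; apply: complex_ext => /=; rewrite ?oppr0.
Qed.

Lemma smooth_z : smooth (fun p : heis R => p.1).
Proof.
have -> : (fun p : heis R => p.1) =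
    (fun p => (get_coord axis_x p)%:C + 'i%C * (get_coord axis_y p)%:C).
  by apply/funext => -[[a b] c]; apply: complex_ext; rewrite /= ?creimE /=; ring.
by apply: smooth_add; [exact: smooth_coord | apply: smooth_scale; exact: smooth_coord].
Qed.

Lemma ZopE f : Zop f = fun p => 2^-1 * (partial axis_x f p + (- 'i%C) * partial axis_y f p)
  + 'i%C * (zbar p * partial axis_t f p).
Proof. by apply/funext => p; rewrite /Zop /d_z mulrC mulNr mulrA. Qed.

Lemma ZbaropE f : Zbarop f = fun p => 2^-1 * (partial axis_x f p + 'i%C * partial axis_y f p)
  + (- 'i%C) * (p.1 * partial axis_t f p).
Proof. by apply/funext => p; rewrite /Zbarop /d_zbar mulrC mulNr mulrA. Qed.

Lemma smooth_Zop f : smooth f -> smooth (Zop f).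
Proof.
move=> sf; rewrite ZopE; have sp v := smooth_partial v sf.
apply: smooth_add; apply: smooth_scale.
  exact: smooth_add (sp axis_x) (smooth_scale _ (sp axis_y)).
exact: smooth_mul (smooth_conj smooth_z) (sp axis_t).
Qed.

Lemma smooth_Zbarop f : smooth f -> smooth (Zbarop f).
Proof.
move=> sf; rewrite ZbaropE; have sp v := smooth_partial v sf.
apply: smooth_add; apply: smooth_scale.
  exact: smooth_add (sp axis_x) (smooth_scale _ (sp axis_y)).
exact: smooth_mul smooth_z (sp axis_t).
Qed.

Lemma pder_Zop v f : smooth f -> pder v (Zop f) (fun p =>
  2^-1 * (partial v (partial axis_x f) p + (- 'i%C) * partial v (partial axis_y f) p)
  + 'i%C * (dzbar_axis v * partial axis_t f p + zbar p * partial v (partial axis_t f) p)).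
Proof.
move=> sf; rewrite ZopE; have sp w := smooth_partial w sf.
apply: pder_add; apply: pder_scale.
  exact: pder_add (smooth_pder v (sp axis_x)) (pder_scale _ (smooth_pder v (sp axis_y))).
exact: pder_mul (pder_zbar v) (smooth_pder v (sp axis_t)).
Qed.

Lemma pder_Zbarop v f : smooth f -> pder v (Zbarop f) (fun p =>
  2^-1 * (partial v (partial axis_x f) p + 'i%C * partial v (partial axis_y f) p)
  + (- 'i%C) * (dz_axis v * partial axis_t f p + p.1 * partial v (partial axis_t f) p)).
Proof.
move=> sf; rewrite ZbaropE; have sp w := smooth_partial w sf.
apply: pder_add; apply: pder_scale.
  exact: pder_add (smooth_pder v (sp axis_x)) (pder_scale _ (smooth_pder v (sp axis_y))).
exact: pder_mul (pder_z v) (smooth_pder v (sp axis_t)).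
Qed.

(** The second order terms cancel by symmetry of mixed partials; what is left
    comes from differentiating the coefficients [z] and [zbar]. *)
Lemma Zop_Zbarop_commutator f p : smooth f ->
  Zop (Zbarop f) p - Zbarop (Zop f) p = - (2 * 'i%C) * partial axis_t f p.
Proof.
move=> sf; rewrite [Zop (Zbarop f)]ZopE [Zbarop (Zop f)]ZbaropE.
rewrite !(partialE (pder_Zop _ sf)) !(partialE (pder_Zbarop _ sf)).
rewrite !(partialC axis_y axis_x sf) !(partialC axis_t axis_x sf) !(partialC axis_t axis_y sf).
rewrite /dz_axis /dzbar_axis.
have i2 : 'i%C * 'i%C = -1 :> C by rewrite -expr2 sqr_i.
set z := p.1; set zb := zbar p.
set xx := partial axis_x (partial axis_x f) p; set yy := partial axis_y (partial axis_y f) p.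
set xy := partial axis_x (partial axis_y f) p; set xt := partial axis_x (partial axis_t f) p.
set yt := partial axis_y (partial axis_t f) p; set tt := partial axis_t (partial axis_t f) p.
set t := partial axis_t f p.
have key : forall j : C, j * j = -1 ->
  2^-1 * (2^-1 * (xx + j * xy) + - j * (1 * t + z * xt) +
    - j * (2^-1 * (xy + j * yy) + - j * (j * t + z * yt))) +
  j * (zb * (2^-1 * (xt + j * yt) + - j * (0 * t + z * tt))) -
  (2^-1 * (2^-1 * (xx + - j * xy) + j * (1 * t + zb * xt) +
    j * (2^-1 * (xy + - j * yy) + j * (- j * t + zb * yt))) +
  - j * (z * (2^-1 * (xt + - j * yt) + j * (0 * t + zb * tt)))) = - (2 * j) * t.
  move=> j jj.
  have -> : forall A B : C, A = B <-> A - B = 0.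
    by move=> A B; split => [->|/eqP]; rewrite ?subrr // subr_eq0 => /eqP.
  transitivity ((j * j + 1) * (j * t)); last by rewrite jj addNr mul0r.
  by field.
exact: key.
Qed.

(** The vertical field is central, so it commutes with [Z] and [Zbar]. *)
Lemma partial_t_Zop f (k : C) : smooth f -> (forall p, partial axis_t f p = k * f p) ->
  forall p, partial axis_t (Zop f) p = k * Zop f p.
Proof.
move=> sf ft p; rewrite (partialE (pder_Zop axis_t sf)).
have fv v : partial axis_t (partial v f) p = k * partial v f p.
  rewrite (partialC axis_t v sf).
  have -> : partial axis_t f = (fun p => k * f p) by apply/funext.
  by rewrite (partialE (pder_scale k (smooth_pder v sf))).
by rewrite !fv ZopE /dzbar_axis; ring.
Qed.

Lemma partial_t_Zbarop f (k : C) : smooth f -> (forall p, partial axis_t f p = k * f p) ->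
  forall p, partial axis_t (Zbarop f) p = k * Zbarop f p.
Proof.
move=> sf ft p; rewrite (partialE (pder_Zbarop axis_t sf)).
have fv v : partial axis_t (partial v f) p = k * partial v f p.
  rewrite (partialC axis_t v sf).
  have -> : partial axis_t f = (fun p => k * f p) by apply/funext.
  by rewrite (partialE (pder_scale k (smooth_pder v sf))).
by rewrite !fv ZbaropE /=; ring.
Qed.

Lemma Zop_scale k f : smooth f -> Zop (fun p => k * f p) = fun p => k * Zop f p.
Proof.
move=> sf; rewrite !ZopE; apply/funext => p.
by rewrite !(partialE (pder_scale k (smooth_pder _ sf))); ring.
Qed.

Lemma Zbarop_scale k f : smooth f -> Zbarop (fun p => k * f p) = fun p => k * Zbarop f p.
Proof.
move=> sf; rewrite !ZbaropE; apply/funext => p.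
by rewrite !(partialE (pder_scale k (smooth_pder _ sf))); ring.
Qed.

Lemma Zop_add f g : smooth f -> smooth g ->
  Zop (fun p => f p + g p) = fun p => Zop f p + Zop g p.
Proof.
move=> sf sg; rewrite !ZopE; apply/funext => p.
by rewrite !(partialE (pder_add (smooth_pder _ sf) (smooth_pder _ sg))); ring.
Qed.

Lemma Zbarop_mul f g : smooth f -> smooth g ->
  Zbarop (fun p => f p * g p) = fun p => Zbarop f p * g p + f p * Zbarop g p.
Proof.
move=> sf sg; rewrite !ZbaropE; apply/funext => p.
by rewrite !(partialE (pder_mul (smooth_pder _ sf) (smooth_pder _ sg))); ring.
Qed.

Definition act_slope (g : heisC R) (v i : axis) : R :=
  let w := g.1.1 in let l := val g.2 in
  match v, i with
  | axis_x, axis_x => Re l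
  | axis_x, axis_y => Im l
  | axis_x, axis_t => 2 * (Im w * Re l - Re w * Im l)
  | axis_y, axis_x => - Im l
  | axis_y, axis_y => Re l
  | axis_y, axis_t => - (2 * (Im w * Im l + Re w * Re l))
  | axis_t, axis_t => sqnorm l
  | axis_t, _ => 0
  end.

Lemma act_affine (g : heisC R) : affine_map (act g) (act_slope g).
Proof.
case: g => [[[w1 w2] s] [[l1 l2] l0]] v i [[x y] t] r.
by case: v; case: i; rewrite /act_slope /act /mu /sqnorm /=; ring.
Qed.

Lemma smooth_act (g : heisC R) f : smooth f -> smooth (fun p => f (act g p)).
Proof. exact: smooth_affine (act_affine g). Qed.

(** The action is by automorphisms of the CR structure, whose linear part
    multiplies the antiholomorphic direction by the conjugate of [val g.2]. *)
Lemma Zbarop_act (g : heisC R) f p : smooth f ->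
  Zbarop (fun q => f (act g q)) p = (val g.2)^* * Zbarop f (act g p).
Proof.
move=> sf; rewrite !ZbaropE !(partialE (pder_affine _ (act_affine g) sf)).
case: g p => [[[w1 w2] s] [[l1 l2] l0]] [[x y] t]; set q := act _ _.
have -> : q.1 = (w1 +i* w2) + (l1 +i* l2) * (x +i* y) by [].
rewrite /act_slope /=; case: (partial axis_x f q) => a1 a2.
case: (partial axis_y f q) => b1 b2; case: (partial axis_t f q) => c1 c2.
have -> : 2^-1 = (2^-1)%:C :> C by rewrite fmorphV rmorphMn.
by apply: complex_ext; rewrite /sqnorm /= ?creimE /=; field.
Qed.

Lemma partial_t_act (g : heisC R) f p : smooth f ->
  partial axis_t (fun q => f (act g q)) p = (sqnorm (val g.2))%:C * partial axis_t f (act g p).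
Proof.
move=> sf; rewrite (partialE (pder_affine _ (act_affine g) sf)) /act_slope /=.
by rewrite !mul0r !add0r.
Qed.

(** The quotient of [f] by the character has zero vertical derivative. *)
Lemma t_character f (b : R) : smooth f ->
  (forall p, partial axis_t f p = 'i%C * b%:C * f p) ->
  forall z t, f (z, t) = expi (b * t) * f (z, 0).
Proof.
move=> sf ft z t.
have h s : cder (fun s => cexp (- 'i%C * (b * s)%:C) * f (z, s)) s 0.
  have h1 := @smooth_pder _ axis_t f sf (z, s).
  rewrite ft /= in h1.
  have h2 := cder_cexp (cderZ (- 'i%C) (cder_real (is_derive_affine b 0 s))).
  apply: cder_ext (cderM h2 h1) => [u|]; first by rewrite addr0.
  by rewrite addr0; ring.
have := cder0_cst h t 0; rewrite mulr0 mulr0 cexp0 mul1r => <-.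
by rewrite mulNr cexpN cexp_i mulrA mulfV ?mul1r // expi_neq0.
Qed.

End Operators.

(** * Restriction to the surface t = -2xy *)

Section Slices.
Context {R : realType}.
Local Notation C := R[i].
Implicit Types (f g : heis R -> C) (p : heis R) (x y : R).

(** The surface [t = -2xy] is stable under the translation by [1], which therefore
    acts on restrictions to it by [x -> x + 1], without a phase. *)
Definition slice f x y : C := f (mkpt x y (- (2 * x * y))).

(** The vector fields tangent to the surface that project to the coordinate
    fields of the plane. *)
Definition sliceDx f p : C :=
  partial axis_x f p + (-2) * ((get_coord axis_y p)%:C * partial axis_t f p).
Definition sliceDy f p : C :=
  partial axis_y f p + (-2) * ((get_coord axis_x p)%:C * partial axis_t f p).

Lemma smooth_sliceDx f : smooth f -> smooth (sliceDx f).
Proof.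
move=> sf; apply: smooth_add; first exact: smooth_partial.
by apply: smooth_scale; apply: smooth_mul; [exact: smooth_coord | exact: smooth_partial].
Qed.

Lemma smooth_sliceDy f : smooth f -> smooth (sliceDy f).
Proof.
move=> sf; apply: smooth_add; first exact: smooth_partial.
by apply: smooth_scale; apply: smooth_mul; [exact: smooth_coord | exact: smooth_partial].
Qed.

Lemma cder_slice_x f x y : smooth f ->
  cder (fun s => slice f s y) x (slice (sliceDx f) x y).
Proof.
move=> sf.
have h1 := is_derive_affine 1 0 x.
have h2 : is_derive x 1 (fun _ : R => y) 0 := is_derive_cst _ _ _.
have h3 := is_derive_affine (- (2 * y)) 0 x.
have := chain_rule sf h1 h2 h3.
apply: cder_ext => [s|].
  by rewrite /slice mul1r !addr0; congr (f (mkpt _ _ _)); ring.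
rewrite mul1r !addr0 mul0r addr0 /slice /sliceDx /=.
have -> : - (2 * y) * x = - (2 * x * y) by ring.
set q := mkpt _ _ _; have -> : (- (2 * y))%:C = -2 * y%:C :> C.
  by rewrite rmorphN rmorphM /= mulNr rmorphMn.
by rewrite mul1r; ring.
Qed.

Lemma cder_slice_y f x y : smooth f ->
  cder (fun s => slice f x s) y (slice (sliceDy f) x y).
Proof.
move=> sf.
have h1 := is_derive_affine 1 0 y.
have h2 : is_derive y 1 (fun _ : R => x) 0 := is_derive_cst _ _ _.
have h3 := is_derive_affine (- (2 * x)) 0 y.
have := chain_rule sf h2 h1 h3.
apply: cder_ext => [s|].
  by rewrite /slice mul1r !addr0; congr (f (mkpt _ _ _)); ring.
rewrite mul1r !addr0 mul0r add0r /slice /sliceDy /=.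
have -> : - (2 * x) * y = - (2 * x * y) by ring.
set q := mkpt _ _ _; have -> : (- (2 * x))%:C = -2 * x%:C :> C.
  by rewrite rmorphN rmorphM /= mulNr rmorphMn.
by rewrite mul1r; ring.
Qed.

Lemma slice_cont2 f : continuous f -> continuous (fun q : R * R => slice f q.1 q.2).
Proof.
move=> cf q.
apply: (@continuous_cvg _ _ _ _ _ (fun q : R * R => mkpt q.1 q.2 (- (2 * q.1 * q.2))) f).
  exact: cf.
apply: continuous_pairP; [exact: cvg_fst | exact: cvg_snd |].
by apply: cvgN; apply: cvgM; [apply: cvgM; [exact: cvg_cst|exact: cvg_fst]|exact: cvg_snd].
Qed.

Lemma slice_cont f y : smooth f -> continuous (fun x => slice f x y).
Proof. by move=> sf x; exact: cder_cont (cder_slice_x _ _ sf). Qed.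

(** The derivative in [y] of the mean is a mean of derivatives in [x], which
    vanishes by periodicity. *)
Lemma mean_slice_const f (k : C) : smooth f ->
  (forall x y, slice f (x + 1) y = slice f x y) ->
  (forall p, sliceDy f p = k * sliceDx f p) ->
  forall y y', mean (fun x => slice f x y) = mean (fun x => slice f x y').
Proof.
move=> sf pf CR; apply: cder0_cst => y.
have sy := smooth_sliceDy sf.
have := @mean_derive _ (slice f) (slice (sliceDy f)) (slice (sliceDy (sliceDy f))) y
  (fun x s => cder_slice_y x s sf) (fun x s => cder_slice_y x s sy)
  (fun s => @slice_cont f s sf) (fun s => @slice_cont _ s sy)
  (slice_cont2 (smooth_cont (smooth_sliceDy sy))).
have -> : (fun x => slice (sliceDy f) x y) = (fun x => k * slice (sliceDx f) x y).
  by apply/funext => x; rewrite /slice CR.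
rewrite (meanZ _ (@slice_cont _ y (smooth_sliceDx sf))).
rewrite (mean_eq (U := fun x => slice f x y)); last by move=> x; exact: cder_slice_x.
by have := pf 0 y; rewrite add0r => ->; rewrite subrr mulr0.
Qed.

End Slices.

(** * Fourier coefficients of sections over the hexagonal lattice *)

Section ThetaFourier.
Context {R : realType}.
Local Notation C := R[i].
Implicit Types (f g : heis R -> C) (p : heis R) (x y : R).

Definition s3 : R := Num.sqrt 3.

Lemma s3_gt0 : 0 < s3. Proof. by rewrite sqrtr_gt0. Qed.

Lemma s3_sqr : s3 * s3 = 3. Proof. by rewrite -expr2 sqr_sqrtr. Qed.

(** The Fourier coefficient of index [m] in the direction of the period [1]; for a
    function with the multiplier [expi (2 pi mu0)], [m] is an integer plus [mu0]. *)
Definition theta_coef f (m y : R) : C :=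
  mean (fun x => expi (- (2 * pi * m) * x) * slice f x y).

(** For [sg = 1] and [sg = -1] the equation [hCR] is the restriction to the surface
    of [Zbarop f = 0] and of [Zop f = 0]; [hA] and [hB] say how a section behaves under
    the translations by [1] and [omega]. *)
Variables (D : nat) (sg mu0 : R) (e1 : C) (f : heis R -> C).
Let b : R := pi * D%:R / s3.
Hypothesis D0 : (0 < D)%N.
Hypothesis e1_norm : `|e1| = 1.
Hypothesis sg1 : sg * sg = 1.
Hypothesis sf : smooth f.
Hypothesis hCR : forall p,
  sliceDy f p = sg%:C * ('i%C * sliceDx f p - (4 * b * get_coord axis_y p)%:C * f p).
Hypothesis hA : forall x y, slice f (x + 1) y = expi (2 * pi * mu0) * slice f x y.
Hypothesis hB : forall x y, slice f (x - 2^-1) (y + s3 / 2) =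
  e1 * expi (- (2 * pi * D%:R * x) + pi * D%:R / 2) * slice f x y.

(** The exponential of a quadratic form turns [hCR] into the Cauchy-Riemann equation
    or its conjugate, and the mean of a solution does not depend on [y]. *)
Let K (m : R) p : C :=
  cexp ((sg * 2 * pi * m)%:C * (get_coord axis_y p)%:C +
        (2 * sg * b)%:C * ((get_coord axis_y p)%:C * (get_coord axis_y p)%:C) +
        (- 'i%C * (2 * pi * m)%:C) * (get_coord axis_x p)%:C) * f p.

Let K_smooth m : smooth (K m).
Proof.
apply: smooth_mul sf; apply: smooth_cexp.
apply: smooth_add; first apply: smooth_add; apply: smooth_scale; try exact: smooth_coord.
by apply: smooth_mul; exact: smooth_coord.
Qed.

Let KE m x y : slice (K m) x y = (expR (sg * (2 * pi * m * y + 2 * b * y * y)))%:C *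
   (expi (- (2 * pi * m) * x) * slice f x y).
Proof.
rewrite /slice /K [RHS]mulrA; congr (_ * _).
rewrite -[RHS]/(cexp ((sg * (2 * pi * m * y + 2 * b * y * y)) +i* (- (2 * pi * m) * x))).
congr cexp; apply: complex_ext; rewrite /= ?creimE /=; ring.
Qed.

Let K_CR m p : sliceDy (K m) p = (sg%:C * 'i%C) * sliceDx (K m) p.
Proof.
pose q p : C := (sg * 2 * pi * m)%:C * (get_coord axis_y p)%:C +
        (2 * sg * b)%:C * ((get_coord axis_y p)%:C * (get_coord axis_y p)%:C) +
        (- 'i%C * (2 * pi * m)%:C) * (get_coord axis_x p)%:C.
have dq v := pder_add (pder_add (pder_scale (sg * 2 * pi * m)%:C (pder_coord v axis_y))
  (pder_scale (2 * sg * b)%:C (pder_mul (pder_coord v axis_y) (pder_coord v axis_y))))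
  (pder_scale (- 'i%C * (2 * pi * m)%:C) (@pder_coord R v axis_x)).
have dK v := pder_mul (pder_cexp (dq v)) (smooth_pder v sf).
rewrite /sliceDy /sliceDx /K !(partialE (dK _)) /=.
have := hCR p; rewrite /sliceDy /sliceDx.
set E := cexp _; set fx := partial axis_x f p; set fy := partial axis_y f p.
set ft := partial axis_t f p; set F := f p.
set X := (complex.Re p.1)%:C; set Y := (complex.Im p.1)%:C.
move=> H; have {}H : fy = sg%:C * ('i%C * (fx + -2 * (Y * ft)) - (4 * b * complex.Im p.1)%:C * F) + 2 * (X * ft).
  by rewrite -H; ring.
rewrite H !rmorphM /= -/Y.
have s2 : sg%:C * sg%:C = 1 :> C by rewrite -rmorphM sg1.
have i2 : 'i%C * 'i%C = -1 :> C by rewrite -expr2 sqr_i.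
have n2 n : (n%:R : R)%:C = n%:R :> C by rewrite rmorph_nat.
rewrite !n2; set S := sg%:C in s2 *; set P := pi%:C; set M := m%:C; set B := b%:C.
set j : C := 'i%C in i2 *.
apply/eqP; rewrite -subr_eq0; apply/eqP.
transitivity ((j * j + 1) * (2 * S * P * M * E * F)); last by rewrite i2 addNr mul0r.
ring.
Qed.

(** Each coefficient is a Gaussian in [y], decaying for [sg = 1] and growing for
    [sg = -1]. *)
Lemma theta_coef_shape m y y' : (exists n : int, m = n%:~R + mu0) ->
  (expR (sg * (2 * pi * m * y + 2 * b * y * y)))%:C * theta_coef f m y =
  (expR (sg * (2 * pi * m * y' + 2 * b * y' * y')))%:C * theta_coef f m y'.
Proof.
move=> [n mE].
have cw u : continuous (fun x => expi (- (2 * pi * m) * x) * slice f x u : C).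
  by move=> x; apply: cvg_cM; [exact: continuous_expi | exact: slice_cont].
rewrite /theta_coef -!meanZ; try exact: cw.
have eq u : (fun x => (expR (sg * (2 * pi * m * u + 2 * b * u * u)))%:C *
  (expi (- (2 * pi * m) * x) * slice f x u)) = (fun x => slice (K m) x u).
  by apply/funext => x; rewrite KE.
rewrite !eq; apply: mean_slice_const (K_CR m) _ _; first exact: K_smooth.
move=> x u; rewrite !KE hA; congr (_ * _).
rewrite mulrA -expiD mE.
have -> : - (2 * pi * (n%:~R + mu0)) * (x + 1) + 2 * pi * mu0 =
   - (2 * pi * (n%:~R + mu0)) * x + 2 * pi * (- n)%:~R by rewrite rmorphN /=; ring.
by rewrite expiD expi_2pi mulr1.
Qed.

(** The translation by [omega] shifts the index of a coefficient by [D]. *)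
Lemma theta_coef_step m y : (exists n : int, m = n%:~R + mu0) ->
  exists2 k : C, `|k| = 1 & theta_coef f (m + D%:R) y = k * theta_coef f m (y + s3 / 2).
Proof.
move=> [n mE].
pose w x : C := expi (- (2 * pi * m) * x) * slice f x (y + s3 / 2).
have cw : continuous w.
  by move=> x; apply: cvg_cM; [exact: continuous_expi | exact: slice_cont].
have pw x : w (x + 1) = w x.
  rewrite /w hA mulrA -expiD mE.
  have -> : - (2 * pi * (n%:~R + mu0)) * (x + 1) + 2 * pi * mu0 =
     - (2 * pi * (n%:~R + mu0)) * x + 2 * pi * (- n)%:~R by rewrite rmorphN /=; ring.
  by rewrite expiD expi_2pi mulr1.
have e10 : e1 != 0 by rewrite -normr_eq0 e1_norm oner_eq0.
exists (e1^-1 * expi (- (pi * D%:R / 2) - pi * m)).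
  by rewrite normrM normfV e1_norm invr1 mul1r norm_expi.
rewrite /theta_coef -/w -(mean_shift (- 2^-1) cw pw) -meanZ; last exact: continuous_shift.
congr mean; apply/funext => x; rewrite /w hB.
transitivity ((e1^-1 * e1) * (expi (- (pi * D%:R / 2) - pi * m + - (2 * pi * m) * (x + - 2^-1)
  + (- (2 * pi * D%:R * x) + pi * D%:R / 2)) * slice f x y)).
  by rewrite mulVf // mul1r; congr (expi _ * _); field.
by rewrite !expiD; ring.
Qed.

Lemma theta_coef_eq0 m y y' : (exists n : int, m = n%:~R + mu0) ->
  theta_coef f m y = 0 -> theta_coef f m y' = 0.
Proof.
move=> hm h0; have := theta_coef_shape y' y hm; rewrite h0 mulr0.
by move/eqP; rewrite mulf_eq0 => /orP[/eqP/complexI/eqP|/eqP//]; rewrite expR_eq0.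
Qed.

Lemma theta_coef_all (n : int) y :
  (forall r : 'I_D, theta_coef f (r%:R + mu0) 0 = 0) ->
  theta_coef f (n%:~R + mu0) y = 0.
Proof.
move=> h0.
have ex (k : int) : exists n : int, k%:~R + mu0 = n%:~R + mu0 by exists k.
have up (k : int) (z : R) : theta_coef f (k%:~R + mu0) z = 0 -> theta_coef f ((k + D%:Z)%:~R + mu0) z = 0.
  move=> hk; have [c _] := theta_coef_step z (ex k).
  rewrite (theta_coef_eq0 (z + s3 / 2) (ex k) hk) mulr0 => E; rewrite -[RHS]E.
  by congr theta_coef; rewrite intrD -pmulrn; ring.
have down (k : int) (z : R) : theta_coef f ((k + D%:Z)%:~R + mu0) z = 0 -> theta_coef f (k%:~R + mu0) z = 0.
  move=> hk; have [c c1] := theta_coef_step z (ex k).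
  have -> : k%:~R + mu0 + D%:R = (k + D%:Z)%:~R + mu0 by rewrite intrD -pmulrn; ring.
  rewrite hk => /esym/eqP; rewrite mulf_eq0 => /orP[/eqP c0|/eqP h].
    by move: c1; rewrite c0 normr0 => /eqP; rewrite eq_sym oner_eq0.
  exact: theta_coef_eq0 (ex k) h.
have base (r : nat) z : (r < D)%N -> theta_coef f ((r%:Z)%:~R + mu0) z = 0.
  move=> rD; apply: (theta_coef_eq0 (y := 0)) (ex _) _.
  by have := h0 (Ordinal rD).
have pos (q r : nat) z : (r < D)%N -> theta_coef f ((r%:Z + q%:Z * D%:Z)%:~R + mu0) z = 0.
  move=> rD; elim: q => [|q IH]; first by rewrite mul0r addr0; exact: base.
  have -> : r%:Z + q.+1%:Z * D%:Z = r%:Z + q%:Z * D%:Z + D%:Z by rewrite intS; ring.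
  exact: up.
have neg (q r : nat) z : (r < D)%N -> theta_coef f ((r%:Z - q%:Z * D%:Z)%:~R + mu0) z = 0.
  move=> rD; elim: q => [|q IH]; first by rewrite mul0r subr0; exact: base.
  apply: down; have -> // : r%:Z - q.+1%:Z * D%:Z + D%:Z = r%:Z - q%:Z * D%:Z by rewrite intS; ring.
have Dn0 : D%:Z != 0 by rewrite eqz_nat -lt0n.
rewrite (divz_eq n D%:Z) [X in X%:~R]addrC.
have [r rE] : exists r : nat, (n %% D%:Z)%Z = r%:Z.
  by have := modz_ge0 n Dn0; case: ((n %% D)%Z) => // r _; exists r.
have rD : (r < D)%N by have := ltz_pmod n (_ : 0 < D%:Z); rewrite rE ltz_nat; apply.
rewrite rE; case: ((n %/ D)%Z) => q; first exact: pos.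
by rewrite NegzE mulNr; exact: neg.
Qed.

(** By [theta_coef_step] the other coefficients vanish as well, and a continuous
    function without nonzero coefficients is zero. *)
Lemma theta_unique : (forall r : 'I_D, theta_coef f (r%:R + mu0) 0 = 0) ->
  forall x y, slice f x y = 0.
Proof.
move=> h0 x y.
pose u x : C := expi (- (2 * pi * mu0) * x) * slice f x y.
have cu : continuous u.
  by move=> z; apply: cvg_cM; [exact: continuous_expi | exact: slice_cont].
have pu z : u (z + 1) = u z.
  rewrite /u hA mulrA -expiD; congr (expi _ * _); ring.
have uz : forall n, mean (fun x => fmode n x * u x) = 0.
  move=> n; rewrite -[RHS](theta_coef_all (- n) y h0); congr mean; apply/funext => z.
  rewrite /u mulrA /fmode -expiD; congr (expi _ * _); rewrite rmorphN /=; ring.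
have := fourier_unique cu pu uz x => /eqP; rewrite mulf_eq0 => /orP[/eqP e0|/eqP//].
by have := expi_neq0 (- (2 * pi * mu0) * x); rewrite e0 eqxx.
Qed.

Lemma theta_coef_iter m y (j : nat) : (exists n : int, m = n%:~R + mu0) ->
  exists2 k : C, `|k| = 1 & theta_coef f (m + j%:R * D%:R) y = k * theta_coef f m (y + j%:R * (s3 / 2)).
Proof.
move=> hm; elim: j y => [|j IH] y.
  by exists 1; rewrite ?normr1 // !mul0r !addr0 mul1r.
have [n mE] := hm.
have hj : exists n : int, m + j%:R * D%:R = n%:~R + mu0.
  by exists (n + j%:Z * D%:Z); rewrite mE intrD intrM -!pmulrn; ring.
have [k k1 kE] := theta_coef_step y hj; have [l l1 lE] := IH (y + s3 / 2).
exists (k * l); first by rewrite normrM k1 l1 mulr1.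
have -> : m + j.+1%:R * D%:R = m + j%:R * D%:R + D%:R by rewrite -natr1; ring.
by rewrite kE lE -natr1 mulrA; congr (_ * theta_coef f m _); ring.
Qed.

Lemma theta_coef_bound : exists2 B : R, 0 < B & forall m, `|theta_coef f m 0| <= B%:C.
Proof.
have [B1 B10 hB1] : exists2 B, 0 <= B & forall x, 0 <= x <= 1 -> `|Re (slice f x 0)| <= B.
  have [|B B0 BP] := @bounded_strip _ (fun x y => Re (slice f x y)) 0.
    by move=> p; have /cvg_complexP[] := @slice_cont2 R f (smooth_cont sf) p.
  by exists B => // x x01; apply: BP => //; rewrite subrr normr0.
have [B2 B20 hB2] : exists2 B, 0 <= B & forall x, 0 <= x <= 1 -> `|Im (slice f x 0)| <= B.
  have [|B B0 BP] := @bounded_strip _ (fun x y => Im (slice f x y)) 0.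
    by move=> p; have /cvg_complexP[] := @slice_cont2 R f (smooth_cont sf) p.
  by exists B => // x x01; apply: BP => //; rewrite subrr normr0.
exists ((B1 + B2) + (B1 + B2) + 1); first by lra.
move=> m; have cw : continuous (fun x => expi (- (2 * pi * m) * x) * slice f x 0 : C).
  by move=> x; apply: cvg_cM; [exact: continuous_expi | exact: slice_cont].
have h a (u v : R) : 0 <= u -> `|a| <= 1 -> `|v| <= u -> `|a * v| <= u.
  by move=> u0 a1 vu; rewrite normrM -[leRHS]mul1r ler_pM.
have hb x : 0 <= x <= 1 ->
    `|Re (expi (- (2 * pi * m) * x) * slice f x 0)| <= B1 + B2 /\
    `|Im (expi (- (2 * pi * m) * x) * slice f x 0)| <= B1 + B2.
  move=> x01; split.
    rewrite cRe_mul; apply: le_trans (ler_normB _ _) _.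
    by apply: lerD; apply: h => //=; [exact: cos_max|exact: hB1|exact: sin_max|exact: hB2].
  rewrite cIm_mul addrC; apply: le_trans (ler_normD _ _) _.
  by apply: lerD; apply: h => //=; [exact: sin_max|exact: hB1|exact: cos_max|exact: hB2].
have [k1 k2] := mean_bound cw hb.
apply: le_trans (normc_leD _) _; rewrite lecR; rewrite /theta_coef; lra.
Qed.

(** If [sg = -1] the coefficients of index [m + j D] at [y = 0] are, up to phase,
    those of index [m] at height [j s3 / 2], and grow like Gaussians in [j]; but
    coefficients of a bounded function are bounded. *)
Lemma theta_negative : sg = -1 -> forall x y, slice f x y = 0.
Proof.
move=> sgN; apply: theta_unique => r.
set m := r%:R + mu0.
have hm : exists n : int, m = n%:~R + mu0 by exists r%:Z.
apply/eqP/negP => /negP t0.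
have [B B0 BP] := theta_coef_bound.
have [e eE] : exists e : R, `|theta_coef f m 0| = e%:C.
  by eexists; exact: normc_def.
have e0 : 0 < e by rewrite -ltcR -eE normr_gt0.
(* The heights reached from [0] by [j] translations by [omega]. *)
pose Y (j : nat) : R := j%:R * (s3 / 2).
have b0 : 0 < b by rewrite divr_gt0 ?s3_gt0 // mulr_gt0 ?pi_gt0 // ltr0n.
have bnd j : e * (2 * pi * m * Y j + 2 * b * Y j * Y j) <= B.
  have [k k1 kE] := theta_coef_iter 0 j hm.
  have sh := theta_coef_shape 0 (Y j) hm.
  rewrite add0r -/(Y j) in kE.
  move: sh; rewrite !mulr0 addr0 mulr0 expR0 mul1r sgN mulN1r => sh.
  have : `|theta_coef f m 0| <= (expR (- (2 * pi * m * Y j + 2 * b * Y j * Y j)))%:C * B%:C.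
    rewrite sh normrM normc_def /= expr0n addr0 sqrtr_sqr ger0_norm ?expR_ge0 //.
    rewrite ler_wpM2l ?ler0c ?expR_ge0 //.
    by have := BP (m + j%:R * D%:R); rewrite kE normrM k1 mul1r.
  rewrite eE -rmorphM lecR expRN => hle.
  apply: (@le_trans _ _ (e * expR (2 * pi * m * Y j + 2 * b * Y j * Y j))).
    by rewrite ler_pM2l //; apply: le_trans (expR_ge1Dx _); rewrite lerDr ler01.
  by rewrite -ler_pdivlMr ?expR_gt0 // mulrC.
(* Beyond the height [M] the quadratic exponent exceeds [B / e]. *)
pose M := (`|2 * pi * m| + B / e + 1) / (2 * b) + 1.
have M1 : 1 <= M.
  rewrite lerDr; apply: divr_ge0; last by rewrite mulr_ge0 // ltW.
  by rewrite !addr_ge0 // divr_ge0 // ltW.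
have s30 := s3_gt0.
pose j := Num.bound (M / (s3 / 2)).
have jM : M < Y j.
  have := archi_boundP (divr_ge0 (le_trans ler01 M1) (ltW (divr_gt0 s30 (ltr0n _ 2)))).
  by rewrite ltr_pdivrMr // divr_gt0.
have := bnd j; apply/negP; rewrite -ltNge mulrC -ltr_pdivrMr //.
have Y1 : 1 < Y j by exact: le_lt_trans M1 jM.
have h1 : B / e + 1 <= 2 * pi * m + 2 * b * Y j.
  have : 2 * b * M <= 2 * b * Y j by apply: ler_wpM2l; [rewrite mulr_ge0 // ltW | exact: ltW].
  have -> : 2 * b * M = `|2 * pi * m| + B / e + 1 + 2 * b.
    by rewrite /M; field; rewrite !lt0r_neq0.
  have := ler_norm (- (2 * pi * m)); rewrite normrN; lra.
have -> : 2 * pi * m * Y j + 2 * b * Y j * Y j = Y j * (2 * pi * m + 2 * b * Y j) by ring.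
have Be : 0 < B / e by rewrite divr_gt0.
apply: (@lt_le_trans _ _ (1 * (B / e + 1))); first lra.
by apply: ler_pM; lra.
Qed.

End ThetaFourier.

(** * The generators of the group *)

Section Lattice.
Context {R : realType}.
Local Notation C := R[i].
Local Notation s3 := (@s3 R).
Local Notation om := (@omega R).
Implicit Types (f g : heis R -> C) (p : heis R) (x y : R).

Lemma omega_cubed : om ^+ 3 = 1.
Proof.
have e := @expi_2pi R 1; rewrite -e.
have -> : 2 * pi * 1%:~R = 2 * pi / 3 + (2 * pi / 3 + 2 * pi / 3) :> R by field.
by rewrite !expiD !exprS expr0 mulr1.
Qed.

Lemma Im_omega_gt0 : 0 < Im om.
Proof.
apply: sin_gt0_pi; rewrite divr_gt0 ?mulr_gt0 ?pi_gt0 //=.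
by rewrite ltr_pdivrMr // mulrC ltr_pM2l ?pi_gt0 //; lra.
Qed.

Lemma omega_sum : 1 + om + om ^+ 2 = 0.
Proof.
have : (om - 1) * (1 + om + om ^+ 2) = 0.
  by transitivity (om ^+ 3 - 1); [ring | rewrite omega_cubed subrr].
move/eqP; rewrite mulf_eq0 => /orP[|/eqP//]; rewrite subr_eq0 => /eqP o1.
by have := Im_omega_gt0; rewrite o1 ltxx.
Qed.

(** The real part follows from [1 + omega + omega^2 = 0], the imaginary part from
    its square and its sign. *)
Lemma omegaE : om = (- 2^-1) +i* (s3 / 2).
Proof.
have h := omega_sum; have s0 := Im_omega_gt0; have s30 := @s3_gt0 R; have s3s := @s3_sqr R.
case: om h s0 => a b /= [h1 h2] b0.
have a2 : a = - 2^-1.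
  have : b * (1 + 2 * a) = 0 by rewrite -h2; ring.
  by move/eqP; rewrite mulf_eq0 gt_eqF //= => /eqP; lra.
rewrite a2; congr (_ +i* _).
have : (b - s3 / 2) * (b + s3 / 2) = 0.
  have -> : (b - s3 / 2) * (b + s3 / 2) = b * b - (s3 * s3) / 4 by field.
  by rewrite s3s; move: h1; rewrite a2; lra.
move/eqP; rewrite mulf_eq0 => /orP[|]; rewrite ?subr_eq0 ?addr_eq0 => /eqP // e.
have : 0 < s3 / 2 by rewrite divr_gt0.
lra.
Qed.

Lemma Im_omega : Im om = s3 / 2. Proof. by rewrite omegaE. Qed.
Lemma Re_omega : Re om = - 2^-1. Proof. by rewrite omegaE. Qed.

Definition gA : heisC R := ((1, 0), 1%g).
Definition gB : heisC R := ((om, 0), 1%g).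
Definition gG (c : R) : heisC R := ((om / 2, c / 3 + Im om / 6), omegaS).

Lemma act_gA x y t : act gA (mkpt x y t) = mkpt (x + 1) y (t - 2 * y).
Proof.
rewrite /act /= mu1; rewrite -[(_ * _)%g]/(heis_mul _ _) /heis_mul /mkpt /=.
by congr pair; [congr (_ +i* _)|]; ring.
Qed.

Lemma act_gB x y t : act gB (mkpt x y t) = mkpt (x - 2^-1) (y + s3 / 2) (t + s3 * x + y).
Proof.
rewrite /act /gB omegaE /= mu1; rewrite -[(_ * _)%g]/(heis_mul _ _) /heis_mul /mkpt /=.
by congr pair; [congr (_ +i* _)|]; field.
Qed.

Lemma ReX2 : Re (2^-1 : C) = 2^-1 /\ Im (2^-1 : C) = 0.
Proof.
have -> : (2^-1 : C) = (2^-1)%:C by rewrite fmorphV rmorphMn.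
by [].
Qed.

Lemma act_gG c x y t : act (gG c) (mkpt x y t) =
  mkpt (- (x + s3 * y) / 2 - 4^-1) ((s3 * x - y) / 2 + s3 / 4) (t + c / 3 + s3 / 12 - y).
Proof.
have mE : mu (gG c).2 (mkpt x y t) = (om * (x +i* y), sqnorm om * t) by [].
rewrite /act mE -[(gG c).1]/((om / 2, c / 3 + Im om / 6) : heis R).
have [h1 h2] := ReX2; have s3s := @s3_sqr R.
have e2 : om / 2 = (- 4^-1) +i* (s3 / 4).
  by apply: complex_ext; rewrite ?cRe_mul ?cIm_mul h1 h2 Re_omega Im_omega /=; field.
have s3q : s3 ^+ 2 = 3 by rewrite expr2.
rewrite e2 Im_omega omegaE /sqnorm -[(_ * _)%g]/(heis_mul _ _) /heis_mul /mkpt /=.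
congr pair; first by congr (_ +i* _); field.
by field: s3q.
Qed.

Lemma character_zero f (b : R) : smooth f ->
  (forall p, partial axis_t f p = 'i%C * b%:C * f p) ->
  (forall x y, slice f x y = 0) -> forall p, f p = 0.
Proof.
move=> sf ft h [[x y] t]; rewrite (t_character sf ft).
have := h x y; rewrite /slice /mkpt (t_character sf ft) => /eqP.
rewrite mulf_eq0 => /orP[/eqP e0|/eqP ->]; last by rewrite mulr0.
by have := expi_neq0 (b * - (2 * x * y)); rewrite e0 eqxx.
Qed.

Lemma t_shift f (b : R) x y t s : smooth f ->
  (forall p, partial axis_t f p = 'i%C * b%:C * f p) ->
  f (mkpt x y (t + s)) = expi (b * s) * f (mkpt x y t).
Proof.
move=> sf ft; rewrite /mkpt !(t_character sf ft _ (_ + _)) (t_character sf ft _ t).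
by rewrite mulrDr expiD; ring.
Qed.

Lemma slice_gA f (e : C) x y : (forall p, f (act gA p) = e * f p) ->
  slice f (x + 1) y = e * slice f x y.
Proof.
move=> fA; rewrite /slice -fA act_gA; congr (f (mkpt _ _ _)); ring.
Qed.

(** The phase is the value of the vertical character on the vertical distance
    between the surface and its translate by [omega]. *)
Lemma slice_gB f (e : C) (D : nat) x y : smooth f ->
  (forall p, partial axis_t f p = 'i%C * (pi * D%:R / s3)%:C * f p) ->
  (forall p, f (act gB p) = e * f p) ->
  slice f (x - 2^-1) (y + s3 / 2) =
    e * expi (- (2 * pi * D%:R * x) + pi * D%:R / 2) * slice f x y.
Proof.
move=> sf ft fB; rewrite /slice.
have -> : - (2 * (x - 2^-1) * (y + s3 / 2)) = (- (2 * x * y) + s3 * x + y) + (- (2 * s3 * x) + s3 / 2).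
  by field.
rewrite (t_shift _ _ _ _ sf ft) -act_gB fB mulrA; congr (_ * _).
rewrite mulrC; congr (_ * expi _).
by field; rewrite lt0r_neq0 // s3_gt0.
Qed.

(** The equation [Zbarop f p = 0] solved for the derivative along the surface in
    the direction of [y], the vertical derivative being known. *)
Lemma CR_Zbar f (b : R) p : partial axis_t f p = 'i%C * b%:C * f p -> Zbarop f p = 0 ->
  sliceDy f p = 1%:C * ('i%C * sliceDx f p - (4 * b * get_coord axis_y p)%:C * f p).
Proof.
rewrite ZbaropE /sliceDy /sliceDx => ft; rewrite !ft.
case: p ft => [[x y] t] ft; rewrite /= !rmorphM /= rmorph_nat rmorph1.
have -> : x +i* y = x%:C + 'i%C * y%:C by exact: complexE.
set X := x%:C; set Y := y%:C; set j : C := 'i%C; set B := b%:C; set F := f _.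
set fx := partial axis_x f _; set fy := partial axis_y f _ => H.
have i2 : j * j = -1 by rewrite -expr2 sqr_i.
apply/eqP; rewrite -subr_eq0; apply/eqP.
transitivity (- 2 * j * (2^-1 * (fx + j * fy) + - j * ((X + j * Y) * (j * B * F)))
  + (j * j + 1) * (fy - 2 * X * j * B * F - 2 * Y * B * F * (j * j - 2))).
  by field.
by rewrite H i2 addNr mul0r mulr0 addr0.
Qed.

Lemma CR_Zop f (b : R) p : partial axis_t f p = 'i%C * b%:C * f p -> Zop f p = 0 ->
  sliceDy f p = (-1)%:C * ('i%C * sliceDx f p - (4 * b * get_coord axis_y p)%:C * f p).
Proof.
have hz : zbar p = (get_coord axis_x p)%:C - 'i%C * (get_coord axis_y p)%:C.
  by case: p => [[x y] t]; apply: complex_ext; rewrite /= ?creimE /=; ring.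
rewrite ZopE /sliceDy /sliceDx hz => ft; rewrite !ft !rmorphM /= rmorph_nat rmorphN rmorph1.
set X := (complex.Re p.1)%:C; set Y := (complex.Im p.1)%:C; set j : C := 'i%C; set B := b%:C; set F := f _.
set fx := partial axis_x f _; set fy := partial axis_y f _ => H.
have i2 : j * j = -1 by rewrite -expr2 sqr_i.
apply/eqP; rewrite -subr_eq0; apply/eqP.
transitivity (2 * j * (2^-1 * (fx + - j * fy) + j * ((X - j * Y) * (j * B * F)))
  + (j * j + 1) * (fy - 2 * X * j * B * F + 2 * Y * B * F * (j * j - 2))).
  by field.
by rewrite H i2 addNr mul0r mulr0 addr0.
Qed.

End Lattice.

(** * Transfer of dimensions and the ladder of eigenspaces *)

Section Dimension.
Context {K : fieldType}.

(** The semilinear form of invariance of dimension under isomorphisms; [s] is the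
    identity or complex conjugation. *)
Lemma has_dim_transfer (V V' : lmodType K) (E : set V) (E' : set V') (m : nat)
    (s s' : K -> K) (psi : V -> V') (phi : V' -> V) :
  cancel s' s -> s 0 = 0 -> injective s ->
  (forall v, E v -> E' (psi v)) -> (forall v', E' v' -> E (phi v')) ->
  (forall v', E' v' -> psi (phi v') = v') ->
  (forall v, E v -> psi v = 0 -> v = 0) ->
  (forall (e : 'I_m -> V) (a : 'I_m -> K), (forall i, E (e i)) ->
     psi (\sum_i a i *: e i) = \sum_i s (a i) *: psi (e i)) ->
  has_dim E m -> has_dim E' m.
Proof.
move=> ss' s0 sinj EE' E'E psiphi psi0 psiL [e [EE eF]].
have Ee i : E (e i).
  rewrite EE; exists (fun j => (i == j)%:R).
  rewrite (bigD1 i) //= eqxx scale1r big1 ?addr0 // => j /negbTE.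
  by rewrite eq_sym => ->; rewrite scale0r.
exists (psi \o e); split.
  apply/seteqP; split => v' /=.
    move=> E'v; have := E'E _ E'v; rewrite {1}EE => -[a aE].
    exists (s \o a) => /=; rewrite -(psiL e a Ee) -aE psiphi //.
  move=> [a ->]; have -> : \sum_i a i *: psi (e i) = psi (\sum_i s' (a i) *: e i).
    by rewrite psiL //; apply: eq_bigr => i _; rewrite ss'.
  by apply: EE'; rewrite EE; exists (s' \o a).
move=> a h i; have : psi (\sum_i s' (a i) *: e i) = 0.
  by rewrite psiL // -[RHS]h; apply: eq_bigr => j _; rewrite ss'.
move=> /psi0 h'; have /eF/(_ i) : \sum_i s' (a i) *: e i = 0.
  by apply: h'; rewrite EE; exists (s' \o a).
by move=> /(congr1 s); rewrite /= ss' s0.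
Qed.

End Dimension.

Section Levels.
Context {R : realType}.
Local Notation C := R[i].
Local Notation s3 := (@s3 R).
Local Notation om := (@omega R).
Implicit Types (f g : heis R -> C) (p : heis R) (x y : R).

Lemma Zop_conj f p : smooth f -> Zop f p = (Zbarop (fun q => (f q)^*) p)^*.
Proof.
move=> sf; rewrite ZopE ZbaropE !(partialE (pder_conj (smooth_pder _ sf))) /zbar.
have -> : 2^-1 = (2^-1)%:C :> C by rewrite fmorphV rmorphMn.
case: (partial axis_x f p) => a1 a2.
case: (partial axis_y f p) => b1 b2; case: (partial axis_t f p) => c1 c2.
by case: p => [[x y] t]; apply: complex_ext; rewrite /= ?creimE /=; ring.
Qed.

Lemma Zop_act (g : heisC R) f p : smooth f ->
  Zop (fun q => f (act g q)) p = val g.2 * Zop f (act g p).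
Proof.
move=> sf; rewrite (Zop_conj _ (smooth_act g sf)) (Zop_conj _ sf).
rewrite (Zbarop_act g p (smooth_conj sf)).
by case: (Zbarop _ _) => a1 a2; case: (val g.2) => l1 l2; apply: complex_ext; rewrite /=; ring.
Qed.

Lemma Zop_semi (g : heisC R) (eps : C) f p : smooth f ->
  (forall p, f (act g p) = eps * f p) -> val g.2 * Zop f (act g p) = eps * Zop f p.
Proof.
move=> sf fg; rewrite -(Zop_act g p sf).
have -> : (fun q => f (act g q)) = (fun q => eps * f q) by apply/funext => q; exact: fg.
by rewrite (Zop_scale eps sf).
Qed.

Lemma Zbarop_semi (g : heisC R) (eps : C) f p : smooth f ->
  (forall p, f (act g p) = eps * f p) -> (val g.2)^* * Zbarop f (act g p) = eps * Zbarop f p.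
Proof.
move=> sf fg; rewrite -(Zbarop_act g p sf).
have -> : (fun q => f (act g q)) = (fun q => eps * f q) by apply/funext => q; exact: fg.
by rewrite (Zbarop_scale eps sf).
Qed.

Lemma Zop_transl (q : heis R) f p : smooth f ->
  (forall p, f (act (q, 1%g) p) = f p) -> Zop f (act (q, 1%g) p) = Zop f p.
Proof.
move=> sf fq; have h p' : f (act (q, 1%g) p') = 1 * f p' by rewrite mul1r fq.
by have := Zop_semi p sf h; rewrite [X in X * _ = _](_ : _ = 1) // !mul1r.
Qed.

Lemma Zbarop_transl (q : heis R) f p : smooth f ->
  (forall p, f (act (q, 1%g) p) = f p) -> Zbarop f (act (q, 1%g) p) = Zbarop f p.
Proof.
move=> sf fq; have h p' : f (act (q, 1%g) p') = 1 * f p' by rewrite mul1r fq.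
have := Zbarop_semi p sf h; rewrite [X in X * _ = _](_ : _ = 1) ?mul1r //.
exact: conjc1.
Qed.

Lemma smooth_comb (m : nat) (a : 'I_m -> C) (e : 'I_m -> heis R -> C) (s : seq 'I_m) :
  (forall i, smooth (e i)) -> smooth (\sum_(i <- s) a i *: e i).
Proof.
move=> se; elim: s => [|i s IH]; first by rewrite big_nil; exact: smooth_cst.
rewrite big_cons; exact: (smooth_add (smooth_scale (a i) (se i)) IH).
Qed.

Lemma Zop0 : Zop (fun _ : heis R => 0) = (fun=> 0 : C).
Proof.
have := @Zop_scale R 0 _ (@smooth_cst R 0).
have -> : (fun _ : heis R => 0 * 0 : C) = (fun=> 0) by apply/funext => p; rewrite mul0r.
by move=> ->; apply/funext => p; rewrite mul0r.
Qed.

Lemma Zbarop0 : Zbarop (fun _ : heis R => 0) = (fun=> 0 : C).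
Proof.
have := @Zbarop_scale R 0 _ (@smooth_cst R 0).
have -> : (fun _ : heis R => 0 * 0 : C) = (fun=> 0) by apply/funext => p; rewrite mul0r.
by move=> ->; apply/funext => p; rewrite mul0r.
Qed.

Lemma Zop_comb (m : nat) (a : 'I_m -> C) (e : 'I_m -> heis R -> C) :
  (forall i, smooth (e i)) -> Zop (\sum_i a i *: e i) = \sum_i a i *: Zop (e i).
Proof.
move=> se; elim: (index_enum _) => [|i s IH]; first by rewrite !big_nil; exact: Zop0.
rewrite !big_cons -IH.
rewrite (Zop_add (smooth_scale (a i) (se i)) (smooth_comb a s se)).
by rewrite Zop_scale.
Qed.

(** The functions of vertical frequency [b] at height [k] of the ladder that are
    invariant under the lattice and of character [eps] under the screw motion. *)
Definition landau_level (b c : R) (k : nat) (eps : C) : set (heis R -> C) := [set f |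
  [/\ smooth f, forall p, partial axis_t f p = 'i%C * b%:C * f p,
      forall p, Zop (Zbarop f) p = (- (2 * k%:R * b))%:C * f p
    & [/\ forall p, f (act gA p) = f p, forall p, f (act gB p) = f p
        & forall p, f (act (gG c) p) = eps * f p]]].

Lemma commutator_char f (b : R) p : smooth f ->
  (forall p, partial axis_t f p = 'i%C * b%:C * f p) ->
  Zbarop (Zop f) p = Zop (Zbarop f) p - (2 * b)%:C * f p.
Proof.
move=> sf ft; have := Zop_Zbarop_commutator p sf; rewrite ft => h.
have -> : Zbarop (Zop f) p = Zop (Zbarop f) p - (Zop (Zbarop f) p - Zbarop (Zop f) p) by ring.
rewrite h; congr (_ - _).
have i2 : 'i%C * 'i%C = -1 :> C by rewrite -expr2 sqr_i.
have -> : - (2 * 'i%C) * ('i%C * b%:C * f p) = ('i%C * 'i%C) * (- 2 * b%:C * f p) by ring.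
by rewrite i2 rmorphM /= rmorph_nat; ring.
Qed.

Lemma omega_neq0 : om != 0. Proof. exact: expi_neq0. Qed.

Lemma omega_conj : om * om^* = 1.
Proof.
rewrite /omega /expi; apply: complex_ext => /=; last by ring.
by rewrite -[RHS](cos2Dsin2 (2 * pi / 3)); ring.
Qed.

Section UpDown.
Variables (b c : R) (k : nat) (eps : C).
Hypothesis b0 : b != 0.
Let kap : C := (- (2 * k.+1%:R * b))%:C.

Let kap0 : kap != 0.
Proof.
apply/eqP => /complexI/eqP; rewrite oppr_eq0 !mulf_eq0 (negbTE b0) orbF.
by rewrite !pnatr_eq0.
Qed.

(** [Zop] raises the level since [Zbarop] and [Zop] commute up to a scalar; it
    removes a factor [omega] from the character because the screw motion rotates
    holomorphic directions by [omega]. *)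
Lemma landau_level_up f : landau_level b c k (eps * om) f -> landau_level b c k.+1 eps (Zop f).
Proof.
move=> [sf ft fk [fA fB fG]].
have Zb p : Zbarop (Zop f) p = kap * f p.
  rewrite (commutator_char p sf ft) fk /kap -mulrBl -rmorphB; congr (_%:C * _).
  by rewrite -natr1; ring.
split.
- exact: smooth_Zop.
- exact: partial_t_Zop.
- move=> p; have -> : Zbarop (Zop f) = (fun p => kap * f p) by apply/funext.
  by rewrite Zop_scale.
- split => p.
  + exact: Zop_transl.
  + exact: Zop_transl.
  + have h := Zop_semi p sf fG; apply: (mulfI omega_neq0).
    by rewrite -[om in LHS]/(val (gG c).2) h; ring.
Qed.

Lemma landau_level_down f : landau_level b c k.+1 eps f -> landau_level b c k (eps * om) (Zbarop f).
Proof.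
move=> [sf ft fk [fA fB fG]].
have Zb : Zop (Zbarop f) = (fun p => kap * f p) by apply/funext.
split.
- exact: smooth_Zbarop.
- exact: partial_t_Zbarop.
- move=> p; have := commutator_char p (smooth_Zbarop sf) (partial_t_Zbarop sf ft).
  rewrite Zb (Zbarop_scale kap sf) => h.
  have -> : Zop (Zbarop (Zbarop f)) p = kap * Zbarop f p + (2 * b)%:C * Zbarop f p by rewrite h subrK.
  rewrite -mulrDl -rmorphD; congr (_%:C * _); rewrite -natr1; ring.
- split => p.
  + exact: Zbarop_transl.
  + exact: Zbarop_transl.
  + have h := Zbarop_semi p sf fG; rewrite -[val (gG c).2]/om in h.
    by rewrite [eps * om]mulrC -mulrA -h mulrA omega_conj mul1r.
Qed.

Lemma landau_level_step m : has_dim (landau_level b c k (eps * om)) m -> has_dim (landau_level b c k.+1 eps) m.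
Proof.
apply: (@has_dim_transfer _ _ _ _ _ m id id (@Zop R) (fun f => kap^-1 *: Zbarop f)) => //.
- by move=> f; exact: landau_level_up.
- move=> f /landau_level_down [sf ft fk [fA fB fG]].
  have -> : kap^-1 *: Zbarop f = (fun p => kap^-1 * Zbarop f p) by [].
  split.
  + exact: smooth_scale.
  + move=> p; rewrite (partialE (pder_scale kap^-1 (smooth_pder axis_t sf))) ft.
    by ring.
  + move=> p; rewrite (Zbarop_scale kap^-1 sf) (Zop_scale kap^-1 (smooth_Zbarop sf)).
    by rewrite fk; ring.
  + by split => p; rewrite ?fA ?fB ?fG //; ring.
- move=> f [sf ft fk _].
  have -> : kap^-1 *: Zbarop f = (fun p => kap^-1 * Zbarop f p) by [].
  rewrite (Zop_scale kap^-1 (smooth_Zbarop sf)).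
  by apply/funext => p; rewrite fk mulKf.
- move=> f [sf ft fk _] f0; apply/funext => p.
  have := commutator_char p sf ft; rewrite f0 Zbarop0 fk -mulrBl -rmorphB.
  have -> : - (2 * k%:R * b) - 2 * b = - (2 * k.+1%:R * b) by rewrite -natr1; ring.
  by rewrite -/kap => /esym/eqP; rewrite mulf_eq0 (negbTE kap0) => /eqP.
- by move=> e a Ee; apply: Zop_comb => i; case: (Ee i).
Qed.

End UpDown.

(** [Zop] is an isomorphism from each level to the next: its composition with
    [Zbarop] is the scalar [- 2 (k + 1) b] on level [k]. *)
Lemma landau_level_dim (b c : R) (k : nat) (eps : C) m : b != 0 ->
  has_dim (landau_level b c 0 (eps * om ^+ k)) m -> has_dim (landau_level b c k eps) m.
Proof.
move=> b0; elim: k eps => [|k IH] eps; first by rewrite expr0 mulr1.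
rewrite exprS mulrA => h; apply: landau_level_step => //; exact: IH.
Qed.

(** On level zero, [Zbarop f] is killed by [Zop]; it is then a section for which
    the Gaussians grow, hence zero. *)
Lemma landau_level0_Zbar (D : nat) (c : R) eps f : (0 < D)%N ->
  landau_level (pi * D%:R / s3) c 0 eps f -> forall p, Zbarop f p = 0.
Proof.
move=> D0 [sf ft fk [fA fB fG]].
set g := Zbarop f.
have sg : smooth g by exact: smooth_Zbarop.
have gt := partial_t_Zbarop sf ft.
have gz p : Zop g p = 0 by rewrite fk mulr0 mul0r oppr0 mul0r.
have gA' p : g (act gA p) = 1 * g p.
  by rewrite mul1r; exact: Zbarop_transl.
have gB' p : g (act gB p) = 1 * g p.
  by rewrite mul1r; exact: Zbarop_transl.
apply: (character_zero sg gt).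
apply: (@theta_negative R D (-1) 0 1 g) => //.
- by rewrite normr1.
- by rewrite mulrNN mulr1.
- by move=> p; apply: CR_Zop (gt p) (gz p).
- by move=> x y; rewrite mulr0 expi0; exact: slice_gA.
- by move=> x y; exact: slice_gB.
Qed.

End Levels.

(** * Rapidly decreasing trigonometric series *)

Section RapidSeries.
Context {R : realType}.
Local Notation C := R[i].
Implicit Types (u : nat -> R) (d : nat -> R).

Definition tsum u : R := limn (series u).

(** A fixed ratio, so that the sum is at most [2 * M]. *)
Definition geo_bound u (M : R) : Prop := forall j, `|u j| <= M * 2^-1 ^+ j.

Lemma normr_half_lt1 : `|2^-1 : R| < 1.
Proof. by rewrite ger0_norm // invf_lt1 // ltr1n. Qed.

Lemma tsum_cvg u M : geo_bound u M -> cvgn (series u).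
Proof.
move=> uM; apply: normed_cvg.
have g0 n : 0 <= geometric M 2^-1 n by apply: le_trans (uM n).
apply: (@series_le_cvg _ (fun n => `|u n|) (geometric M 2^-1)).
- by move=> n.
- exact: g0.
- exact: uM.
- by apply: is_cvg_geometric_series; exact: normr_half_lt1.
Qed.

Lemma tsum_norm u M : geo_bound u M -> `|tsum u| <= 2 * M.
Proof.
move=> uM; have cu := tsum_cvg uM.
have cg : cvgn (series (geometric M 2^-1)).
  by apply: is_cvg_geometric_series; exact: normr_half_lt1.
have gl : limn (series (geometric M 2^-1)) = 2 * M.
  apply: cvg_lim => //; have := @cvg_geometric_series R M _ normr_half_lt1.
  by have -> // : M / (1 - 2^-1) = 2 * M by field.
rewrite ler_norml /tsum; apply/andP; split.
  have cn : cvgn (series (- u)) by rewrite is_cvg_seriesN.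
  rewrite lerNl -lim_seriesN // -gl; apply: lim_series_le => // n.
  by apply: le_trans (ler_norm _) _; rewrite /= normrN; exact: uM.
rewrite -gl; apply: lim_series_le => // n.
by apply: le_trans (ler_norm _) _; exact: uM.
Qed.

Lemma tsum_comb (a b : R) u v M N : geo_bound u M -> geo_bound v N ->
  tsum (fun j => a * u j + b * v j) = a * tsum u + b * tsum v.
Proof.
move=> /tsum_cvg cu /tsum_cvg cv.
rewrite /tsum -[RHS]/(a *: limn (series u) + b *: limn (series v)).
by rewrite -!lim_seriesZ // -lim_seriesD //; apply: is_cvg_seriesZ.
Qed.

(** Taylor's quadratic bound for each term sums to one for the series. *)
Lemma series_derive (u u' u'' : nat -> R -> R) (x M : R) :
  (forall j (y : R), is_derive y 1 (u j) (u' j y)) ->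
  (forall j (y : R), is_derive y 1 (u' j) (u'' j y)) ->
  (forall y, `|y - x| <= 1 -> geo_bound (fun j => u j y) M) ->
  geo_bound (fun j => u' j x) M ->
  (forall y, `|y - x| <= 1 -> geo_bound (fun j => u'' j y) M) ->
  is_derive x 1 (fun s => tsum (fun j => u j s)) (tsum (fun j => u' j x)).
Proof.
move=> du du' uM u'M u''M; apply: (@is_derive_quad _ _ _ _ (2 * M)) => h h1.
have xx : `|x - x| <= 1 by rewrite subrr normr0.
have xh : `|x + h - x| <= 1 by rewrite addrAC subrr add0r.
have E : tsum (fun j => u j (x + h)) - tsum (fun j => u j x) - h * tsum (fun j => u' j x) =
   tsum (fun j => 1 * (u j (x + h) - u j x) + (- h) * u' j x).
  rewrite (@tsum_comb _ _ _ _ (`|1| * M + `|-1| * M) M) //; last first.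
    move=> j; apply: le_trans (ler_normB _ _) _; rewrite mulrDl !normrN normr1 !mul1r.
    by apply: lerD; exact: uM.
  have := @tsum_comb 1 (-1) (fun j => u j (x + h)) (fun j => u j x) M M (uM _ xh) (uM _ xx).
  have -> : (fun j => 1 * u j (x + h) + -1 * u j x) = (fun j => u j (x + h) - u j x).
    by apply/funext => j; ring.
  by move=> ->; ring.
rewrite E; apply: le_trans (tsum_norm (M := M * h ^+ 2) _) _; last by rewrite mulrA.
move=> j; rewrite mulrAC.
have -> : 1 * (u j (x + h) - u j x) + - h * u' j x = u j (x + h) - u j x - h * u' j x by ring.
apply: (@taylor_quad _ (u j) (u' j) (u'' j) x (M * 2^-1 ^+ j) h h1) => y yx.
exact: u''M.
Qed.

(** A series of sines of odd multiples of [pi z] is odd and antiperiodic. *)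
Definition odd_freq (j : nat) : R := j.*2.+1%:R.

Lemma odd_freqE j : odd_freq j = 2 * j%:R + 1.
Proof. by rewrite /odd_freq -natr1 -muln2 natrM mulrC. Qed.

Lemma odd_freq_ge1 j : 1 <= odd_freq j.
Proof. by rewrite ler1n. Qed.

(** Decay faster than every exponential absorbs the growth of [expR (a y)] as well
    as the factors brought down by differentiation. *)
Definition rapid d : Prop :=
  forall a : R, exists2 M, 0 <= M & forall j, `|d j| * expR (a * odd_freq j) <= M.

Lemma rapid_scale (k : R) d : rapid d -> rapid (fun j => k * odd_freq j * d j).
Proof.
move=> rd a; have [M M0 dM] := rd (a + 1); exists (`|k| * M); first by rewrite mulr_ge0.
move=> j; rewrite !normrM -!mulrA ler_wpM2l //; apply: le_trans (dM j).
have j0 : 0 <= odd_freq j by exact: le_trans (odd_freq_ge1 j).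
rewrite mulrCA ler_wpM2l // mulrDl mul1r expRD mulrC ler_wpM2l ?expR_ge0 //.
by rewrite ger0_norm //; apply: le_trans (expR_ge1Dx _); rewrite lerDr.
Qed.

Lemma expR_half j : expR (- odd_freq j) <= 2^-1 ^+ j :> R.
Proof.
have e1 : 2 <= expR (1 : R) by apply: le_trans (expR_ge1Dx 1).
apply: (@le_trans _ _ (expR (- j%:R))).
  by rewrite ler_expR lerN2 odd_freqE; have := @ler0n R j; lra.
rewrite expRN -[j%:R]mulr1 expRM_natl exprVn lef_pV2 ?posrE ?exprn_gt0 ?expR_gt0 //.
by apply: lerXn2r; rewrite ?nnegrE ?expR_ge0.
Qed.

(** For [a = 0] and [a = - pi / 2] the real and imaginary parts of
    [d j * exp (i pi (2 j + 1) z)], up to the sign [e] of the exponent. *)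
Definition tterm d (a e : R) (j : nat) (x y : R) : R :=
  d j * (cos (odd_freq j * pi * x + a) * expR (e * (odd_freq j * pi * y))).

Lemma tterm_bound d (Y : R) : rapid d -> exists2 M, 0 <= M &
  forall a e x y, `|e| <= 1 -> `|y| <= Y -> geo_bound (fun j => tterm d a e j x y) M.
Proof.
move=> rd; have [M M0 dM] := rd (pi * Y + 1); exists M => // a e x y e1 yY j.
rewrite /tterm normrM; apply: (@le_trans _ _ (`|d j| * (expR (pi * Y * odd_freq j)))).
  apply: ler_wpM2l => //; rewrite normrM -[leRHS]mul1r ler_pM ?cos_max //.
  rewrite ger0_norm ?expR_ge0 // ler_expR; apply: le_trans (ler_norm _) _.
  have j0 : 0 <= odd_freq j by exact: le_trans (odd_freq_ge1 j).
  rewrite !normrM (ger0_norm j0) (ger0_norm (pi_ge0 R)).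
  have -> : pi * Y * odd_freq j = 1 * (odd_freq j * pi * Y) by ring.
  apply: ler_pM => //; first by rewrite mulr_ge0 // mulr_ge0 // pi_ge0.
  by apply: ler_wpM2l => //; rewrite mulr_ge0 // pi_ge0.
have := dM j; rewrite mulrDl mul1r expRD => h.
apply: (@le_trans _ _ (M * expR (- odd_freq j))).
  by move: h; rewrite mulrA -ler_pdivlMr ?expR_gt0 // expRN.
by apply: ler_wpM2l => //; exact: expR_half.
Qed.

Definition tfun d (a e : R) (x y : R) : R := tsum (fun j => tterm d a e j x y).

Lemma is_derive_scale (k : R) (f : R -> R) (x l : R) : is_derive x 1 f l ->
  is_derive x 1 (fun s => k * f s) (k * l).
Proof.
move=> fl; apply: (@is_derive_extf _ (k \*: f)) => //.
Qed.

Lemma tterm_dx d a e j (x y : R) :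
  is_derive x 1 (fun s => tterm d a e j s y)
    (tterm (fun j => pi * odd_freq j * d j) (a + pi / 2) e j x y).
Proof.
have h := @is_derive1_comp R cos (fun s => odd_freq j * pi * s + a) x _ _
  (is_derive_cos (odd_freq j * pi * x + a)) (is_derive_affine (odd_freq j * pi) a x).
pose k := d j * expR (e * (odd_freq j * pi * y)).
apply: (is_derive_ext _ _ (is_derive_scale k h)) => [s|].
  by rewrite /tterm /k /=; ring.
by rewrite /tterm /k /= addrA cosDpihalf; ring.
Qed.

Lemma tterm_dy d a e j (x y : R) :
  is_derive y 1 (fun s => tterm d a e j x s)
    (e * tterm (fun j => pi * odd_freq j * d j) a e j x y).
Proof.
have h := @is_derive1_comp R expR (fun s => e * (odd_freq j * pi) * s + 0) y _ _
  (is_derive_expR (e * (odd_freq j * pi) * y + 0)) (is_derive_affine (e * (odd_freq j * pi)) 0 y).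
pose k := d j * cos (odd_freq j * pi * x + a).
apply: (is_derive_ext _ _ (is_derive_scale k h)) => [s|].
  by rewrite /tterm /k /= addr0 !mulrA.
by rewrite /tterm /k /= addr0 !mulrA; ring.
Qed.

Lemma tfun_dx d a e (x y : R) : rapid d -> `|e| <= 1 ->
  is_derive x 1 (fun s => tfun d a e s y) (tfun (fun j => pi * odd_freq j * d j) (a + pi / 2) e x y).
Proof.
move=> rd e1; have rd1 := rapid_scale pi rd; have rd2 := rapid_scale pi rd1.
have [M0 M00 b0] := tterm_bound `|y| rd; have [M1 M10 b1] := tterm_bound `|y| rd1.
have [M2 M20 b2] := tterm_bound `|y| rd2.
have mono u M M' : geo_bound u M -> M <= M' -> geo_bound u M'.
  by move=> uM MM' j; apply: le_trans (uM j) _; rewrite ler_wpM2r // exprn_ge0.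
pose d1 (j : nat) : R := pi * odd_freq j * d j; pose d2 (j : nat) : R := pi * odd_freq j * d1 j.
apply: (@series_derive (fun j s => tterm d a e j s y) (fun j s => tterm d1 (a + pi / 2) e j s y)
  (fun j s => tterm d2 (a + pi / 2 + pi / 2) e j s y) x (M0 + M1 + M2)).
- by move=> j s; exact: tterm_dx.
- by move=> j s; exact: tterm_dx.
- by move=> s _; apply: mono (b0 a e s y e1 (lexx _)) _; lra.
- by apply: mono (b1 (a + pi / 2) e x y e1 (lexx _)) _; lra.
- by move=> s _; apply: mono (b2 (a + pi / 2 + pi / 2) e s y e1 (lexx _)) _; lra.
Qed.

Lemma tfun_dy d a e (x y : R) : rapid d -> `|e| <= 1 ->
  is_derive y 1 (fun s => tfun d a e x s) (e * tfun (fun j => pi * odd_freq j * d j) a e x y).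
Proof.
move=> rd e1; have rd1 := rapid_scale pi rd; have rd2 := rapid_scale pi rd1.
have [M0 M00 b0] := tterm_bound (`|y| + 1) rd; have [M1 M10 b1] := tterm_bound (`|y| + 1) rd1.
have [M2 M20 b2] := tterm_bound (`|y| + 1) rd2.
have nb u M M' (k : R) : 0 <= M -> `|k| <= 1 -> geo_bound u M -> M <= M' -> geo_bound (fun j => k * u j) M'.
  move=> Mp k1 uM MM' j; apply: (@le_trans _ _ (M * 2^-1 ^+ j)).
    by rewrite normrM -[leRHS]mul1r ler_pM.
  by rewrite ler_wpM2r // exprn_ge0.
have near1 s : `|s - y| <= 1 -> `|s| <= `|y| + 1.
  by move=> sy; have := ler_normD (s - y) y; rewrite subrK => h; lra.
have yy : `|y| <= `|y| + 1 by rewrite lerDl.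
have -> : e * tfun (fun j => pi * odd_freq j * d j) a e x y =
  tsum (fun j => e * tterm (fun j => pi * odd_freq j * d j) a e j x y).
  have := @tsum_comb e 0 _ _ _ _ (b1 a e x y e1 yy) (b1 a e x y e1 yy).
  rewrite mul0r addr0 => <-; congr tsum; apply/funext => j; ring.
have ee : `|e * e| <= 1 by rewrite normrM mulr_ile1.
pose d1 (j : nat) : R := pi * odd_freq j * d j; pose d2 (j : nat) : R := pi * odd_freq j * d1 j.
apply: (@series_derive (fun j s => tterm d a e j x s) (fun j s => e * tterm d1 a e j x s)
  (fun j s => e * e * tterm d2 a e j x s) y (M0 + M1 + M2)).
- by move=> j s; exact: tterm_dy.
- move=> j s.
  have h := tterm_dy (fun j => pi * odd_freq j * d j) a e j x s.
  by apply: (is_derive_ext _ _ (is_derive_scale e h)); rewrite ?mulrA.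
- move=> s /near1 sy; have := nb _ _ (M0 + M1 + M2) 1 M00 _ (b0 a e x s e1 sy).
  rewrite normr1 lexx => /(_ isT) h; have {}h := h ltac:(lra).
  by move=> j; have := h j; rewrite mul1r.
- by apply: nb M10 e1 (b1 a e x y e1 yy) _; lra.
- by move=> s /near1 sy; apply: nb M20 ee (b2 a e x s e1 sy) _; lra.
Qed.

Lemma tfun_bound d (Y : R) : rapid d -> exists2 M, 0 <= M &
  forall a e x y, `|e| <= 1 -> `|y| <= Y -> `|tfun d a e x y| <= M.
Proof.
move=> rd; have [M M0 dM] := tterm_bound Y rd; exists (2 * M); first by rewrite mulr_ge0.
by move=> a e x y e1 yY; apply: tsum_norm; exact: dM.
Qed.

(** The mean value theorem along each axis, with the derivatives bounded on a
    strip. *)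
Lemma tfun_cont d a e : rapid d -> `|e| <= 1 ->
  continuous (fun p : heis R => tfun d a e (get_coord axis_x p) (get_coord axis_y p)).
Proof.
move=> rd e1 p; set x0 := get_coord axis_x p; set y0 := get_coord axis_y p.
have [M M0 MP] := tfun_bound (`|y0| + 1) (rapid_scale pi rd).
apply/cvgrPdist_le => eps eps0.
have cx := @get_coord_continuous R axis_x p; have cy := @get_coord_continuous R axis_y p.
have d0 : 0 < Num.min 1 (eps / (2 * M + 1)).
  by rewrite lt_min ltr01 divr_gt0 // ltr_wpDl // mulr_ge0.
near=> q.
have hx : `|x0 - get_coord axis_x q| < Num.min 1 (eps / (2 * M + 1)).
  by near: q; move/cvgrPdist_lt : cx; apply.
have hy : `|y0 - get_coord axis_y q| < Num.min 1 (eps / (2 * M + 1)).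
  by near: q; move/cvgrPdist_lt : cy; apply.
set x := get_coord axis_x q in hx *; set y := get_coord axis_y q in hy *.
move: hx hy; rewrite !lt_min => /andP[_ hx] /andP[hy1 hy].
have ny s : `|s - y0| <= `|y - y0| -> `|s| <= `|y0| + 1.
  move=> sy; have := ler_normD (s - y0) y0; rewrite subrK distrC in hy1 * => h; lra.
have [xi [_ xiE]] := @MVT_between _ _ _ x x0 (fun s => tfun_dx a s y0 rd e1).
have [eta [etaP etaE]] := @MVT_between _ _ _ y0 y (fun s => tfun_dy a x s rd e1).
have b1 : `|tfun d a e x0 y0 - tfun d a e x y0| <= M * `|x0 - x|.
  by rewrite xiE normrM ler_wpM2r //; apply: MP => //; rewrite lerDl.
have b2 : `|tfun d a e x y - tfun d a e x y0| <= M * `|y0 - y|.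
  rewrite etaE normrM (distrC y) ler_wpM2r // normrM -[leRHS]mul1r ler_pM //.
  by apply: MP => //; exact: ny etaP.
have -> : tfun d a e x0 y0 - tfun d a e x y = (tfun d a e x0 y0 - tfun d a e x y0) -
   (tfun d a e x y - tfun d a e x y0) by ring.
apply: le_trans (ler_normB _ _) _; apply: le_trans (lerD b1 b2) _.
rewrite -mulrDr.
have : (2 * M + 1) * (eps / (2 * M + 1)) = eps.
  by rewrite mulrC divfK // gt_eqF // ltr_wpDl // mulr_ge0.
move: (eps / _) hx hy => k hx hy <-.
have k0 : 0 <= k by exact: le_trans (ltW hx).
apply: (@le_trans _ _ (M * (k + k))).
  by apply: ler_wpM2l => //; apply: lerD; exact: ltW.
have -> : (2 * M + 1) * k = M * (k + k) + k by ring.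
by rewrite lerDl.
Unshelve. all: by end_near. Qed.

End RapidSeries.

(** * Odd exponential series and the theta coefficients *)

Section ThetaFunction.
Context {R : realType}.
Local Notation C := R[i].
Local Notation s3 := (@s3 R).
Local Notation om := (@omega R).
Implicit Types (f g : heis R -> C) (p : heis R) (x y : R) (d : nat -> R).

(** The series of [d j * exp (i pi e (2 j + 1) z)] for [e = 1] or [e = -1]. *)
Definition zexp d (e : R) p : C :=
  tfun d 0 (- e) (get_coord axis_x p) (get_coord axis_y p) +i*
  (e * tfun d (- (pi / 2)) (- e) (get_coord axis_x p) (get_coord axis_y p)).

Definition freq_scale d (j : nat) : R := pi * odd_freq j * d j.

Lemma tsumN (u : nat -> R) M : geo_bound u M -> tsum (fun j => - u j) = - tsum u.
Proof.
move=> uM; have := tsum_comb (-1) 0 uM uM.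
rewrite mul0r addr0 mulN1r => <-; congr tsum; apply/funext => j; ring.
Qed.

Lemma tfun_alt d (e x y : R) : rapid d -> `|e| <= 1 ->
  tfun d (0 + pi / 2) e x y = - tfun d (- (pi / 2)) e x y.
Proof.
move=> rd e1; have [M _ bM] := tterm_bound `|y| rd.
rewrite /tfun -(tsumN (bM (- (pi / 2)) e x y e1 (lexx _))); congr tsum; apply/funext => j.
rewrite /tterm add0r cosDpihalf cosBpihalf; ring.
Qed.

Section Sign.
Variables (d : nat -> R) (e : R).
Hypothesis rd : rapid d.
Hypothesis e1 : e = 1 \/ e = -1.

Let ne : `|- e| <= 1. Proof. by case: e1 => ->; rewrite ?normrN ?opprK normr1. Qed.
Let ee : e * e = 1. Proof. by case: e1 => ->; ring. Qed.

Lemma pder_zexp_x : pder axis_x (zexp d e) (fun p => ('i%C * e%:C) * zexp (freq_scale d) e p).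
Proof.
move=> [[x y] t]; have rd1 : rapid (freq_scale d) := rapid_scale pi rd.
split.
  apply: is_derive_ext (tfun_dx 0 x y rd ne) => //.
  transitivity (- (e * e) * tfun (freq_scale d) (- (pi / 2)) (- e) x y).
    by rewrite ee mulN1r; exact: tfun_alt.
  by rewrite /zexp /=; ring.
apply: is_derive_ext (is_derive_scale e (tfun_dx (- (pi / 2)) x y rd ne)) => //.
by rewrite addNr /zexp /=; ring.
Qed.

Lemma pder_zexp_y : pder axis_y (zexp d e) (fun p => (- e%:C) * zexp (freq_scale d) e p).
Proof.
move=> [[x y] t]; split.
  apply: is_derive_ext (tfun_dy 0 x y rd ne) => //.
  by rewrite /zexp /freq_scale /=; ring.
apply: is_derive_ext (is_derive_scale e (tfun_dy (- (pi / 2)) x y rd ne)) => //.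
by rewrite /zexp /freq_scale /=; ring.
Qed.

Lemma pder_zexp_t : pder axis_t (zexp d e) (fun p => 0).
Proof. by move=> [[x y] t]; exact: (@cder_cst R (zexp d e (x +i* y, t)) t). Qed.

Lemma zexp_cont : continuous (zexp d e).
Proof.
move=> p; apply/cvg_complexP; split; first exact: tfun_cont.
by apply: cvgM; [exact: cvg_cst | exact: tfun_cont].
Qed.

Lemma zexp_cvg p :
  (fun n => \sum_(0 <= j < n) (d j)%:C * cexp ('i%C * (e * odd_freq j * pi)%:C * p.1))
    @ \oo --> zexp d e p.
Proof.
case: p => [[x y] t].
have [M _ bM] := tterm_bound `|y| rd.
have cv a : series (fun j => tterm d a (- e) j x y) @ \oo --> tfun d a (- e) x y.
  by apply: tsum_cvg (bM a (- e) x y ne (lexx _)).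
have reE (F : nat -> C) n : complex.Re (\sum_(0 <= j < n) F j) = \sum_(0 <= j < n) complex.Re (F j).
  exact: raddf_sum.
have imE (F : nat -> C) n : complex.Im (\sum_(0 <= j < n) F j) = \sum_(0 <= j < n) complex.Im (F j).
  exact: raddf_sum.
have ecos u : cos (e * u) = cos u.
  by case: e1 => ->; rewrite ?mul1r // mulN1r cosN.
have esin u : sin (e * u) = e * sin u.
  by case: e1 => ->; rewrite ?mul1r // !mulN1r sinN.
apply/cvg_complexP; split.
  have -> // : (fun n => complex.Re (\sum_(0 <= j < n) (d j)%:C * cexp ('i%C * (e * odd_freq j * pi)%:C * (x +i* y)))) =
     series (fun j => tterm d 0 (- e) j x y).
  apply/funext => n; rewrite reE /series /=; apply: eq_bigr => j _.
  rewrite /tterm addr0 -(ecos (_ * x)) /=.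
  have -> : e * (odd_freq j * pi * x) = (0 * (e * odd_freq j * pi) - 1 * 0) * y +
    (0 * 0 + 1 * (e * odd_freq j * pi)) * x by ring.
  have -> : - e * (odd_freq j * pi * y) = (0 * (e * odd_freq j * pi) - 1 * 0) * x -
    (0 * 0 + 1 * (e * odd_freq j * pi)) * y by ring.
  ring.
have -> : (fun n => complex.Im (\sum_(0 <= j < n) (d j)%:C * cexp ('i%C * (e * odd_freq j * pi)%:C * (x +i* y)))) =
     (fun n => e * series (fun j => tterm d (- (pi / 2)) (- e) j x y) n).
  apply/funext => n; rewrite imE /series /= mulr_sumr; apply: eq_bigr => j _.
  rewrite /tterm cosBpihalf.
  have -> : e * (d j * (sin (odd_freq j * pi * x) * expR (- e * (odd_freq j * pi * y)))) =
    d j * (sin (e * (odd_freq j * pi * x)) * expR (- e * (odd_freq j * pi * y))).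
    by rewrite esin; ring.
  rewrite /=.
  have -> : e * (odd_freq j * pi * x) = (0 * (e * odd_freq j * pi) - 1 * 0) * y +
    (0 * 0 + 1 * (e * odd_freq j * pi)) * x by ring.
  have -> : - e * (odd_freq j * pi * y) = (0 * (e * odd_freq j * pi) - 1 * 0) * x -
    (0 * 0 + 1 * (e * odd_freq j * pi)) * y by ring.
  ring.
by apply: cvgM; [exact: cvg_cst | exact: cv].
Qed.

End Sign.

(** Differentiation multiplies the coefficients by a multiple of their index,
    which preserves rapid decay. *)
Lemma smooth_zexp d e : rapid d -> e = 1 \/ e = -1 -> smooth (zexp d e).
Proof.
move=> rd e1.
pose S := [set h | exists2 d, rapid d & h = zexp d e].
apply: (@smooth_alg _ S); last by apply: fun_alg_gen; exists d.
move=> _ [{}d {}rd ->]; split; first exact: zexp_cont.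
have gen : fun_alg S (zexp (freq_scale d) e).
  by apply: fun_alg_gen; exists (freq_scale d) => //; exact: rapid_scale.
case.
- eexists; last exact: pder_zexp_x.
  by apply: fun_alg_mul => //; exact: fun_alg_cst.
- eexists; last exact: pder_zexp_y.
  by apply: fun_alg_mul => //; exact: fun_alg_cst.
- eexists; last exact: pder_zexp_t.
  exact: fun_alg_cst.
Qed.

(** A form of quasi-periodicity that is exact on partial sums: the shift maps
    terms to terms, except that one term changes from the series in [w^-1] to the one
    in [w]; the lengths of the sums account for it. *)
Lemma theta_shift_identity (F : fieldType) (a : nat -> F) (q w : F) (n : nat) :
  q != 0 -> w != 0 -> (forall j, a j.+1 = - a j * q ^+ (2 * j + 2)) ->
  \sum_(0 <= j < n.+1) a j * (q * w) ^+ (2 * j + 1) -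
  \sum_(0 <= j < n.+1) a j / (q * w) ^+ (2 * j + 1) =
  - (q^-1 * w ^- 2) * (\sum_(0 <= j < n.+2) a j * w ^+ (2 * j + 1) -
     \sum_(0 <= j < n) a j / w ^+ (2 * j + 1)).
Proof.
move=> q0 w0 aS; elim: n => [|n IH].
  rewrite !big_nat_recr //= !big_geq // !add0r aS; field.
  by rewrite q0 w0.
rewrite [in LHS]big_nat_recr //= [X in _ - X]big_nat_recr //=.
rewrite [in RHS]big_nat_recr //= [X in _ * (_ - X)]big_nat_recr //=.
have h (A B c e k X Y u v : F) : A - B = k * (X - Y) -> c - e = k * (u - v) ->
   A + c - (B + e) = k * (X + u - (Y + v)).
  move=> h1 h2; have -> : A + c - (B + e) = (A - B) + (c - e) by ring.
  by rewrite h1 h2; ring.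
apply: h IH _; rewrite (aS n.+1) (aS n).
rewrite !mulnS !exprMn !exprD !expr1; field.
by rewrite q0 w0 !expf_neq0.
Qed.

(** The number [- exp (2 pi i omega)]. *)
Definition theta_q : R := expR (- (pi * s3)).

(** The coefficients of the odd theta function of [C / L_omega]:
    [(-1)^j exp (2 pi i omega) ^ (j (j + 1) / 2)]. *)
Definition tcoef (j : nat) : R := (-1) ^+ j * (- theta_q) ^+ 'C(j.+1, 2).

Lemma tcoefS j : tcoef j.+1 = - tcoef j * (- theta_q) ^+ j.+1.
Proof. by rewrite /tcoef binS bin1 exprD exprS; ring. Qed.

Lemma theta_q_gt0 : 0 < theta_q. Proof. exact: expR_gt0. Qed.

Lemma norm_tcoef j : `|tcoef j| = theta_q ^+ 'C(j.+1, 2).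
Proof.
by rewrite normrM !normrX normrN1 expr1n mul1r normrN ger0_norm // ltW // theta_q_gt0.
Qed.

Lemma bin2R (j : nat) : ('C(j.+1, 2))%:R = (j%:R * j%:R + j%:R) / 2 :> R.
Proof.
elim: j => [|j IH]; first by rewrite mul0r addr0 mul0r.
by rewrite binS bin1 natrD IH -[j.+1%:R]natr1; field.
Qed.

(** The exponent is quadratic in [j]; completing the square gives the bound. *)
Lemma rapid_tcoef : rapid tcoef.
Proof.
move=> a; have s30 := @s3_gt0 R; have p0 := pi_gt0 R.
(* [A] is half the exponent of [theta_q], as the binomial coefficient is about
   [j ^+ 2 / 2]. *)
pose A : R := pi * s3 / 2; have A0 : 0 < A by rewrite divr_gt0 // mulr_gt0.
exists (expR (a * a / A + a)); first exact: expR_ge0.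
move=> j; rewrite norm_tcoef /theta_q -expRM_natl -expRD ler_expR bin2R odd_freqE.
have -> : (j%:R * j%:R + j%:R) / 2 * - (pi * s3) + a * (2 * j%:R + 1) =
  - (A * (j%:R * j%:R)) - A * j%:R + 2 * a * j%:R + a by rewrite /A; field.
have : 0 <= (A * j%:R - a) ^+ 2 / A by rewrite divr_ge0 ?sqr_ge0 // ltW.
have -> : (A * j%:R - a) ^+ 2 / A = A * (j%:R * j%:R) - 2 * a * j%:R + a * a / A.
  by field; rewrite gt_eqF.
have : 0 <= A * j%:R by rewrite mulr_ge0 // ltW.
lra.
Qed.

End ThetaFunction.

(** * The odd theta function of the hexagonal lattice *)

Section Theta.
Context {R : realType}.
Local Notation C := R[i].
Local Notation s3 := (@s3 R).
Local Notation om := (@omega R).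
Local Notation tc := (@tcoef R).
Implicit Types (f g : heis R -> C) (p : heis R) (x y t : R).

(** The frequency [2 pi n / c] when [D = n N] and [c = 4 Im omega / N]. *)
Definition weight (D : nat) : R := pi * D%:R / s3.

Lemma weight_s3 D : weight D * s3 = pi * D%:R.
Proof. by rewrite /weight divfK // gt_eqF // s3_gt0. Qed.

(** The factor [cexp (theta_phase p)] has the vertical frequency [weight 1] and
    turns a holomorphic function of [z] into a solution of [Zbarop f = 0]. *)
Definition theta_phase p : C :=
  ('i%C * (weight 1)%:C) * ((get_coord axis_t p)%:C +
     2 * ((get_coord axis_x p)%:C * (get_coord axis_y p)%:C)) +
  (- 2 * weight 1)%:C * ((get_coord axis_y p)%:C * (get_coord axis_y p)%:C).

(** The series [2 i * sum_j tcoef j * sin ((2 j + 1) pi z)]. *)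
Definition theta_hol p : C := zexp tc 1 p + (-1) * zexp tc (-1) p.

Definition theta p : C := cexp (theta_phase p) * theta_hol p.

Lemma smooth_theta_hol : smooth theta_hol.
Proof.
apply: smooth_add; last apply: smooth_scale.
  by apply: smooth_zexp; [exact: rapid_tcoef | left].
by apply: smooth_zexp; [exact: rapid_tcoef | right].
Qed.

Lemma smooth_theta_phase : smooth theta_phase.
Proof.
apply: smooth_add; apply: smooth_scale; last by apply: smooth_mul; exact: smooth_coord.
apply: smooth_add; first exact: smooth_coord.
by apply: smooth_scale; apply: smooth_mul; exact: smooth_coord.
Qed.

Lemma smooth_theta : smooth theta.
Proof.
by apply: smooth_mul smooth_theta_hol; exact: smooth_cexp smooth_theta_phase.
Qed.

Lemma pder_theta_phase v : pder v theta_phase (fun p =>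
  ('i%C * (weight 1)%:C) * ((axis_eq v axis_t)%:R +
     2 * ((axis_eq v axis_x)%:R * (get_coord axis_y p)%:C +
          (get_coord axis_x p)%:C * (axis_eq v axis_y)%:R)) +
  (- 2 * weight 1)%:C * ((axis_eq v axis_y)%:R * (get_coord axis_y p)%:C +
     (get_coord axis_y p)%:C * (axis_eq v axis_y)%:R)).
Proof.
exact: (pder_add (pder_scale _ (pder_add (pder_coord v axis_t)
  (pder_scale 2 (pder_mul (pder_coord v axis_x) (pder_coord v axis_y)))))
  (pder_scale _ (pder_mul (pder_coord v axis_y) (pder_coord v axis_y)))).
Qed.

Lemma theta_t p : partial axis_t theta p = 'i%C * (weight 1)%:C * theta p.
Proof.
have h := pder_mul (pder_cexp (pder_theta_phase axis_t)) (smooth_pder axis_t smooth_theta_hol).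
rewrite (partialE h) /=.
have -> : partial axis_t theta_hol p = 0.
  have h' := pder_add (@pder_zexp_t R tc 1) (pder_scale (-1) (@pder_zexp_t R tc (-1))).
  by rewrite (partialE h'); ring.
by rewrite /theta; ring.
Qed.

Lemma Zbar_theta p : Zbarop theta p = 0.
Proof.
rewrite (Zbarop_mul (smooth_cexp smooth_theta_phase) smooth_theta_hol).
have theta_hol0 : Zbarop theta_hol p = 0.
  have l1 : (1 : R) = 1 \/ (1 : R) = -1 by left.
  have l2 : (-1 : R) = 1 \/ (-1 : R) = -1 by right.
  have rt := @rapid_tcoef R.
  have hx := pder_add (pder_zexp_x rt l1) (pder_scale (-1) (pder_zexp_x rt l2)).
  have hy := pder_add (pder_zexp_y rt l1) (pder_scale (-1) (pder_zexp_y rt l2)).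
  have ht := pder_add (@pder_zexp_t R tc 1) (pder_scale (-1) (@pder_zexp_t R tc (-1))).
  rewrite ZbaropE (partialE hx) (partialE hy) (partialE ht) !rmorphN !rmorph1; ring.
have h v := pder_cexp (pder_theta_phase v).
rewrite theta_hol0 mulr0 addr0 ZbaropE (partialE (h axis_x)) (partialE (h axis_y)) (partialE (h axis_t)) /=.
have e2 : (- 2 * weight 1)%:C = - 2 * (weight 1)%:C :> C by rewrite rmorphM rmorphN rmorph_nat.
rewrite e2; have := complexE p.1.
set j : C := 'i%C; set X := (complex.Re p.1)%:C; set Y := (complex.Im p.1)%:C => pE.
set W := (weight 1)%:C; set E := cexp _; set G := theta_hol p.
have i2 : j * j = -1 by rewrite -expr2 sqr_i.
rewrite pE.
transitivity (- (j * j + 1) * j * W * Y * E * G); last by rewrite i2; ring.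
by field.
Qed.

Lemma cvg_addn_shift (u : nat -> C) (l : C) k : u n @[n --> \oo] --> l ->
  u (n + k)%N @[n --> \oo] --> l.
Proof. by move=> h; apply: cvg_comp h; exact: cvg_addnr. Qed.

Lemma ccvg_unique (u : nat -> C) (l l' : C) : u n @[n --> \oo] --> l ->
  u n @[n --> \oo] --> l' -> l = l'.
Proof.
move=> /cvg_complexP[h1 h2] /cvg_complexP[k1 k2]; apply: complex_ext.
  exact: (cvg_unique (@Rhausdorff R) h1 k1).
exact: (cvg_unique (@Rhausdorff R) h2 k2).
Qed.

Lemma cvg_seq_ext (u v : nat -> C) (l : C) : (forall n, u n = v n) ->
  u n @[n --> \oo] --> l -> v n @[n --> \oo] --> l.
Proof. by move=> /funext ->. Qed.

Definition theta_w p : C := cexp ('i%C * pi%:C * p.1).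

Lemma odd_freqC (j : nat) : (odd_freq j : R)%:C = (2 * j + 1)%:R :> C.
Proof. by rewrite /odd_freq rmorph_nat -addn1 mul2n. Qed.

Lemma phaseC (e : R) (j : nat) (z : C) :
  'i%C * (e * odd_freq j * pi)%:C * z = e%:C * (('i%C * pi%:C * z) *+ (2 * j + 1)).
Proof.
have -> : (e * odd_freq j * pi)%:C = e%:C * (2 * j + 1)%:R * pi%:C :> C.
  by rewrite -odd_freqC -!rmorphM.
by rewrite -[X in _ = e%:C * X]mulr_natr; ring.
Qed.

Lemma zexp_pos_cvg p :
  (fun n => \sum_(0 <= j < n) (tc j)%:C * theta_w p ^+ (2 * j + 1)) @ \oo --> zexp tc 1 p.
Proof.
have l1 : (1 : R) = 1 \/ (1 : R) = -1 by left.
apply: cvg_seq_ext (@zexp_cvg R tc 1 (@rapid_tcoef R) l1 p).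
move=> n; apply: eq_bigr => j _; congr (_ * _).
by rewrite -cexpMn; congr cexp; rewrite phaseC rmorph1 mul1r.
Qed.

Lemma zexp_neg_cvg p :
  (fun n => \sum_(0 <= j < n) (tc j)%:C / theta_w p ^+ (2 * j + 1)) @ \oo --> zexp tc (-1) p.
Proof.
have l2 : (-1 : R) = 1 \/ (-1 : R) = -1 by right.
apply: cvg_seq_ext (@zexp_cvg R tc (-1) (@rapid_tcoef R) l2 p).
move=> n; apply: eq_bigr => j _; congr (_ * _).
by rewrite -cexpMn -cexpN; congr cexp; rewrite phaseC rmorphN rmorph1 mulN1r.
Qed.

(** The real part of [omega] is [- 1 / 2], which makes this number negative and
    accounts for the sign in [tcoef]. *)
Lemma cexp_om_sqr : cexp ('i%C * pi%:C * om) ^+ 2 = (- theta_q)%:C.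
Proof.
rewrite -cexpMn.
have -> : ('i%C * pi%:C * om) *+ 2 = (- (pi * s3)) +i* (- pi).
  by rewrite omegaE -mulr_natr; apply: complex_ext => /=; field.
by rewrite /cexp /theta_q /expi cosN sinN cospi sinpi; apply: complex_ext; rewrite /=; ring.
Qed.

Lemma theta_hol_shift p p' : p'.1 = p.1 + om ->
  theta_hol p' = - ((cexp ('i%C * pi%:C * om))^-1 * theta_w p ^- 2) * theta_hol p.
Proof.
move=> pp'; set q := cexp ('i%C * pi%:C * om).
have wq : theta_w p' = q * theta_w p by rewrite /theta_w pp' mulrDr cexpD mulrC.
have ide n := @theta_shift_identity C (fun j => (tc j)%:C) q (theta_w p) n
  (cexp_neq0 _) (cexp_neq0 _) _.
have {}ide n : \sum_(0 <= j < n.+1) (tc j)%:C * theta_w p' ^+ (2 * j + 1) -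
  \sum_(0 <= j < n.+1) (tc j)%:C / theta_w p' ^+ (2 * j + 1) =
  - (q^-1 * theta_w p ^- 2) * (\sum_(0 <= j < n.+2) (tc j)%:C * theta_w p ^+ (2 * j + 1) -
     \sum_(0 <= j < n) (tc j)%:C / theta_w p ^+ (2 * j + 1)).
  rewrite wq; apply: ide => j; rewrite tcoefS rmorphM rmorphN rmorphXn /=.
  rewrite -cexp_om_sqr -/q -exprM mulnS addnC; congr (_ * _ ^+ _).
pose A p n := \sum_(0 <= j < n) (tc j)%:C * theta_w p ^+ (2 * j + 1).
pose B p n := \sum_(0 <= j < n) (tc j)%:C / theta_w p ^+ (2 * j + 1).
have h1 : A p' (n + 1)%N + (-1) * B p' (n + 1)%N @[n --> \oo] --> theta_hol p'.
  apply: cvg_cD; first exact: (@cvg_addn_shift _ _ 1%N (@zexp_pos_cvg p')).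
  by apply: cvg_cM; [exact: cvg_cst | exact: (@cvg_addn_shift _ _ 1%N (@zexp_neg_cvg p'))].
have h2 : - (q^-1 * theta_w p ^- 2) * (A p (n + 2)%N + (-1) * B p n) @[n --> \oo] -->
    - (q^-1 * theta_w p ^- 2) * theta_hol p.
  apply: cvg_cM; first exact: cvg_cst.
  apply: cvg_cD; first exact: (@cvg_addn_shift _ _ 2%N (@zexp_pos_cvg p)).
  by apply: cvg_cM; [exact: cvg_cst | exact: (@zexp_neg_cvg p)].
apply: (ccvg_unique h1); apply: cvg_seq_ext h2 => n.
rewrite addn1 addn2 (mulN1r (B p n)) (mulN1r (B p' n.+1)); exact: esym (ide n).
Qed.

Lemma zexp_antiperiodic e x y t t' : e = 1 \/ e = -1 ->
  zexp tc e (mkpt (x + 1) y t) = - zexp tc e (mkpt x y t').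
Proof.
move=> e1; have ne : `|- e| <= 1 by case: e1 => ->; rewrite ?normrN ?opprK normr1.
have [M _ bM] := tterm_bound `|y| (@rapid_tcoef R).
have h a : tfun tc a (- e) (x + 1) y = - tfun tc a (- e) x y.
  rewrite /tfun -(tsumN (bM a (- e) x y ne (lexx _))); congr tsum; apply/funext => j.
  rewrite /tterm; have -> : odd_freq j * pi * (x + 1) + a = odd_freq j * pi * x + a + pi *+ j.*2.+1.
    by rewrite -mulr_natr -/(odd_freq j); ring.
  rewrite (alternatingn (@cosDpi R)) exprS -mul2n exprM sqrrN !expr1n; ring.
by rewrite /zexp /= !h; apply: complex_ext => /=; ring.
Qed.

Lemma zexp_opp e x y t t' : e = 1 \/ e = -1 ->
  zexp tc e (mkpt (- x) (- y) t) = zexp tc (- e) (mkpt x y t').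
Proof.
move=> e1; have ne : `|e| <= 1 by case: e1 => ->; rewrite ?normrN normr1.
have [M _ bM] := tterm_bound `|y| (@rapid_tcoef R).
rewrite /zexp /= opprK.
have -> : tfun tc 0 (- e) (- x) (- y) = tfun tc 0 e x y.
  congr tsum; apply/funext => j; rewrite /tterm !addr0 mulrN cosN.
  by congr (_ * (_ * expR _)); ring.
have -> : tfun tc (- (pi / 2)) (- e) (- x) (- y) = - tfun tc (- (pi / 2)) e x y.
  rewrite /tfun -(tsumN (bM (- (pi / 2)) e x y ne (lexx _))); congr tsum; apply/funext => j.
  rewrite /tterm !cosBpihalf mulrN sinN.
  by have -> : - e * (odd_freq j * pi * - y) = e * (odd_freq j * pi * y); ring.
by congr (_ +i* _); ring.
Qed.

Lemma theta_gA p : theta (act gA p) = -1 * theta p.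
Proof.
rewrite -[p]mkptE act_gA; set x := get_coord axis_x p; set y := get_coord axis_y p.
set t := get_coord axis_t p; rewrite /theta mulrCA; congr (_ * _); last first.
  rewrite /theta_hol !(zexp_antiperiodic _ _ _ t); [ring|by right|by left].
congr cexp; apply: complex_ext; rewrite /theta_phase /= ?creimE /=; ring.
Qed.

Lemma theta_odd x y t : theta (mkpt (- x) (- y) t) = - theta (mkpt x y t).
Proof.
rewrite /theta -mulrN; congr (_ * _).
  by congr cexp; apply: complex_ext; rewrite /theta_phase /= ?creimE /=; ring.
rewrite /theta_hol (zexp_opp _ _ _ t); last by left.
by rewrite (zexp_opp _ _ _ t) ?opprK; [ring|right].
Qed.

(** The exponential factor of [theta_hol_shift] cancels against the change of the
    Gaussian phase, and a sign remains. *)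
Lemma theta_gB p : theta (act gB p) = -1 * theta p.
Proof.
rewrite -[p]mkptE act_gB; set x := get_coord axis_x p; set y := get_coord axis_y p.
set t := get_coord axis_t p; rewrite /theta.
rewrite (@theta_hol_shift (mkpt x y t)); last first.
  by rewrite omegaE /mkpt /=; apply: complex_ext => /=; ring.
rewrite mulrA [RHS]mulrA; congr (_ * _).
rewrite mulrN mulN1r; congr (- _).
rewrite /theta_w -cexpMn -!cexpN -!cexpD; congr cexp.
rewrite -mulr_natr omegaE /theta_phase.
have w3 := weight_s3 1; rewrite mulr1 in w3.
have pE : pi = weight 1 * s3 by rewrite w3.
rewrite pE; move: (weight 1) => W.
by apply: complex_ext; rewrite /= ?creimE /=; field.
Qed.

End Theta.

(** * Sections of powers of the theta line bundle *)

Section Holomorphic.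
Context {R : realType}.
Local Notation C := R[i].
Local Notation s3 := (@s3 R).
Local Notation om := (@omega R).
Local Notation tc := (@tcoef R).
Implicit Types (f g : heis R -> C) (p : heis R) (x y t : R).

(** The sections of the [D]-th power of the line bundle that carries [theta]. *)
Definition theta_space (D : nat) : set (heis R -> C) := [set f |
  [/\ smooth f, forall p, partial axis_t f p = 'i%C * (weight D)%:C * f p,
      forall p, Zbarop f p = 0, forall p, f (act gA p) = (-1) ^+ D * f p
    & forall p, f (act gB p) = (-1) ^+ D * f p]].

Lemma expi_pi (D : nat) : expi (pi * D%:R) = (-1) ^+ D :> C.
Proof.
elim: D => [|D IH]; first by rewrite mulr0 expi0.
rewrite -natr1 mulrDr mulr1 expiD IH exprS mulrC; congr (_ * _).
by rewrite /expi cospi sinpi; apply: complex_ext; rewrite /= ?oppr0.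
Qed.

Lemma theta_space_unique (D : nat) f : (0 < D)%N -> theta_space D f ->
  (forall r : 'I_D, theta_coef f (r%:R + D%:R / 2) 0 = 0) -> forall p, f p = 0.
Proof.
move=> D0 [sf ft fZ fA fB] h.
apply: (character_zero sf ft).
apply: (@theta_unique R D 1 (D%:R / 2) ((-1) ^+ D) f) => //.
- by rewrite normrX normrN1 expr1n.
- by rewrite mulr1.
- by move=> p; apply: CR_Zbar (ft p) (fZ p).
- move=> x y; have -> : 2 * pi * (D%:R / 2) = pi * D%:R :> R by field.
  by rewrite expi_pi; exact: slice_gA.
- by move=> x y; exact: slice_gB.
Qed.

Lemma theta_coef_comb (a b : C) f g m y : smooth f -> smooth g ->
  theta_coef (fun p => a * f p + b * g p) m y = a * theta_coef f m y + b * theta_coef g m y.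
Proof.
move=> sf sg.
have cw h : smooth h -> continuous (fun x => expi (- (2 * pi * m) * x) * slice h x y : C).
  by move=> sh x; apply: cvg_cM; [exact: continuous_expi | exact: slice_cont].
have := @mean_lin3 R a b 0 _ _ _ (cw _ sf) (cw _ sg) (cw _ sf).
rewrite mul0r addr0 => <-; congr mean; apply/funext => x; rewrite /slice; ring.
Qed.

Definition gR : heisC R := (1%g, omegaS).

Lemma act_gR x y t : act gR (mkpt x y t) = mkpt (- (x + s3 * y) / 2) ((s3 * x - y) / 2) t.
Proof.
have mE : mu gR.2 (mkpt x y t) = (om * (x +i* y), sqnorm om * t) by [].
rewrite /act mE mul1g omegaE /sqnorm /mkpt /=; have s3s := @s3_sqr R.
have s3q : s3 ^+ 2 = 3 by rewrite expr2.
congr pair; first by congr (_ +i* _); field.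
by field: s3q.
Qed.

Lemma sqnorm_omega : sqnorm om = 1.
Proof. by rewrite /sqnorm /omega /expi /= cos2Dsin2. Qed.

(** The rotation normalizes the lattice: it maps [A] to [B], and [B] to the inverse
    of [A * B] up to a vertical translation, on which the character is computed. *)
Lemma theta_space_rot (D : nat) f : theta_space D f -> theta_space D (fun p => f (act gR p)).
Proof.
move=> [sf ft fZ fA fB]; have s3s := @s3_sqr R; split.
- exact: smooth_act.
- by move=> p; rewrite (partial_t_act gR p sf) -[val gR.2]/om sqnorm_omega ft mul1r.
- by move=> p; rewrite (Zbarop_act gR p sf) fZ mulr0.
- move=> p; rewrite -[p]mkptE act_gA !act_gR -fB act_gB.
  by congr (f (mkpt _ _ _)); field: s3s.
- move=> p; rewrite -[p]mkptE act_gB !act_gR.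
  set x := get_coord axis_x p; set y := get_coord axis_y p; set t := get_coord axis_t p.
  set q := mkpt (- (x - 2^-1 + s3 * (y + s3 / 2)) / 2) _ _.
  have fq : f q = f (act gA (act gB q)).
    by rewrite fA fB mulrA -expr2 sqrr_sign mul1r.
  rewrite fq act_gB act_gA.
  rewrite -[(-1) ^+ D]mulr1 -{2}(expi0) -(subrr (pi * D%:R)) expiD -expi_pi.
  have -> : expi (pi * D%:R) * (expi (pi * D%:R) * expi (- (pi * D%:R))) =
     (expi (weight D * - s3)) * (expi (pi * D%:R) * expi (pi * D%:R)) :> C.
    by rewrite mulrN weight_s3; ring.
  rewrite expi_pi -expr2 sqrr_sign mulr1 -(t_shift _ _ _ _ sf ft).
  by congr (f (mkpt _ _ _)); field: s3s.
Qed.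

Lemma theta_space_theta : theta_space 1 (@theta R).
Proof.
split; rewrite ?expr1.
- exact: smooth_theta.
- exact: theta_t.
- exact: Zbar_theta.
- exact: theta_gA.
- exact: theta_gB.
Qed.

Lemma tsum_split (u : nat -> R) M : geo_bound u M -> tsum u = u 0%N + tsum (fun j => u j.+1).
Proof.
move=> uM; have uM' : geo_bound (fun j => u j.+1) M.
  move=> j; apply: le_trans (uM j.+1) _; rewrite exprS.
  have M0 : 0 <= M by have := le_trans (normr_ge0 _) (uM 0%N); rewrite expr0 mulr1.
  by apply: ler_wpM2l => //; rewrite ler_piMl ?exprn_ge0 // invf_le1 // ler1n.
have c1 : series u @ \oo --> tsum u by exact: tsum_cvg uM.
have c2 : series (fun j => u j.+1) @ \oo --> tsum (fun j => u j.+1) by exact: tsum_cvg uM'.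
have c3 : series u (n + 1)%N @[n --> \oo] --> tsum u.
  by apply: cvg_comp c1; exact: cvg_addnr.
have c4 : u 0%N + series (fun j => u j.+1) n @[n --> \oo] --> u 0%N + tsum (fun j => u j.+1).
  by apply: cvgD; [exact: cvg_cst | exact: c2].
have e : (fun n => series u (n + 1)%N) = (fun n => u 0%N + series (fun j => u j.+1) n).
  by apply/funext => n; rewrite addn1 /series /= big_nat_recl.
rewrite e in c3; exact: (cvg_unique (@Rhausdorff R) c3 c4).
Qed.

(** The terms after the first add up to at most half of it. *)
Lemma tsum_gt0 (u : nat -> R) : 0 < u 0%N ->
  (forall j, `|u j.+1| <= u 0%N * 3^-1 ^+ j.+1) -> 0 < tsum u.
Proof.
move=> u0 h.
have hg : geo_bound (fun j => u j.+1) (u 0%N / 3).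
  move=> j; apply: le_trans (h j) _; rewrite exprS mulrA; apply: ler_wpM2l.
    by rewrite divr_ge0 // ltW.
  by apply: lerXn2r; rewrite ?nnegrE ?invr_ge0 // lef_pV2 ?posrE // ler_nat.
have hu : geo_bound u (u 0%N).
  case=> [|j]; first by rewrite expr0 mulr1 ger0_norm // ltW.
  apply: le_trans (h j) _; rewrite ler_pM2l //.
  by apply: lerXn2r; rewrite ?nnegrE ?invr_ge0 // lef_pV2 ?posrE // ler_nat.
rewrite (tsum_split hu); have := tsum_norm hg; rewrite ler_norml => /andP[h1 _].
move: u0 h1; move: (tsum _) (u 0%N) => T a a0 h1; lra.
Qed.

Lemma s3_ge : 3 / 2 <= s3.
Proof.
have s30 := @s3_gt0 R; have s3s := @s3_sqr R.
rewrite leNgt; apply/negP => h.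
have : s3 * s3 < 3 / 2 * (3 / 2) by apply: ltr_pM; rewrite ?ltW.
by rewrite s3s; lra.
Qed.

Lemma expR_sqr (x : R) : expR (2 * x) = expR x * expR x.
Proof. by rewrite -expRD; congr expR; ring. Qed.

Lemma expR32 : 3 <= expR (3 / 2 : R).
Proof.
have -> : 3 / 2 = 2 * (3 / 4) :> R by field.
rewrite expR_sqr; have h := expR_ge1Dx (3 / 4 : R).
apply: (@le_trans _ _ ((1 + 3 / 4) * (1 + 3 / 4))); first lra.
by apply: ler_pM => //; lra.
Qed.

Lemma theta_q_le : @theta_q R <= 9^-1.
Proof.
rewrite /theta_q expRN lef_pV2 ?posrE ?expR_gt0 //.
apply: (@le_trans _ _ (expR (2 * (3 / 2)))).
  rewrite expR_sqr; have h := expR32; apply: (@le_trans _ _ (3 * 3)); first lra.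
  by apply: ler_pM => //; lra.
by rewrite ler_expR; apply: ler_pM; [lra | lra | exact: pi_ge2 | exact: s3_ge].
Qed.

Lemma theta_q_exp_le : @theta_q R * expR (2 * (pi * s3 / 6)) <= 3^-1.
Proof.
rewrite /theta_q -expRD.
have -> : - (pi * s3) + 2 * (pi * s3 / 6) = - (2 * (pi * s3 / 3)) by field.
rewrite expRN lef_pV2 ?posrE ?expR_gt0 //.
apply: le_trans expR32 _; rewrite ler_expR.
have : 2 * (3 / 2) <= pi * s3 by apply: ler_pM; [lra| lra | exact: pi_ge2 | exact: s3_ge].
by move: (pi * s3) => u; lra.
Qed.

Lemma theta_q_pow j : @theta_q R ^+ 'C(j.+2, 2) <= theta_q ^+ j.+1.
Proof.
have q0 := @theta_q_gt0 R; have q1 := theta_q_le.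
have qq : theta_q <= 1 :> R by lra.
rewrite ler_wiXn2l ?(ltW q0) // binS bin1.
by elim: j => // j IH; rewrite leq_addl.
Qed.

Lemma odd_freq_sum_gt0 : 0 < tsum (fun j => freq_scale tc j).
Proof.
have u0 : freq_scale tc 0 = pi.
  by rewrite /freq_scale /tcoef /odd_freq /= bin_small // !expr0 !mulr1.
apply: tsum_gt0; rewrite u0; first exact: pi_gt0.
move=> j; rewrite /freq_scale normrM norm_tcoef normrM (ger0_norm (pi_ge0 R)) -mulrA.
rewrite ler_pM2l ?pi_gt0 // ger0_norm; last exact: le_trans ler01 (odd_freq_ge1 _).
apply: (@le_trans _ _ (3 ^+ j.+1 * 9^-1 ^+ j.+1)).
  apply: ler_pM.
  - exact: le_trans ler01 (odd_freq_ge1 _).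
  - by rewrite exprn_ge0 // ltW // theta_q_gt0.
  - rewrite /odd_freq -natrX ler_nat; elim: j => // j IH.
    rewrite expnS doubleS; apply: (@leq_trans (3 * j.+1.*2.+1)); last by rewrite leq_mul2l IH orbT.
    by rewrite -mul2n; lia.
  - apply: le_trans (theta_q_pow j) _; apply: lerXn2r; rewrite ?nnegrE ?invr_ge0 ?(ltW theta_q_gt0) //.
    exact: theta_q_le.
rewrite -exprMn; have -> // : 3 * 9^-1 = 3^-1 :> R by field.
Qed.

Lemma trig_odd j : cos (odd_freq j * pi * 2^-1) = 0 :> R /\ sin (odd_freq j * pi * 2^-1) = (-1) ^+ j :> R.
Proof.
have -> : odd_freq j * pi * 2^-1 = pi / 2 + pi *+ j :> R.
  by rewrite odd_freqE -mulr_natr; field.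
rewrite (alternatingn (@cosDpi R)) (alternatingn (@sinDpi R)) cos_pihalf sin_pihalf.
by rewrite mulr0 mulr1.
Qed.

(** At this point all sines are plus or minus one and the imaginary part of
    [theta_hol] is a series that its first term dominates. *)
Lemma theta_hexp_neq0 t : theta (mkpt 2^-1 (s3 / 6) t) != 0.
Proof.
rewrite mulf_neq0 ?cexp_neq0 //; set Y := s3 / 6.
have im : Im (theta_hol (mkpt 2^-1 Y t)) =
    tfun tc (- (pi / 2)) (-1) 2^-1 Y + tfun tc (- (pi / 2)) 1 2^-1 Y.
  by rewrite /theta_hol /zexp /= opprK; ring.
apply/eqP => z0; move: im; rewrite z0 => /esym/eqP; apply/negP.
have [M _ bM] := tterm_bound `|Y| (@rapid_tcoef R).
have b1 := bM (- (pi / 2)) (-1) 2^-1 Y; rewrite normrN1 in b1; have {}b1 := b1 (lexx _) (lexx _).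
have b2 := bM (- (pi / 2)) 1 2^-1 Y; rewrite normr1 in b2; have {}b2 := b2 (lexx _) (lexx _).
have := tsum_comb 1 1 b1 b2; rewrite !mul1r -/(tfun _ _ _ _ _) -/(tfun _ _ _ _ _) => E.
rewrite -E gt_eqF //.
pose th : R := pi * s3 / 6.
have uE j : 1 * tterm tc (- (pi / 2)) (-1) j 2^-1 Y + 1 * tterm tc (- (pi / 2)) 1 j 2^-1 Y =
   (- theta_q) ^+ 'C(j.+1, 2) * (expR (- (odd_freq j * th)) + expR (odd_freq j * th)).
  have [_ hs] := trig_odd j; rewrite /tterm cosBpihalf hs /tcoef.
  have -> : -1 * (odd_freq j * pi * Y) = - (odd_freq j * th) by rewrite /Y /th; field.
  have -> : 1 * (odd_freq j * pi * Y) = odd_freq j * th by rewrite /Y /th; field.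
  have s2 : (-1) ^+ j * (-1) ^+ j = 1 :> R by rewrite -expr2 sqrr_sign.
  set a := (-1) ^+ j in s2 *; set b := (- theta_q) ^+ _; set c := expR _; set d := expR _.
  transitivity ((a * a) * b * (c + d)); first by ring.
  by rewrite s2 mul1r.
have f0 : odd_freq 0 = 1 :> R by [].
apply: tsum_gt0 => [|j]; rewrite ?uE.
  by rewrite bin_small // expr0 mul1r addr_gt0 ?expR_gt0.
rewrite [in leRHS]bin_small // expr0 mul1r f0 !mul1r.
rewrite normrM normrX normrN (ger0_norm (ltW theta_q_gt0)).
rewrite (ger0_norm (addr_ge0 (expR_ge0 _) (expR_ge0 _))).
have th0 : 0 <= th by rewrite /th !mulr_ge0 ?pi_ge0 ?invr_ge0 // ltW // s3_gt0.
apply: (@le_trans _ _ (theta_q ^+ j.+1 * (expR (j.+1%:R * (2 * th)) * (expR (- th) + expR th)))).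
  apply: ler_pM.
  - by rewrite exprn_ge0 // ltW // theta_q_gt0.
  - by rewrite addr_ge0 ?expR_ge0.
  - exact: theta_q_pow.
  - rewrite mulrDr -!expRD odd_freqE; apply: lerD; rewrite ler_expR.
      have : 0 <= j.+1%:R * th by rewrite mulr_ge0.
      by lra.
    by lra.
rewrite mulrA expRM_natl -exprMn mulrC; apply: ler_wpM2l; first by rewrite addr_ge0 ?expR_ge0.
apply: lerXn2r; rewrite ?nnegrE ?invr_ge0 ?mulr_ge0 ?expR_ge0 ?(ltW theta_q_gt0) //.
exact: theta_q_exp_le.
Qed.

Lemma theta_hexp_opp_neq0 t : theta (mkpt (- 2^-1) (- (s3 / 6)) t) != 0.
Proof. by rewrite theta_odd oppr_eq0 theta_hexp_neq0. Qed.

(** The derivative of the series at the origin is the sum of [(2 j + 1) tcoef j],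
    again dominated by its first term. *)
Lemma partial_theta0 : partial axis_x (@theta R) (mkpt 0 0 0) != 0.
Proof.
have l1 : (1 : R) = 1 \/ (1 : R) = -1 by left.
have l2 : (-1 : R) = 1 \/ (-1 : R) = -1 by right.
have rt := @rapid_tcoef R.
have hx := pder_add (pder_zexp_x rt l1) (pder_scale (-1) (pder_zexp_x rt l2)).
have h := pder_mul (pder_cexp (pder_theta_phase axis_x)) hx.
rewrite (partialE h) {h hx}.
have -> : forall A B E H : C, A = 0 -> A * E * H + E * B = E * B by move=> A B E H ->; rewrite !mul0r add0r.
  rewrite mulf_neq0 ?cexp_neq0 //.
  have S e : tfun (freq_scale tc) 0 e 0 0 = tsum (fun j => freq_scale tc j).
    by congr tsum; apply/funext => j; rewrite /tterm !mulr0 addr0 cos0 expR0 !mulr1.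
  set F : C := (X in X != 0); have im : Im F = 2 * tsum (fun j => freq_scale tc j).
    by rewrite /F /zexp /= !S; ring.
  apply/eqP => F0; move: im; rewrite F0 /=.
  have := odd_freq_sum_gt0; move: (tsum _) => T; lra.
by rewrite /= !(mul0r, mulr0, addr0).
Qed.

End Holomorphic.

(** * Eigenspaces of a map with a basis of eigenvectors *)

Section EigenDimension.
Context {K : fieldType} {V : lmodType K} (D : nat).
Variables (E : set V) (phi : V -> 'I_D -> K) (T : V -> V).
Variables (e : 'I_D -> V) (ev : 'I_D -> K) (eps : K).
Hypothesis E0 : E 0.
Hypothesis Elin : forall a u v, E u -> E v -> E (a *: u + v).
Hypothesis phi_lin : forall a u v i, E u -> E v ->
  phi (a *: u + v) i = a * phi u i + phi v i.
Hypothesis phi_inj : forall v, E v -> (forall i, phi v i = 0) -> v = 0.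
Hypothesis T_lin : forall a u v, E u -> E v -> T (a *: u + v) = a *: T u + T v.
Hypothesis Ee : forall i, E (e i).
Hypothesis e_free : forall a : 'I_D -> K, \sum_i a i *: e i = 0 -> forall i, a i = 0.
Hypothesis Te : forall i, T (e i) = ev i *: e i.

Lemma eigen_comb (a : 'I_D -> K) : [/\ E (\sum_i a i *: e i),
  (forall j, phi (\sum_i a i *: e i) j = \sum_i a i * phi (e i) j)
  & T (\sum_i a i *: e i) = \sum_i (a i * ev i) *: e i].
Proof.
elim: (index_enum _) => [|i s [IE IP IT]].
  rewrite !big_nil; split => //.
  - by move=> j; have := phi_lin (-1) j E0 E0; rewrite scaler0 addr0 mulN1r addNr big_nil.
  - by have := T_lin (-1) E0 E0; rewrite scaler0 addr0 scaleN1r addNr.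
rewrite !big_cons; split.
- exact: Elin.
- by move=> j; rewrite phi_lin // IP big_cons.
- by rewrite T_lin // IT Te scalerA.
Qed.

(** The coordinates [phi] embed [E] into a space of dimension [D], so [D]
    independent vectors span it. *)
Lemma spanned v : E v -> exists a : 'I_D -> K, v = \sum_i a i *: e i.
Proof.
move=> Ev; pose M : 'M[K]_D := \matrix_(i, j) phi (e i) j.
have Mu : M \in unitmx.
  rewrite -row_free_unit.
  apply: inj_row_free => w wM; apply/rowP => i; rewrite [RHS]mxE.
  apply: (e_free (a := fun i => w 0 i)); have [cE cP _] := eigen_comb (fun i => w 0 i).
  apply: phi_inj => // j; rewrite cP; have /rowP/(_ j) := wM; rewrite !mxE => wMj.
  by rewrite -[RHS]wMj; apply: eq_bigr => k _; rewrite mxE.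
have [w wM] : exists w, w *m M = \row_j phi v j.
  by exists ((\row_j phi v j) *m invmx M); rewrite mulmxKV.
exists (fun i => w 0 i); have [cE cP _] := eigen_comb (fun i => w 0 i).
apply/eqP; rewrite -subr_eq0 addrC -scaleN1r; apply/eqP; apply: phi_inj; first exact: Elin.
move=> j; rewrite phi_lin // cP mulN1r; apply/eqP; rewrite addrC subr_eq0; apply/eqP.
move/rowP/(_ j): wM.
rewrite mxE [in RHS]mxE => <-.
by apply: eq_bigr => k _; rewrite mxE.
Qed.

(** A subspace spanned by eigenvectors of [T] meets each eigenspace of [T] in
    the span of those among them that have the right eigenvalue. *)
Lemma eigen_has_dim : has_dim [set v | E v /\ T v = eps *: v] #|[pred i | ev i == eps]|.
Proof.
pose A := [pred i | ev i == eps].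
have bigA (a : 'I_#|A| -> K) (b : 'I_D -> K) : (forall j, b (enum_val j) = a j) ->
    (forall i, i \notin A -> b i = 0) -> \sum_i b i *: e i = \sum_j a j *: e (enum_val j).
  move=> ba b0; rewrite (bigID (mem A)) /= [X in _ + X]big1 ?addr0; last first.
    by move=> i /b0 ->; rewrite scale0r.
  by rewrite big_enum_val; apply: eq_bigr => j _; rewrite ba.
have ext (a : 'I_#|A| -> K) : exists b : 'I_D -> K, (forall j, b (enum_val j) = a j) /\
    (forall i, i \notin A -> b i = 0).
  exists (fun i => if [pick j : 'I_#|A| | enum_val j == i] is Some j then a j else 0); split.
    move=> j; case: pickP => [j' /eqP/enum_val_inj -> //|/(_ j)].
    by rewrite eqxx.
  move=> i iA; case: pickP => // j /eqP ji; have := enum_valP j.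
  by rewrite ji (negbTE iA).
exists (fun j => e (enum_val j)); split; last first.
  move=> a a0 j; have [b [ba b0]] := ext a.
  by rewrite -ba; apply: e_free; rewrite (bigA a).
apply/seteqP; split => v /=.
  move=> [Ev Tv]; have [a aE] := spanned Ev.
  exists (fun j => a (enum_val j)); rewrite {1}aE; apply: bigA => // i iA.
  have [_ _ cT] := eigen_comb a.
  have /e_free/(_ i) : \sum_i (a i * (ev i - eps)) *: e i = 0.
    transitivity (\sum_i (a i * ev i) *: e i - eps *: \sum_i a i *: e i).
      rewrite scaler_sumr -sumrB; apply: eq_bigr => k _.
      by rewrite scalerA -scalerBl; congr (_ *: _); ring.
    by rewrite -cT -aE Tv subrr.
  by move/eqP; rewrite mulf_eq0 subr_eq0 [ev i == eps](negbTE iA) orbF => /eqP.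
move=> [a ->]; have [b [ba b0]] := ext a; rewrite -(bigA a b) //.
have [cE _ cT] := eigen_comb b; split; rewrite // cT scaler_sumr; apply: eq_bigr => i _.
have [/eqP ->|iA] := boolP (i \in A); first by rewrite scalerA mulrC.
by rewrite (b0 i iA) mul0r !scale0r scaler0.
Qed.

End EigenDimension.

(** * Rotation of theta and of its translates *)

Section Rotation.
Context {R : realType}.
Local Notation C := R[i].
Local Notation s3 := (@s3 R).
Local Notation om := (@omega R).
Implicit Types (f g : heis R -> C) (p : heis R) (x y t : R).

Lemma theta_space_lin (D : nat) (a : C) f g : theta_space D f -> theta_space D g -> theta_space D (a *: f + g).
Proof.
move=> [sf ft fZ fA fB] [sg gt gZ gA gB].
have -> : a *: f + g = (fun p => a * f p + g p) by [].
have pf v := pder_add (pder_scale a (smooth_pder v sf)) (smooth_pder v sg).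
split.
- exact: smooth_add (smooth_scale a sf) sg.
- by move=> p; rewrite (partialE (pf axis_t)) ft gt; ring.
- move=> p; rewrite ZbaropE !(partialE (pf _)).
  transitivity (a * Zbarop f p + Zbarop g p); last by rewrite fZ gZ mulr0 addr0.
  by rewrite !ZbaropE; ring.
- by move=> p; rewrite fA gA; ring.
- by move=> p; rewrite fB gB; ring.
Qed.

Lemma theta_coef_lin (D : nat) (a : C) f g m : theta_space D f -> theta_space D g ->
  theta_coef (a *: f + g) m 0 = a * theta_coef f m 0 + theta_coef g m 0.
Proof.
move=> [sf _ _ _ _] [sg _ _ _ _].
rewrite -[theta_coef g m 0]mul1r -(theta_coef_comb a 1 m 0 sf sg).
by congr theta_coef; apply/funext => p; rewrite mul1r.
Qed.

(** Sections of degree one have a single free Fourier coefficient. *)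
Lemma theta_space1_line f : theta_space 1 f -> exists l : C, forall p, f p = l * theta p.
Proof.
move=> hf; have ht := @theta_space_theta R; pose m : R := 0%:R + 1%:R / 2.
have t0 : theta_coef (@theta R) m 0 != 0.
  apply/eqP => t0; have := theta_hexp_neq0 (0 : R).
  rewrite (theta_space_unique _ ht) ?eqxx // => r; by rewrite (ord1 r).
exists (theta_coef f m 0 / theta_coef (@theta R) m 0) => p.
set l := _ / _.
have h : theta_space 1 ((- l) *: @theta R + f) by exact: theta_space_lin.
have : ((- l) *: @theta R + f) p = 0.
  apply: (theta_space_unique _ h) => // r; rewrite (ord1 r) (theta_coef_lin _ _ ht hf).
  by rewrite mulNr divfK // addNr.
rewrite -[LHS]/(- l * theta p + f p) addrC mulNr => /eqP.
by rewrite subr_eq0 => /eqP.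
Qed.

(** Both sides are sections of degree one, so they agree up to a constant, which
    the first order part at the zero of [theta] determines. *)
Lemma theta_rot p : theta (act gR p) = om * theta p.
Proof.
have [l lE] := theta_space1_line (theta_space_rot (@theta_space_theta R)).
rewrite lE; congr (_ * _); apply: (mulIf partial_theta0).
have st := @smooth_theta R; pose o : heis R := mkpt 0 0 0.
have := partialE (pder_scale l (smooth_pder axis_x st)).
have <- : (fun q => theta (act gR q)) = (fun q => l * theta q) by apply/funext.
move=> /(congr1 (fun F => F o)) <-.
rewrite (partialE (pder_affine _ (act_affine gR) st)).
have -> : act gR o = o by rewrite /o act_gR; congr mkpt; ring.
have -> : act_slope (gR : heisC R) axis_x axis_x = Re om by [].
have -> : act_slope (gR : heisC R) axis_x axis_y = Im om by [].
have -> : act_slope (gR : heisC R) axis_x axis_t = 0.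
  by rewrite /act_slope /= !mul0r subrr mulr0.
rewrite mul0r addr0 Re_omega Im_omega omegaE.
have := @Zbar_theta R o; rewrite ZbaropE.
have -> : o.1 = 0 by [].
rewrite mul0r mulr0 addr0 => /eqP.
rewrite mulf_eq0 invr_eq0 (pnatr_eq0 _ 2) /= addr_eq0 => /eqP fx.
rewrite fx.
set fy := partial axis_y theta o.
by case: fy => a b; apply: complex_ext; rewrite /= ?creimE /=; ring.
Qed.

(** For [e = 1] and [e = -1] this is the translation by the fixed points, other
    than the origin, of the rotation on [C / L_omega]. *)
Definition half_shift (e : R) : heisC R := ((e / 2 +i* (e * s3 / 6), 0), 1%g).

Lemma act_half_shift e x y t : act (half_shift e) (mkpt x y t) =
  mkpt (x + e / 2) (y + e * s3 / 6) (t + e * (s3 / 3 * x - y)).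
Proof.
rewrite /act /half_shift /= mu1; rewrite -[(_ * _)%g]/(heis_mul _ _) /heis_mul /mkpt /=.
by congr pair; [congr (_ +i* _)|]; field.
Qed.

Definition theta_at (e : R) p : C := theta (act (half_shift e) p).

(** The character [k] on the two translations is kept variable: it takes other
    values than signs on the translates of [theta], and only suitable products of
    these are sections. *)
Definition theta_space_char (D : nat) (k : C) : set (heis R -> C) := [set f |
  [/\ smooth f, forall p, partial axis_t f p = 'i%C * (weight D)%:C * f p,
      forall p, Zbarop f p = 0, forall p, f (act gA p) = k * f p
    & forall p, f (act gB p) = k * f p]].

Lemma weightD D D' : weight (D + D') = weight D + weight D' :> R.
Proof. by rewrite /weight natrD mulrDr mulrDl. Qed.

Lemma theta_space_char_mul D D' k k' f g : theta_space_char D k f -> theta_space_char D' k' g ->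
  theta_space_char (D + D') (k * k') (fun p => f p * g p).
Proof.
move=> [sf ft fZ fA fB] [sg gt gZ gA gB]; split.
- exact: smooth_mul.
- move=> p; rewrite (partialE (pder_mul (smooth_pder axis_t sf) (smooth_pder axis_t sg))).
  by rewrite ft gt weightD rmorphD /=; ring.
- by move=> p; rewrite (Zbarop_mul sf sg) fZ gZ; ring.
- by move=> p; rewrite fA gA; ring.
- by move=> p; rewrite fB gB; ring.
Qed.

Lemma theta_space_char_one : theta_space_char 0 1 (fun=> 1).
Proof.
have pc v := partialE (@pder_cst R v 1).
split => [|p|p|p|p]; rewrite ?mulr1 //.
- exact: smooth_cst.
- by rewrite pc /weight mulr0 mul0r mulr0.
- by rewrite ZbaropE !pc; ring.
Qed.

Lemma theta_space_char_exp D k f n : theta_space_char D k f -> theta_space_char (n * D) (k ^+ n) (fun p => f p ^+ n).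
Proof.
move=> hf; elim: n => [|n IH].
  have -> : (fun p => f p ^+ 0) = (fun=> 1) by apply/funext.
  exact: theta_space_char_one.
have -> : (fun p => f p ^+ n.+1) = (fun p => f p * f p ^+ n).
  by apply/funext => p; rewrite exprS.
by rewrite mulSn exprS; exact: theta_space_char_mul.
Qed.

Definition cube_root (e : R) : C := expi (2 * pi / 3 * e).

Lemma cube_root_exp n : cube_root n%:R = om ^+ n.
Proof.
elim: n => [|n IH]; first by rewrite /cube_root mulr0 expi0.
by rewrite -[n.+1%:R]natr1 /cube_root mulrDr expiD mulr1 -/(cube_root _) IH exprSr.
Qed.

Lemma eq_mkpt (F : heis R -> C) (x x' y y' t t' : R) :
  x = x' -> y = y' -> t = t' -> F (mkpt x y t) = F (mkpt x' y' t').
Proof. by move=> -> -> ->. Qed.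

Lemma weight1E : weight 1 = pi / 3 * s3 :> R.
Proof.
have s30 := lt0r_neq0 (@s3_gt0 R); have s3q : s3 ^+ 2 = 3 by rewrite expr2 s3_sqr.
by apply: (mulIf s30); rewrite weight_s3; field: s3q.
Qed.

(** Commuting [half_shift] past the lattice costs a vertical translation, on
    which the character takes a cube root of unity as value. *)
Lemma theta_at_char (e : int) : theta_space_char 1 (- cube_root e%:~R) (theta_at e%:~R).
Proof.
have st := @smooth_theta R; have tt := @theta_t R; have s3s := @s3_sqr R.
have W := weight1E; have s3q : s3 ^+ 2 = 3 by rewrite expr2.
have e2 := @expi_2pi R e; move: (e%:~R : R) e2 => {}e e2.
have l1 : val (half_shift e).2 = 1 by [].
split.
- exact: smooth_act.
- move=> p; rewrite (partial_t_act _ p st) l1 tt /theta_at.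
  by rewrite /sqnorm /= expr1n expr0n addr0 mul1r.
- by move=> p; rewrite (Zbarop_act _ p st) Zbar_theta mulr0.
- move=> p; rewrite /theta_at -[p]mkptE act_gA !act_half_shift.
  set x := get_coord axis_x p; set y := get_coord axis_y p; set t := get_coord axis_t p.
  have := theta_gA (mkpt (x + e / 2) (y + e * s3 / 6) (t + e * (s3 / 3 * x - y))).
  rewrite act_gA mulN1r => h; rewrite mulNr -mulrN -h /cube_root.
  have -> : 2 * pi / 3 * e = weight 1 * (e * s3 * 2 / 3) by rewrite W; field: s3q.
  rewrite -(t_shift _ _ _ _ st tt).
  by apply: eq_mkpt; field.
- move=> p; rewrite /theta_at -[p]mkptE act_gB !act_half_shift.
  set x := get_coord axis_x p; set y := get_coord axis_y p; set t := get_coord axis_t p.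
  have := theta_gB (mkpt (x + e / 2) (y + e * s3 / 6) (t + e * (s3 / 3 * x - y))).
  rewrite act_gB mulN1r => h; rewrite mulNr -mulrN -h /cube_root.
  have -> : 2 * pi / 3 * e = weight 1 * (- (e * s3 * 4 / 3)) + 2 * pi * e.
    by rewrite W; field: s3q.
  rewrite expiD e2 mulr1 -(t_shift _ _ _ _ st tt).
  by apply: eq_mkpt; field.
Qed.

Lemma theta_at_opp e x y t : theta_at (- e) (mkpt (- x) (- y) t) = - theta_at e (mkpt x y t).
Proof.
by rewrite /theta_at !act_half_shift -theta_odd; apply: eq_mkpt; field.
Qed.

(** Both sides equal [omega * theta q] for the point [q] below: one by [theta_rot], the other since the
    fixed point and its image under the inverse rotation differ by [1 + omega]. *)
Lemma theta_at_rot1 p : theta_at 1 (act gR p) = theta_at 1 p.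
Proof.
have st := @smooth_theta R; have tt := @theta_t R; have s3s := @s3_sqr R.
have W := weight1E; have s3q : s3 ^+ 2 = 3 by rewrite expr2.
rewrite -[p]mkptE; set x := get_coord axis_x p; set y := get_coord axis_y p; set t := get_coord axis_t p.
(* The point [(0, - s3 / 3)] is the image of the fixed point under the inverse
   rotation. *)
pose q := mkpt x (y - s3 / 3) (t - 2 * s3 / 3 * x).
have hR : theta_at 1 (act gR (mkpt x y t)) = om * theta q.
  rewrite /theta_at act_gR act_half_shift -theta_rot /q act_gR.
  by apply: eq_mkpt; field: s3q.
have hV : theta_at 1 (mkpt x y t) = om * theta q.
  have := theta_gA (act gB q); rewrite theta_gB mulrA mulrNN mulr1 mul1r => <-.
  rewrite /q act_gB act_gA /theta_at act_half_shift.
  have o1 : om = cube_root 1 by rewrite -[om]expr1 -cube_root_exp.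
  have -> : om = expi (weight 1 * (2 * s3 / 3)).
    by rewrite o1 /cube_root W; congr expi; field: s3q.
  rewrite -(t_shift _ _ _ _ st tt).
  by apply: eq_mkpt; field.
by rewrite hR hV.
Qed.

Lemma theta_at_rotN1 p : theta_at (-1) (act gR p) = theta_at (-1) p.
Proof.
rewrite -[p]mkptE; set x := get_coord axis_x p; set y := get_coord axis_y p; set t := get_coord axis_t p.
have := theta_at_rot1 (mkpt (- x) (- y) t); rewrite !act_gR => h.
have e1 := theta_at_opp 1 (- x) (- y) t; rewrite !opprK -h in e1.
by rewrite e1 -theta_at_opp; apply: eq_mkpt; field.
Qed.

Lemma theta_at0 e : e = 1 \/ e = -1 -> theta_at e (mkpt 0 0 0) != 0.
Proof.
rewrite /theta_at act_half_shift; case=> ->.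
  by have := theta_hexp_neq0 (0 : R); congr (_ != 0); apply: eq_mkpt; field.
by have := theta_hexp_opp_neq0 (0 : R); congr (_ != 0); apply: eq_mkpt; field.
Qed.

End Rotation.

(** * A basis of rotation eigenvectors *)

Section ThetaBasis.
Context {R : realType}.
Local Notation C := R[i].
Local Notation s3 := (@s3 R).
Local Notation om := (@omega R).
Implicit Types (f g : heis R -> C) (p : heis R) (x y t : R).

Let o : heis R := mkpt 0 0 0.

Definition theta_half (a1 a2 : nat) p : C := theta_at 1 p ^+ a1 * theta_at (-1) p ^+ a2.

Lemma cube_rootN1 : cube_root (-1) = om ^+ 2 :> C.
Proof.
apply: (mulfI (@omega_neq0 R)); rewrite -exprS omega_cubed -[om]expr1 -cube_root_exp.
by rewrite /cube_root -expiD mulr1 mulrN1 subrr expi0.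
Qed.

(** The characters of [theta_at 1] and [theta_at (-1)] are [- omega] and
    [- omega^2]; their powers combine to a sign exactly if [a1 + 2 a2] is a multiple
    of three. *)
Lemma theta_space_theta_half (s a1 a2 : nat) : (a1 = a2 %[mod 3])%N ->
  theta_space (s + (a1 + a2)) (fun p => theta p ^+ s * theta_half a1 a2 p).
Proof.
move=> a12; have h0 := theta_space_char_exp s (@theta_space_theta R : theta_space_char 1 ((-1) ^+ 1) (@theta R)).
have h1 : theta_space_char a1 ((- om) ^+ a1) (fun p => theta_at 1 p ^+ a1).
  have := @theta_space_char_exp R _ _ _ a1 (theta_at_char 1); rewrite muln1.
  have -> : 1%:~R = 1 :> R by [].
  have -> // : cube_root 1 = om :> C by rewrite -[om]expr1 -cube_root_exp.
have h2 : theta_space_char a2 ((- om ^+ 2) ^+ a2) (fun p => theta_at (-1) p ^+ a2).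
  have := @theta_space_char_exp R _ _ _ a2 (theta_at_char (-1)); rewrite muln1.
  have -> : (-1)%:~R = -1 :> R by [].
  by rewrite cube_rootN1.
have := theta_space_char_mul h0 (theta_space_char_mul h1 h2); rewrite muln1.
have -> // : ((-1) ^+ 1) ^+ s * ((- om) ^+ a1 * (- om ^+ 2) ^+ a2) = (-1) ^+ (s + (a1 + a2)) :> C.
rewrite expr1 (exprNn om) (exprNn (om ^+ 2)) -(exprM om 2) mulrACA -(exprD om).
rewrite -(exprD (-1) a1) mulrA -exprD.
have /dvdnP[q ->] : (3 %| a1 + 2 * a2)%N.
  by rewrite /dvdn -modnDml a12 modnDml -mulSn modnMr.
by rewrite mulnC exprM omega_cubed expr1n mulr1.
Qed.

Lemma smooth_theta_half a1 a2 : smooth (theta_half a1 a2).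
Proof. by apply: smooth_mul; apply: smooth_exp; exact: smooth_act smooth_theta. Qed.

Lemma theta_half_rot a1 a2 p : theta_half a1 a2 (act gR p) = theta_half a1 a2 p.
Proof. by rewrite /theta_half theta_at_rot1 theta_at_rotN1. Qed.

Lemma theta_half0 a1 a2 : theta_half a1 a2 o != 0.
Proof. by rewrite mulf_neq0 ?expf_neq0 // theta_at0 //; [left | right]. Qed.

Lemma theta0 : theta o = 0.
Proof.
have := @theta_odd R 0 0 0; rewrite oppr0 -/o => /eqP.
by rewrite -addr_eq0 -mulr2n -mulr_natr mulf_eq0 (pnatr_eq0 _ 2) orbF => /eqP.
Qed.

(** [theta] does not vanish identically near the origin along the axis of [x],
    since its derivative there is nonzero; so [G] has zeros arbitrarily close to the
    origin. *)
Lemma theta_cancel (n : nat) (G : heis R -> C) : continuous G ->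
  (forall p, theta p ^+ n * G p = 0) -> G o = 0.
Proof.
move=> cG h; apply/eqP/negP => /negP Go.
have path : (fun s => set_coord axis_x o s) @ 0 --> o.
  by apply: continuous_pairP; [exact: cvg_id | exact: cvg_cst | exact: cvg_cst].
have cu : G (set_coord axis_x o s) @[s --> 0] --> G o.
  exact: (cvg_comp _ _ path (cG o)).
have near0 : \forall s \near 0, (0 : C) = theta (set_coord axis_x o s).
  apply: filterS (cvgr_neq0 (G o) cu Go) => s Gs.
  have /eqP := h (set_coord axis_x o s); rewrite mulf_eq0 (negbTE Gs) orbF expf_eq0.
  by case/andP => _ /eqP.
have d0 := cder_near near0 (cder_cst 0 0).
have := @partial_theta0 R; rewrite -/o (cder_unique (smooth_pder axis_x smooth_theta o) d0).
by rewrite eqxx.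
Qed.

Section Basis.
Variable D : nat.
Hypothesis D0 : (0 < D)%N.

(** The value [D - 1] is skipped: the remaining degree would be [1], which is not
    a sum [a1 + a2] with [a1 = a2] modulo three. *)
Definition order_at0 (i : 'I_D) : nat := if i.+1 == D then D else i.

Lemma order_at0_inj : injective order_at0.
Proof.
move=> i j; rewrite /order_at0; have := ltn_ord i; have := ltn_ord j.
case: eqP => hi; case: eqP => hj jD iD h; apply: val_inj => /=; lia.
Qed.

(** The remaining degree [r] is split into two equal halves if it is even, and
    into [(r + 3) / 2] and [(r - 3) / 2] if it is odd, so that the exponents are
    congruent modulo three. *)
Definition theta_basis (i : 'I_D) : heis R -> C :=
  let r := (D - order_at0 i)%N in
  fun p => theta p ^+ order_at0 i * theta_half (r./2 + (odd r).*2) (r./2 - odd r) p.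

Lemma theta_space_basis i : theta_space D (theta_basis i).
Proof.
rewrite /theta_basis; set s := order_at0 i; set r := (D - s)%N.
have [sD r1] : (s <= D)%N /\ r <> 1%N.
  rewrite /r /s /order_at0; have := ltn_ord i; case: eqP => h iD; split; lia.
have rE := odd_double_half r.
have h : (odd r <= r./2)%N by move: rE r1; case: (odd r); case: (r./2) => //=; lia.
have := @theta_space_theta_half s (r./2 + (odd r).*2) (r./2 - odd r).
have -> : (s + (r./2 + (odd r).*2 + (r./2 - odd r)) = D)%N.
  move: rE; rewrite -addnn; lia.
apply; have -> : (r./2 + (odd r).*2 = 3 * odd r + (r./2 - odd r))%N by lia.
by rewrite mulnC modnMDl.
Qed.

Lemma theta_basis_rot i p : theta_basis i (act gR p) = om ^+ order_at0 i * theta_basis i p.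
Proof. by rewrite /theta_basis theta_rot theta_half_rot exprMn mulrA. Qed.

(** The basis functions vanish to distinct orders at the origin. *)
Lemma theta_basis_free (a : 'I_D -> C) : \sum_i a i *: theta_basis i = 0 -> forall i, a i = 0.
Proof.
move=> h i; have [n] := ubnP (order_at0 i); elim: n i => // n IH i; rewrite ltnS => ni.
have {}IH j : (order_at0 j < order_at0 i)%N -> a j = 0.
  by move=> ji; apply: IH; exact: leq_trans ji ni.
set m := order_at0 i in IH ni.
pose rest j := let r := (D - order_at0 j)%N in theta_half (r./2 + (odd r).*2) (r./2 - odd r).
pose G p := \sum_j a j * (theta p ^+ (order_at0 j - m) * rest j p).
have cG : continuous G.
  apply: smooth_cont; apply: smooth_sum => j; apply: smooth_scale; apply: smooth_mul.
    exact: smooth_exp smooth_theta.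
  exact: smooth_theta_half.
have G0 : G o = 0.
  apply: (@theta_cancel m) => // p; transitivity ((\sum_i a i *: theta_basis i) p); last by rewrite h.
  rewrite /G mulr_sumr; rewrite fct_sumE; apply: eq_bigr => j _.
  have [jm|mj] := ltnP (order_at0 j) m.
    by rewrite IH // scale0r mul0r mulr0.
  rewrite -[RHS]/(a j * (theta p ^+ order_at0 j * rest j p)).
  by rewrite mulrCA; congr (_ * _); rewrite mulrA -exprD subnKC.
move: G0; rewrite /G (bigD1 i) //= big1 ?addr0; last first.
  move=> j ji; have [jm|] := ltnP (order_at0 j) m; first by rewrite IH // mul0r.
  rewrite leq_eqVlt => /orP[/eqP/order_at0_inj e|mj]; first by rewrite e eqxx in ji.
  by rewrite theta0 expr0n subn_eq0 leqNgt mj mul0r mulr0.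
rewrite subnn expr0 mul1r => /eqP; rewrite mulf_eq0 => /orP[/eqP //|].
by rewrite (negbTE (theta_half0 _ _)).
Qed.

Lemma theta_space_rot_dim (eps : C) :
  has_dim [set f | theta_space D f /\ (fun p => f (act gR p)) = eps *: f]
    #|[pred i | om ^+ order_at0 i == eps]|.
Proof.
have h0 : theta_space D (0 : heis R -> C).
  have := theta_space_lin (-1) (theta_space_basis (Ordinal D0)) (theta_space_basis (Ordinal D0)).
  by rewrite scaleN1r addNr.
apply: (@eigen_has_dim _ _ D (theta_space D) (fun f i => theta_coef f (i%:R + D%:R / 2) 0)
  (fun f p => f (act gR p)) theta_basis) => //.
- by move=> a u v; exact: theta_space_lin.
- by move=> a u v i; exact: theta_coef_lin.
- by move=> v hv v0; apply/funext => p; exact: (theta_space_unique D0 hv).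
- exact: theta_space_basis.
- exact: theta_basis_free.
- by move=> i; apply/funext => p; exact: theta_basis_rot.
Qed.

End Basis.
End ThetaBasis.

(** * Recentring at a fixed point of the screw motion *)

Section Recentring.
Context {R : realType}.
Local Notation C := R[i].
Local Notation s3 := (@s3 R).
Local Notation om := (@omega R).
Implicit Types (f g : heis R -> C) (p : heis R) (x y t : R).

(** For [e = 1] the translation by [(1 + omega) / 2], the fixed point of
    [gA * gG c] in the plane. *)
Definition recenter (e : R) : heisC R := ((e / 4 +i* (e * s3 / 4), 0), 1%g).

Lemma act_recenter e x y t : act (recenter e) (mkpt x y t) =
  mkpt (x + e / 4) (y + e * s3 / 4) (t + e * (s3 / 2 * x - y / 2)).
Proof.
rewrite /act /recenter /= mu1; rewrite -[(_ * _)%g]/(heis_mul _ _) /heis_mul /mkpt /=.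
by congr pair; [congr (_ +i* _)|]; field.
Qed.

Lemma recenterK e p : act (recenter e) (act (recenter (- e)) p) = p.
Proof. by rewrite -[p]mkptE !act_recenter; congr (mkpt _ _ _); field. Qed.

Lemma recenterNK e p : act (recenter (- e)) (act (recenter e) p) = p.
Proof. by rewrite -{2}[e]opprK recenterK. Qed.

Lemma expi_sign (e : R) (D : nat) : e = 1 \/ e = -1 -> expi (e * (pi * D%:R)) = (-1) ^+ D :> C.
Proof.
case=> ->; first by rewrite mul1r expi_pi.
have e0 : (-1) ^+ D != 0 :> C by rewrite signr_eq0.
apply: (mulfI e0); rewrite -[X in X * _]expi_pi -expiD mulN1r subrr expi0.
by rewrite -expr2 sqrr_sign.
Qed.

(** Commuting the translation by half a period past [gA] and [gB] costs the sign
    [(-1) ^+ D]; hence the character in the definition of [theta_space]. *)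
Lemma theta_space_char_recenter D k e f : e = 1 \/ e = -1 -> theta_space_char D k f ->
  theta_space_char D ((-1) ^+ D * k) (fun p => f (act (recenter e) p)).
Proof.
move=> e1 [sf ft fZ fA fB]; have l1 : val (recenter e).2 = 1 by [].
have W := @weight_s3 R D; have s3s := @s3_sqr R; have s3q : s3 ^+ 2 = 3 by rewrite expr2.
split.
- exact: smooth_act.
- move=> p; rewrite (partial_t_act _ p sf) l1 ft.
  by rewrite /sqnorm /= expr1n expr0n addr0 mul1r.
- by move=> p; rewrite (Zbarop_act _ p sf) fZ mulr0.
- move=> p; rewrite -[p]mkptE act_gA !act_recenter.
  set x := get_coord axis_x p; set y := get_coord axis_y p; set t := get_coord axis_t p.
  have := fA (mkpt (x + e / 4) (y + e * s3 / 4) (t + e * (s3 / 2 * x - y / 2))).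
  rewrite act_gA => h; rewrite -(mulrA ((-1) ^+ D)) -h -(expi_sign D e1) -W.
  have -> : e * (weight D * s3) = weight D * (e * s3) by ring.
  rewrite -(t_shift _ _ _ _ sf ft).
  by apply: eq_mkpt; field.
- move=> p; rewrite -[p]mkptE act_gB !act_recenter.
  set x := get_coord axis_x p; set y := get_coord axis_y p; set t := get_coord axis_t p.
  have := fB (mkpt (x + e / 4) (y + e * s3 / 4) (t + e * (s3 / 2 * x - y / 2))).
  have e1' : - e = 1 \/ - e = -1 by case: e1 => ->; rewrite ?opprK; [right|left].
  rewrite act_gB => h; rewrite -(mulrA ((-1) ^+ D)) -h -(expi_sign D e1') -W.
  have -> : - e * (weight D * s3) = weight D * (- (e * s3)) by ring.
  rewrite -(t_shift _ _ _ _ sf ft).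
  by apply: eq_mkpt; field.
Qed.

(** The fixed point of the rotation part of [gA * gG c] is moved to the origin;
    what remains is a rotation and a vertical translation. *)
Lemma gG_recenter (b c : R) f p : smooth f ->
  (forall p, partial axis_t f p = 'i%C * b%:C * f p) -> (forall p, f (act gA p) = f p) ->
  expi (b * (c / 3 - 2 * s3 / 3)) * f (act (recenter 1) (act gR p)) =
    f (act (gG c) (act (recenter 1) p)).
Proof.
move=> sf ft fA; have s3s := @s3_sqr R; have s3q : s3 ^+ 2 = 3 by rewrite expr2.
rewrite -[p]mkptE -(fA (act (gG c) _)) act_gR !act_recenter act_gG act_gA -(t_shift _ _ _ _ sf ft).
by apply: eq_mkpt; field: s3q.
Qed.

Section Level0.
Variables (N n k : nat) (c : R).
Hypothesis N0 : (0 < N)%N.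
Hypothesis n0 : (0 < n)%N.
Hypothesis cE : c = 2 * s3 / N%:R.
Let D := (n * N)%N.

Let D0 : (0 < D)%N. Proof. by rewrite muln_gt0 n0. Qed.

Let phase_shift : expi (weight D * (c / 3 - 2 * s3 / 3)) * om ^+ (D + 2 * n) = 1 :> C.
Proof.
have -> : weight D * (c / 3 - 2 * s3 / 3) = 2 * pi * n%:Z%:~R - 2 * pi / 3 * (D + 2 * n)%:R :> R.
  have N0' : N%:R != 0 :> R by rewrite pnatr_eq0 -lt0n.
  have := @s3_gt0 R; move/lt0r_neq0 => s30.
  rewrite cE /weight /D !natrD !natrM pmulrn; by field; rewrite s30 N0'.
rewrite expiD expi_2pi mul1r -cube_root_exp /cube_root -expiD.
by rewrite addNr expi0.
Qed.

(** Recentring identifies level zero with an eigenspace of the rotation. The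
    exponent collects the character [k] and the phase of the vertical translation in
    [gG_recenter]. *)
Lemma landau_level0_dim : has_dim (landau_level (weight D) c 0 (om ^+ k))
  #|[pred i : 'I_D | om ^+ order_at0 i == om ^+ (D + 2 * n + k)]|.
Proof.
have sgn2 : (-1) ^+ D * (-1) ^+ D = 1 :> C by rewrite -expr2 sqrr_sign.
have EP : expi (weight D * (c / 3 - 2 * s3 / 3)) != 0 :> C by exact: expi_neq0.
have rot f : smooth f -> (forall p, partial axis_t f p = 'i%C * (weight D)%:C * f p) ->
    (forall p, f (act gA p) = f p) ->
    ((fun p => f (act (recenter 1) (act gR p))) =
       om ^+ (D + 2 * n + k) *: ((fun p => f (act (recenter 1) p)) : heis R -> C)) <->
    (forall p, f (act (gG c) p) = om ^+ k * f p).
  move=> sf ft fA; split=> [h p|h].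
    have := congr1 (fun F => F (act (recenter (-1)) p)) h.
    rewrite -[RHS]/(_ * f (act _ (act _ p))) recenterK => hp.
    have := gG_recenter c (act (recenter (-1)) p) sf ft fA; rewrite hp.
    by rewrite recenterK exprD mulrA mulrA phase_shift mul1r => ->.
  apply/funext => p; rewrite -[RHS]/(om ^+ (D + 2 * n + k) * f _); apply: (mulfI EP).
  by rewrite (gG_recenter c p sf ft fA) h exprD !mulrA phase_shift mul1r.
apply: (has_dim_transfer (s := id) (s' := id)
  (psi := fun g => (fun p => g (act (recenter (-1)) p)))
  (phi := fun f => (fun p => f (act (recenter 1) p))) _ _ _ _ _ _ _ _ (theta_space_rot_dim D0 _)) => //.
- move=> g /= [hg gr].
  have := theta_space_char_recenter (or_intror erefl) hg; rewrite sgn2 => -[sf ft fZ fA fB].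
  have fA1 p : g (act (recenter (-1)) (act gA p)) = g (act (recenter (-1)) p) by rewrite fA mul1r.
  have fB1 p : g (act (recenter (-1)) (act gB p)) = g (act (recenter (-1)) p) by rewrite fB mul1r.
  split=> //.
    move=> p; have -> : Zbarop (fun p => g (act (recenter (-1)) p)) = (fun=> 0) by apply/funext.
    by rewrite Zop0 mulr0 mul0r oppr0 mul0r.
  split=> //; apply/(rot _ sf ft fA1).
  have K p : act (recenter (-1)) (act (recenter 1) p) = p.
    exact: recenterNK.
  have -> : (fun p => g (act (recenter (-1)) (act (recenter 1) (act gR p)))) = (fun p => g (act gR p)).
    by apply/funext => p; rewrite K.
  by rewrite gr; congr (_ *: _); apply/funext => p; rewrite K.
- move=> f lf; have fZ := landau_level0_Zbar D0 lf; case: lf => sf ft _ [fA fB fG].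
  have hf : theta_space_char D 1 f by split=> // p; rewrite mul1r.
  split; last exact/(rot f sf ft fA).
  by have := theta_space_char_recenter (or_introl erefl) hf; rewrite mulr1.
- by move=> f _; apply/funext => p; rewrite recenterK.
- move=> g _ g0; apply/funext => p; have := congr1 (fun F => F (act (recenter 1) p)) g0.
  by rewrite recenterNK.
- by move=> e a _; apply/funext => p; rewrite !fct_sumE.
Qed.

End Level0.
End Recentring.

(** * Joint eigenspaces as levels of the ladder *)

Section Invariance.
Context {R : realType}.
Local Notation C := R[i].
Local Notation s3 := (@s3 R).
Local Notation om := (@omega R).
Implicit Types (f : heis R -> C) (p : heis R) (x y t : R).

Lemma gen_sub (G : groupType) (S : set G) (P : set G) : group_closed [in P] ->
  S `<=` P -> forall x : G, x \in gen S -> P x.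
Proof. by move=> Pg SP x /set_mem; apply. Qed.

Lemma sub_gen (G : groupType) (S : set G) (x : G) : S x -> x \in gen S.
Proof. by move=> Sx; apply/mem_set => A [_]; apply. Qed.

Lemma stabilizer_closed f : group_closed [in [set g : heisC R | forall p, f (act g p) = f p]].
Proof.
split=> [|g h /set_mem /= fg /set_mem /= fh]; apply/mem_set => /= p; first by rewrite act1.
by rewrite actM fg -{2}[p]act1 -(mulgV h) actM fh.
Qed.

Definition gC (c : R) : heisC R := ((0, c), 1%g).

Lemma act_gC c x y t : act (gC c) (mkpt x y t) = mkpt x y (t + c).
Proof.
rewrite /act /= mu1; rewrite -[(_ * _)%g]/(heis_mul _ _) /heis_mul /mkpt /=.
by congr pair; [congr (_ +i* _)|]; ring.
Qed.

Lemma translation_closed (P : set (heisC R)) : group_closed [in P] ->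
  group_closed [in [set q : heis R | P (q, 1%g)]].
Proof.
move=> [P1 PM]; split=> [|q q' /set_mem /= Pq /set_mem /= Pq'].
  by apply/mem_set; exact: set_mem P1.
apply/mem_set => /=; have := PM _ _ (mem_set Pq) (mem_set Pq') => /set_mem.
congr (P _); rewrite -[LHS]/(heisC_mul _ (heisC_inv _)) /heisC_mul /heisC_inv /=.
by rewrite invg1 !mu1 mulg1.
Qed.

(** The stabilizer of [f] is a group, so invariance can be checked on generators,
    first those of the lattice and then those of [Gamma c]. *)
Lemma Gamma_inv f (c : R) : (forall g p, g \in Gamma c -> f (act g p) = f p) <->
  [/\ forall p, f (act gA p) = f p, forall p, f (act gB p) = f p,
      forall p, f (act (gC c) p) = f p & forall p, f (act (gG c) p) = f p].
Proof.
have La q : Lambda om c q -> Gamma c (q, 1%g).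
  by move=> Lq; apply: sub_gen; left; exists q.
split=> [h|[hA hB hC hG] g p].
  split=> p; apply: h; try (by apply: La; apply: sub_gen; constructor).
  by apply: sub_gen; right.
move: g p; pose P := [set g : heisC R | forall p, f (act g p) = f p].
suff h g : g \in Gamma c -> P g by move=> g p /h.
apply: gen_sub; first exact: stabilizer_closed.
move=> _ [[q Lq ->]|->] //.
apply: (gen_sub (P := [set q : heis R | P (q, 1%g)]) _ _ Lq).
  exact/translation_closed/stabilizer_closed.
by move=> _ [] -> /=.
Qed.

(** On functions of frequency [b] the sub-Laplacian is [(b - Z Zbar) / r], by the
    commutator; invariance under the vertical generator is automatic as [b c] is a
    multiple of [2 pi]. *)
Lemma joint_eigenspaceE (c r : R) (n : nat) (k : nat) : 0 < r -> c != 0 -> (0 < n)%N ->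
  joint_eigenspace (Gamma c) r ((4 * k%:R + 2) * pi * n%:R / (c * r)) (2 * pi * n%:R / (c * r))
  = landau_level (2 * pi * n%:R / c) c k 1.
Proof.
move=> r0 c0 n0; set b := 2 * pi * n%:R / c.
have r0' := lt0r_neq0 r0; have rC0 : r%:C != 0 :> C.
  by apply/eqP => /complexI/eqP; rewrite (negbTE r0').
have i2 : 'i%C * 'i%C = -1 :> C by rewrite -expr2 sqr_i.
have i0 : 'i%C != 0 :> C by apply/eqP => i0; move/eqP: i2; rewrite i0 mul0r eq_sym oppr_eq0 oner_eq0.
have bE : (2 * pi * n%:R / (c * r))%:C = (r%:C)^-1 * b%:C :> C.
  by rewrite -fmorphV -rmorphM; congr (_%:C); rewrite /b; field; rewrite c0 r0'.
have aE : (4 * k%:R + 2) * pi * n%:R / (c * r) = (2 * k%:R + 1) * b / r.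
  by rewrite /b; field; rewrite c0 r0'.
have bc : b * c = 2 * pi * n%:Z%:~R by rewrite /b divfK // pmulrn.
clearbody b.
have reebE f p : (('i%C)^-1 * reeb r f p = (2 * pi * n%:R / (c * r))%:C * f p) <->
    (partial axis_t f p = 'i%C * b%:C * f p).
  rewrite bE /reeb; split=> [h|->]; last by field; rewrite rC0 i0.
  by apply: (mulfI (mulf_neq0 (invr_neq0 i0) (invr_neq0 rC0))); rewrite -mulrA h; field; rewrite rC0 i0.
have subE f p : smooth f -> (forall p, partial axis_t f p = 'i%C * b%:C * f p) ->
    (sublaplacian r f p = ((4 * k%:R + 2) * pi * n%:R / (c * r))%:C * f p) <->
    (Zop (Zbarop f) p = (- (2 * k%:R * b))%:C * f p).
  move=> sf ft; rewrite /sublaplacian (commutator_char p sf ft).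
  have -> : ((4 * k%:R + 2) * pi * n%:R / (c * r))%:C = ((2 * k%:R + 1) * b)%:C * r%:C^-1 :> C.
    by rewrite aE rmorphM fmorphV.
  have -> : ((2 * r)%:C)^-1 = 2^-1 * (r%:C)^-1 :> C by rewrite rmorphM rmorph_nat invfM.
  rewrite !(rmorphM, rmorphD, rmorphN, rmorph_nat, rmorph1).
  set Z := Zop _ _; set F := f p; set B := b%:C; set K : C := k%:R; set I := r%:C^-1.
  have I0 : I != 0 by rewrite invr_eq0.
  split=> [h|->]; last by field.
  have := congr1 (fun z => z * r%:C) h.
  have rI : I * r%:C = 1 by rewrite mulVf.
  have -> : (- (2^-1 * I) * (Z + (Z - 2 * B * F))) * r%:C = (I * r%:C) * (- Z + B * F) by field.
  have -> : (2 * K + 1) * B * I * F * r%:C = (I * r%:C) * ((2 * K + 1) * B * F) by ring.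
  rewrite rI !mul1r => {}h.
  have -> : Z = B * F - (- Z + B * F) by ring.
  by rewrite h; ring.
apply/seteqP; split=> f.
  move=> [sf /Gamma_inv[fA fB fC fG] fa fb].
  have ft p := (reebE f p).1 (fb p); split=> //; last by split=> // p; rewrite mul1r.
  by move=> p; apply/(subE f p sf ft).
move=> [sf ft fk [fA fB fG]]; split=> //.
- apply/Gamma_inv; split=> // p; last by rewrite fG mul1r.
  rewrite -[p]mkptE act_gC (t_shift _ _ _ _ sf ft).
  by rewrite bc expi_2pi mul1r.
- by move=> p; apply/(subE f p sf ft).
- by move=> p; apply/reebE.
Qed.

Lemma sublaplacian_conj (r : R) f p : smooth f ->
  sublaplacian r (fun q => (f q)^*) p = (sublaplacian r f p)^*.
Proof.
move=> sf; have sc := smooth_conj sf.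
have e1 : Zop (fun q => (f q)^*) = (fun q => (Zbarop f q)^*).
  by apply/funext => q; rewrite (Zop_conj q sc); congr ((Zbarop _ q)^*); apply/funext => w; rewrite conjcK.
have e2 : Zbarop (fun q => (f q)^*) = (fun q => (Zop f q)^*).
  by apply/funext => q; rewrite (Zop_conj q sf) conjcK.
have e3 : Zop (fun q => (Zop f q)^*) p = (Zbarop (Zop f) p)^*.
  rewrite (Zop_conj p (smooth_conj (smooth_Zop sf))); congr ((Zbarop _ p)^*).
  by apply/funext => w; rewrite conjcK.
have e4 : Zbarop (fun q => (Zbarop f q)^*) p = (Zop (Zbarop f) p)^*.
  by rewrite (Zop_conj p (smooth_Zbarop sf)) conjcK.
rewrite /sublaplacian e1 e2 e3 e4.
case: (Zop _ p) => a1 a2; case: (Zbarop _ p) => b1 b2.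
rewrite -fmorphV; apply: complex_ext; rewrite /= ?creimE /=; ring.
Qed.

(** Conjugation exchanges [Zop] and [Zbarop] and reverses the vertical frequency. *)
Lemma joint_conj G (r a b : R) f : r != 0 -> joint_eigenspace G r a b f ->
  joint_eigenspace G r a (- b) (fun p => (f p)^*).
Proof.
move=> r0 [sf fG fa fb]; split.
- exact: smooth_conj.
- by move=> g p gG; rewrite fG.
- move=> p; rewrite (sublaplacian_conj r p sf) fa.
  by case: (f p) => u v; apply: complex_ext => /=; ring.
- move=> p; have := fb p; rewrite /reeb (partialE (pder_conj (smooth_pder axis_t sf))).
  have rC0 : r%:C != 0 :> C by apply/eqP => /complexI/eqP; rewrite (negbTE r0).
  have i2 : 'i%C * 'i%C = -1 :> C by rewrite -expr2 sqr_i.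
  have i0 : 'i%C != 0 :> C by apply/eqP => i0; move/eqP: i2; rewrite i0 mul0r eq_sym oppr_eq0 oner_eq0.
  have iE (z : C) : ('i%C)^-1 * z = - 'i%C * z.
    by apply: (mulfI i0); rewrite mulVKf // mulrA mulrN i2 opprK mul1r.
  rewrite !iE -fmorphV.
  case: (f p) => u v; case: (partial axis_t f p) => u' v' [h1 h2].
  apply: complex_ext; rewrite /= ?creimE /=; move: h1 h2; move: (r^-1) => q; lra.
Qed.

End Invariance.

(** * Counting exponents modulo three *)

Section Counting.
Context {R : realType}.
Local Notation C := R[i].
Local Notation s3 := (@s3 R).
Local Notation om := (@omega R).

Lemma omega_exp_mod a : om ^+ a = om ^+ (a %% 3).
Proof. by rewrite {1}(divn_eq a 3) exprD mulnC exprM omega_cubed expr1n mul1r. Qed.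

Lemma omega_exp_eq a b : (om ^+ a == om ^+ b) = (a %% 3 == b %% 3)%N.
Proof.
have o1 : om != 1 by apply/eqP => o1; have := @Im_omega_gt0 R; rewrite o1 ltxx.
have o2 : om ^+ 2 != 1.
  apply/eqP => e; have := @omega_cubed R; rewrite exprS e mulr1 => /eqP.
  by rewrite (negbTE o1).
have o12 : om != om ^+ 2.
  by rewrite expr2 -{1}[om]mulr1 (inj_eq (mulfI (@omega_neq0 R))) eq_sym.
rewrite (omega_exp_mod a) (omega_exp_mod b).
have := ltn_pmod a (isT : 0 < 3)%N; have := ltn_pmod b (isT : 0 < 3)%N.
case: (a %% 3)%N => [|[|[|//]]]; case: (b %% 3)%N => [|[|[|//]]] _ _;
  by rewrite ?expr0 ?expr1 ?eqxx // ?(negbTE o1) ?(negbTE o2) ?(negbTE o12) //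
    eq_sym ?(negbTE o1) ?(negbTE o2) ?(negbTE o12).
Qed.

Lemma card_mod3 D j : (\sum_(i < D) (i %% 3 == j %% 3) = (D + 2 - j %% 3) %/ 3)%N.
Proof.
have := ltn_pmod j (isT : 0 < 3)%N; move: (j %% 3)%N => r r3.
elim: D => [|D IH]; first by rewrite big_ord0; lia.
by rewrite big_ord_recr /= IH; case: eqP => h; lia.
Qed.

(** Among [D.+1] sections the exponents are [0, ..., D - 1] and [D.+1]. *)
Lemma card_order D j : (#|[pred i : 'I_D.+1 | om ^+ order_at0 i == om ^+ j]| =
  (D + 2 - j %% 3) %/ 3 + (D.+1 %% 3 == j %% 3))%N.
Proof.
rewrite -sum1_card big_mkcond /= big_ord_recr /= -(card_mod3 D j).
congr (_ + _)%N; last first.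
  by rewrite unfold_in /order_at0 /= eqxx omega_exp_eq; case: eqP.
apply: eq_bigr => i _; rewrite unfold_in /order_at0 /= eqSS (ltn_eqF (ltn_ord i)) omega_exp_eq.
by case: eqP.
Qed.

(** The function of period three that is the value of
    [2 / s3 * cos (2 pi a / 3 + pi / 6)]. *)
Definition chi3 (a : nat) : int := if (a %% 3 == 0)%N then 1 else if (a %% 3 == 1)%N then -1 else 0.

Lemma card_chi3 D a : ((((D + 2 - (D.+1 + 2 * a) %% 3) %/ 3 +
  (D.+1 %% 3 == (D.+1 + 2 * a) %% 3)) * 3)%N%:Z = D.+1%:Z + 2 * chi3 a + chi3 (a + 2 * D.+1))%R.
Proof.
rewrite /chi3; case: eqP => h1; case: eqP => h2; case: eqP => h3; try case: eqP => h4; try case: eqP => h5; lia.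
Qed.

Lemma cos_pi6 : cos (pi / 6) = s3 / 2 :> R /\ sin (pi / 6) = 2^-1 :> R.
Proof.
have h : 2 * pi / 3 = pi / 6 + pi / 2 :> R by field.
have := @Im_omega R; have := @Re_omega R; rewrite /omega /expi /= h sinDpihalf cosDpihalf.
by move=> /oppr_inj -> ->.
Qed.

Lemma cos_chi3 a (x : R) (q : int) : x = a%:R + 3 * q%:~R ->
  2 / s3 * cos (2 * pi * x / 3 + pi / 6) = (chi3 a)%:~R.
Proof.
move=> ->; have [c6 s6] := cos_pi6; have s30 := lt0r_neq0 (@s3_gt0 R).
have -> : cos (2 * pi * (a%:R + 3 * q%:~R) / 3 + pi / 6) = Re (om ^+ (a %% 3) * expi (pi / 6)).
  have <- : expi (2 * pi * (a%:R + 3 * q%:~R) / 3 + pi / 6) = om ^+ (a %% 3) * expi (pi / 6).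
    rewrite -omega_exp_mod -cube_root_exp /cube_root -expiD -[RHS]mulr1 -(expi_2pi q) -expiD.
    by congr expi; field.
  by [].
rewrite /chi3; have := ltn_pmod a (isT : 0 < 3)%N.
have e6 : expi (pi / 6) = (s3 / 2) +i* 2^-1 by rewrite /expi c6 s6.
have s3q : s3 ^+ 2 = 3 by rewrite expr2 s3_sqr.
rewrite e6 omegaE; case: (a %% 3)%N => [|[|[|//]]] _.
- by rewrite expr0 mul1r /=; field.
- by rewrite expr1 /=; field: s3q.
- by rewrite expr2 /=; field: s3q.
Qed.

Lemma multiplicity_pos (N n k : nat) (r c : R) : (0 < N)%N -> (0 < n)%N -> 0 < r ->
  c = 4 * Im om / N%:R ->
  exists2 m : nat, multiplicity (Gamma c) r
      ((4 * k%:R + 2) * pi * n%:R / (c * r)) (2 * pi * n%:R / (c * r)) m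
    & m%:R = 3^-1 * (n%:R * N%:R + 4 / s3 * cos (2 * pi * (n%:R - k%:R) / 3 + pi / 6)
       + 2 / s3 * cos (2 * pi * (n%:R - k%:R - n%:R * N%:R) / 3 + pi / 6)).
Proof.
move=> N0 n0 r0 c4; have s30 := lt0r_neq0 (@s3_gt0 R).
have N0' : N%:R != 0 :> R by rewrite pnatr_eq0 -lt0n.
have cE : c = 2 * s3 / N%:R by rewrite c4 Im_omega; field.
have c0 : c != 0 by rewrite cE !mulf_neq0 ?invr_eq0.
have pi0 : pi != 0 :> R by rewrite lt0r_neq0 // pi_gt0.
have D0 : (0 < n * N)%N by rewrite muln_gt0 n0.
have bE : 2 * pi * n%:R / c = weight (n * N) :> R.
  by rewrite cE /weight natrM; field; rewrite N0' s30.
have b0 : weight (n * N) != 0 :> R.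
  by rewrite /weight !mulf_neq0 ?invr_eq0 // pnatr_eq0 -lt0n.
have h := landau_level0_dim k N0 n0 cE.
exists #|[pred i : 'I_(n * N) | om ^+ order_at0 i == om ^+ (n * N + 2 * n + k)]|.
  rewrite /multiplicity (joint_eigenspaceE k r0 c0 n0) bE; apply: landau_level_dim => //.
  by rewrite mul1r.
have [D DE] : exists D, (n * N = D.+1)%N by exists (n * N).-1; rewrite prednK.
have c1 := @cos_chi3 (n + 2 * k) (n%:R - k%:R) (- k%:Z).
have c2 := @cos_chi3 (n + 2 * k + 2 * (n * N)) (n%:R - k%:R - n%:R * N%:R) (- (k + n * N)%N%:Z).
have -> : 4 / s3 = 2 * (2 / s3) by ring.
rewrite -mulrA c1 ?c2; first last.
- rewrite natrD natrM mulrNz -pmulrn; ring.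
- by rewrite !natrD !natrM mulrNz -pmulrn natrD natrM; ring.
rewrite -natrM DE; have <- : (om ^+ (D.+1 + 2 * (n + 2 * k))) = om ^+ (D.+1 + 2 * n + k).
  by apply/eqP; rewrite omega_exp_eq; apply/eqP; lia.
rewrite card_order; have := card_chi3 D (n + 2 * k).
set M := (X in X%:Z = _) => /(congr1 (fun z : int => z%:~R : R)).
rewrite -pmulrn !intrD intrM => h3.
apply: (mulIf (_ : 3 != 0 :> R)); first by rewrite pnatr_eq0.
by rewrite -[LHS]natrM -/M h3; field.
Qed.

Lemma multiplicity_conj G (r a b : R) m : r != 0 ->
  multiplicity G r a b m -> multiplicity G r a (- b) m.
Proof.
move=> r0; apply: (has_dim_transfer (s := fun z : C => z^*) (s' := fun z : C => z^*)
  (psi := fun f => (fun p => (f p)^*)) (phi := fun f => (fun p => (f p)^*))).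
- exact: conjcK.
- exact: conjc0.
- exact: (inv_inj (@conjcK R)).
- by move=> f; exact: joint_conj.
- by move=> f /(joint_conj r0); rewrite opprK.
- by move=> f _; apply/funext => p; exact: conjcK.
- by move=> f _ f0; apply/funext => p; rewrite -[LHS]conjcK (congr1 (fun F => F p) f0) conjc0.
- move=> e a' _; apply/funext => p; rewrite !fct_sumE rmorph_sum; apply: eq_bigr => i _.
  exact: rmorphM.
Qed.

End Counting.

(** * Fourier coefficients on the torus *)

Section Torus.
Context {R : realType}.
Local Notation C := R[i].
Local Notation s3 := (@s3 R).
Local Notation om := (@omega R).
Implicit Types (f g : heis R -> C) (p : heis R) (x y t : R).

(** Vertical frequency zero: functions on the torus [C / L_omega]. *)
Definition torus_fun : set (heis R -> C) := [set f |
  [/\ smooth f, forall p, partial axis_t f p = 0, forall p, f (act gA p) = f p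
    & forall p, f (act gB p) = f p]].

Lemma torus_flat f x y t t' : torus_fun f -> f (mkpt x y t) = f (mkpt x y t').
Proof.
move=> [sf ft _ _]; have ft' p : partial axis_t f p = 'i%C * 0%:C * f p.
  by rewrite ft mulr0 mul0r.
have -> : t = t' + (t - t') by ring.
by rewrite (t_shift _ _ _ _ sf ft') mul0r expi0 mul1r.
Qed.

(** The coordinates [u], [v] of [z = u + v omega], in which the torus is a product
    of two circles. *)
Definition lattice_coord f u v : C := f (mkpt (u - v / 2) (s3 / 2 * v) 0).

Lemma lat_onto f x y t : torus_fun f -> f (mkpt x y t) = lattice_coord f (x + y / s3) (2 * y / s3).
Proof.
move=> tf; rewrite (torus_flat _ _ _ 0 tf) /lattice_coord; have s30 := lt0r_neq0 (@s3_gt0 R).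
by apply: eq_mkpt => //; field.
Qed.

Lemma lat_period1 f u v : torus_fun f -> lattice_coord f (u + 1) v = lattice_coord f u v.
Proof.
move=> tf; have [_ _ fA _] := tf.
rewrite /lattice_coord -[RHS]fA act_gA [RHS](torus_flat _ _ _ 0 tf); apply: eq_mkpt => //; ring.
Qed.

Lemma lat_period2 f u v : torus_fun f -> lattice_coord f u (v + 1) = lattice_coord f u v.
Proof.
move=> tf; have [_ _ _ fB] := tf.
rewrite /lattice_coord -[RHS]fB act_gB [RHS](torus_flat _ _ _ 0 tf).
by apply: eq_mkpt => //; field.
Qed.

(** The derivative in the direction of [omega]. *)
Definition D2 f p : C := (- 2^-1)%:C * partial axis_x f p + (s3 / 2)%:C * partial axis_y f p.

Lemma smooth_D2 f : smooth f -> smooth (D2 f).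
Proof. by move=> sf; apply: smooth_add; apply: smooth_scale; exact: smooth_partial. Qed.

Lemma cder_lat1 f u v : smooth f ->
  cder (fun s => lattice_coord f s v) u (lattice_coord (partial axis_x f) u v).
Proof.
move=> sf; have h2 : is_derive u 1 (fun _ : R => s3 / 2 * v) 0 := is_derive_cst _ _ _.
have h3 : is_derive u 1 (fun _ : R => 0 : R) 0 := is_derive_cst _ _ _.
have := chain_rule sf (is_derive_affine 1 (- (v / 2)) u) h2 h3.
apply: cder_ext => [s|]; rewrite mul1r // /lattice_coord; ring.
Qed.

Lemma cder_lat2 f u v : smooth f -> cder (lattice_coord f u) v (lattice_coord (D2 f) u v).
Proof.
move=> sf; have h3 : is_derive v 1 (fun _ : R => 0 : R) 0 := is_derive_cst _ _ _.
have := chain_rule sf (is_derive_affine (- 2^-1) u v) (is_derive_affine (s3 / 2) 0 v) h3.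
apply: cder_ext => [s|].
  by rewrite /lattice_coord; apply: eq_mkpt => //; field.
have -> : - 2^-1 * v + u = u - v / 2 by field.
by rewrite addr0 /lattice_coord /D2; ring.
Qed.

Lemma lat_cont2 f : smooth f -> continuous (fun q : R * R => lattice_coord f q.1 q.2).
Proof.
move=> sf q.
apply: (@continuous_cvg _ _ _ _ _ (fun q : R * R => mkpt (q.1 - q.2 / 2) (s3 / 2 * q.2) 0) f).
  exact: smooth_cont.
apply: continuous_pairP; last exact: cvg_cst.
  by apply: cvgB; [exact: cvg_fst | apply: cvgM; [exact: cvg_snd | exact: cvg_cst]].
by apply: cvgM; [exact: cvg_cst | exact: cvg_snd].
Qed.

Lemma lat_cont1 f v : smooth f -> continuous (fun u => lattice_coord f u v).
Proof. by move=> sf u; exact: cder_cont (cder_lat1 u v sf). Qed.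

Lemma mean_by_parts (m : int) (U U' : R -> C) : (forall x, cder U x (U' x)) -> continuous U' ->
  (forall x, U (x + 1) = U x) -> mean (fun x => fmode (- m) x * U' x) =
    ('i%C * (2 * pi * m%:~R)%:C) * mean (fun x => fmode (- m) x * U x).
Proof.
move=> dU cU' pU; have cU : continuous U by move=> x; exact: cder_cont (dU x).
set k := 'i%C * _; have dm x : cder (fmode (- m)) x (- k * fmode (- m) x).
  have := cder_cexp (cderZ (- k) (cder_real (is_derive_affine 1 0 x))).
  apply: cder_ext => [s|].
    rewrite mul1r addr0 /fmode -cexp_i; congr cexp; rewrite /k.
    by apply: complex_ext; rewrite /= ?creimE /=; ring.
  rewrite mul1r addr0 mulr1 /fmode -cexp_i; congr (_ * cexp _); rewrite /k.
  by apply: complex_ext; rewrite /= ?creimE /=; ring.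
have h x := cderM (dm x) (dU x).
have := mean_eq h; rewrite -(add0r 1) fmode_period pU subrr.
have cmU V : continuous V -> continuous (fun x => fmode (- m) x * V x).
  by move=> cV x; apply: cvg_cM; [exact: fmode_cont | exact: cV].
have := @mean_lin3 R (- k) 1 0 _ _ _ (cmU _ cU) (cmU _ cU') (cmU _ cU).
rewrite mul0r addr0 mul1r => E1 E2; apply/eqP; rewrite -subr_eq0; apply/eqP.
transitivity (- k * mean (fun x => fmode (- m) x * U x) + mean (fun x => fmode (- m) x * U' x)).
  by ring.
by rewrite -E1 -[RHS]E2; congr mean; apply/funext => x; ring.
Qed.

Definition inner (m : int) f v : C := mean (fun u => fmode (- m) u * lattice_coord f u v).
Definition coef (m j : int) f : C := mean (fun v => fmode (- j) v * inner m f v).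

Lemma inner_cont_kernel m f v : smooth f -> continuous (fun u => fmode (- m) u * lattice_coord f u v).
Proof. by move=> sf u; apply: cvg_cM; [exact: fmode_cont | exact: lat_cont1]. Qed.

Lemma inner_cder m f v : smooth f -> cder (inner m f) v (inner m (D2 f) v).
Proof.
move=> sf; have s1 := smooth_D2 sf; have s2 := smooth_D2 s1.
apply: (@mean_derive _ (fun u s => fmode (- m) u * lattice_coord f u s)
  (fun u s => fmode (- m) u * lattice_coord (D2 f) u s) (fun u s => fmode (- m) u * lattice_coord (D2 (D2 f)) u s)).
- by move=> x s; apply: cderZ; exact: cder_lat2.
- by move=> x s; apply: cderZ; exact: cder_lat2.
- by move=> s; exact: inner_cont_kernel.
- by move=> s; exact: inner_cont_kernel.
- move=> q; apply: cvg_cM; last exact: lat_cont2.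
  apply: (@continuous_cvg _ _ _ _ _ (fun q : R * R => q.1) (fmode (- m))).
    exact: fmode_cont.
  exact: cvg_fst.
Qed.

Lemma inner_cont m f : smooth f -> continuous (inner m f).
Proof. by move=> sf v; exact: cder_cont (inner_cder m v sf). Qed.

Lemma coef_cont_kernel m j f : smooth f -> continuous (fun v => fmode (- j) v * inner m f v).
Proof. by move=> sf u; apply: cvg_cM; [exact: fmode_cont | exact: inner_cont]. Qed.

Lemma coef_lin m j (a b : C) f g : smooth f -> smooth g ->
  coef m j (fun p => a * f p + b * g p) = a * coef m j f + b * coef m j g.
Proof.
move=> sf sg.
have E v : inner m (fun p => a * f p + b * g p) v = a * inner m f v + b * inner m g v.
  have := @mean_lin3 R a b 0 _ _ _ (@inner_cont_kernel m f v sf) (@inner_cont_kernel m g v sg)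
    (@inner_cont_kernel m f v sf).
  rewrite mul0r addr0 => <-; congr mean; apply/funext => u; rewrite /lattice_coord; ring.
have := @mean_lin3 R a b 0 _ _ _ (@coef_cont_kernel m j f sf) (@coef_cont_kernel m j g sg)
    (@coef_cont_kernel m j f sf).
by rewrite mul0r addr0 => <-; congr mean; apply/funext => v; rewrite E; ring.
Qed.

Lemma coef_x m j f : torus_fun f ->
  coef m j (partial axis_x f) = ('i%C * (2 * pi * m%:~R)%:C) * coef m j f.
Proof.
move=> tf; have [sf _ _ _] := tf; have sx := smooth_partial axis_x sf.
rewrite /coef -(meanZ _ (@coef_cont_kernel m j f sf)); congr mean; apply/funext => v.
rewrite mulrCA; congr (_ * _).
by apply: (mean_by_parts m (fun x => cder_lat1 x v sf) (@lat_cont1 _ v sx)) => x; exact: lat_period1.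
Qed.

Lemma inner_period m f v : torus_fun f -> inner m f (v + 1) = inner m f v.
Proof. by move=> tf; congr mean; apply/funext => u; rewrite lat_period2. Qed.

(** The derivative along [y] is a combination of those along the two periods. *)
Lemma coef_y m j f : torus_fun f ->
  coef m j (partial axis_y f) = ('i%C * (2 * pi * ((2 * j%:~R + m%:~R) / s3))%:C) * coef m j f.
Proof.
move=> tf; have [sf _ _ _] := tf; have sx := smooth_partial axis_x sf.
have sy := smooth_partial axis_y sf; have s30 := lt0r_neq0 (@s3_gt0 R).
have := mean_by_parts j (fun x => inner_cder m x sf) (@inner_cont m _ (smooth_D2 sf))
  (fun x => inner_period m x tf).
rewrite -/(coef m j f) -/(coef m j (D2 f)) (coef_lin m j _ _ sx sy) coef_x // => h.
have s3C : (s3 / 2)%:C != 0 :> C by apply/eqP => /complexI/eqP; rewrite mulf_eq0 (negbTE s30) invr_eq0 pnatr_eq0.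
apply: (mulfI s3C); set X := (s3 / 2)%:C * _ in h *.
have -> : X = 'i%C * (2 * pi * j%:~R)%:C * coef m j f -
   (- 2^-1)%:C * ('i%C * (2 * pi * m%:~R)%:C * coef m j f) by rewrite -h; ring.
have -> : (s3 / 2)%:C * ('i%C * (2 * pi * ((2 * j%:~R + m%:~R) / s3))%:C * coef m j f) =
  'i%C * (2 * pi * (j%:~R + m%:~R / 2))%:C * coef m j f.
  rewrite mulrA mulrCA -rmorphM; congr (_ * _%:C * _); by field.
have -> : 2 * pi * (j%:~R + m%:~R / 2) = 2 * pi * j%:~R - (- 2^-1) * (2 * pi * m%:~R) :> R by field.
by rewrite rmorphB rmorphM /=; ring.
Qed.

(** Uniqueness of Fourier coefficients in [v], then in [u]. *)
Lemma coef_eq0 f : torus_fun f -> (forall m j, coef m j f = 0) -> forall p, f p = 0.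
Proof.
move=> tf h p; have [sf _ _ _] := tf.
have in0 m : forall v, inner m f v = 0.
  apply: fourier_unique; first exact: inner_cont.
    by move=> v; exact: inner_period.
  by move=> j; rewrite -[j]opprK; exact: h.
rewrite -[p]mkptE lat_onto //; apply: (@fourier_unique _ (fun u => lattice_coord f u _)).
- exact: lat_cont1.
- by move=> u; exact: lat_period1.
- by move=> m; rewrite -[m]opprK; exact: in0.
Qed.

End Torus.

(** * Exponentials with frequencies in the dual lattice *)

Section Waves.
Context {R : realType}.
Local Notation C := R[i].
Local Notation s3 := (@s3 R).
Local Notation om := (@omega R).
Implicit Types (f g : heis R -> C) (p : heis R) (x y t : R) (q : int * int).

Lemma mean_fmode (k : int) : mean (@fmode R k) = (k == 0)%:R.
Proof.
have [->|k0] := eqVneq k 0.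
  rewrite (@mean_eq _ _ (fun x : R => x%:C)); first by rewrite rmorph0 rmorph1 subr0.
  move=> x; have := cder_real (is_derive_affine 1 0 x).
  apply: cder_ext => [s|]; first by rewrite mul1r addr0.
  by rewrite /fmode mulr0 mul0r expi0.
have c0 : continuous (fun _ : R => 0 : C) by move=> x; exact: cvg_cst.
have := @mean_by_parts R (- k) (fun=> 1) (fun=> 0) (cder_cst 1) c0 (fun=> erefl).
rewrite opprK; have -> : (fun x : R => fmode k x * 0) = (fun=> 0) by apply/funext => x; rewrite mulr0.
have -> : (fun x : R => fmode k x * 1) = fmode k by apply/funext => x; rewrite mulr1.
have -> : mean (fun=> 0 : C) = 0 :> C.
  by rewrite (@mean_eq _ _ (fun=> 0)) ?subrr // => x; exact: cder_cst.
move/esym/eqP; rewrite mulf_eq0 => /orP[|/eqP //].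
have i0 : 'i%C != 0 :> C by apply/eqP => /(congr1 (fun z : C => Im z))/= /eqP; rewrite oner_eq0.
rewrite mulf_eq0 (negbTE i0) /= => /eqP/complexI/eqP.
by rewrite !mulf_eq0 pnatr_eq0 (gt_eqF (pi_gt0 R)) /= intr_eq0 oppr_eq0 (negbTE k0).
Qed.

(** The element of the dual lattice whose pairings with [1] and [omega] are [q.1]
    and [q.2]. *)
Definition freq q : C := (q.1)%:~R +i* ((2 * q.2%:~R + q.1%:~R) / s3).

Definition cfreq q : C := Re (freq q) +i* (- Im (freq q)).

Definition wave q p : C :=
  cexp ('i%C * ((2 * pi * Re (freq q))%:C * (get_coord axis_x p)%:C
              + (2 * pi * Im (freq q))%:C * (get_coord axis_y p)%:C)).

Lemma waveE q x y t : wave q (mkpt x y t) = expi (2 * pi * (Re (freq q) * x + Im (freq q) * y)).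
Proof.
rewrite -cexp_i /wave; congr cexp; rewrite /=.
by apply: complex_ext; rewrite /= ?creimE /=; ring.
Qed.

Lemma smooth_wave q : smooth (wave q).
Proof.
apply: smooth_cexp; apply: smooth_scale.
by apply: smooth_add; apply: smooth_scale; exact: smooth_coord.
Qed.

Lemma partial_wave v q : partial v (wave q) = fun p =>
  'i%C * ((2 * pi * Re (freq q))%:C * (axis_eq v axis_x)%:R
        + (2 * pi * Im (freq q))%:C * (axis_eq v axis_y)%:R) * wave q p.
Proof.
exact: (partialE (pder_cexp (pder_scale _ (pder_add (pder_scale _ (pder_coord v axis_x))
  (pder_scale _ (pder_coord v axis_y)))))).
Qed.

Lemma torus_wave q : torus_fun (wave q).
Proof.
have s30 := lt0r_neq0 (@s3_gt0 R); split.
- exact: smooth_wave.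
- by move=> p; rewrite partial_wave /=; ring.
- move=> p; rewrite -[p]mkptE act_gA !waveE -[RHS]mulr1 -(expi_2pi q.1) -expiD.
  by congr expi; rewrite /freq /=; ring.
- move=> p; rewrite -[p]mkptE act_gB !waveE -[RHS]mulr1 -(expi_2pi q.2) -expiD.
  by congr expi; rewrite /freq /=; field.
Qed.

Lemma lat_wave q u v : lattice_coord (wave q) u v = fmode q.1 u * fmode q.2 v.
Proof.
have s30 := lt0r_neq0 (@s3_gt0 R).
by rewrite /lattice_coord waveE /fmode -expiD; congr expi; rewrite /freq /=; field.
Qed.

Lemma coef_wave m j q : coef m j (wave q) = (q == (m, j))%:R.
Proof.
have E k l (z : C) : (mean (fun x : R => fmode (- k) x * (fmode l x * z))) = (l == k)%:R * z.
  rewrite mulrC -subr_eq0 -mean_fmode -meanZ; last exact: fmode_cont.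
  by congr mean; apply/funext => x; rewrite addrC fmodeD; ring.
have F v : inner m (wave q) v = (q.1 == m)%:R * fmode q.2 v.
  by rewrite -E; congr mean; apply/funext => u; rewrite lat_wave.
rewrite /coef (_ : (fun v => _) = (fun v => fmode (- j) v * (fmode q.2 v * (q.1 == m)%:R))).
  by rewrite E -natrM mulnb andbC -pair_eqE; case: q {F}.
by apply/funext => v; rewrite F [_%:R * _]mulrC.
Qed.

(** Multiplication of the frequency by the conjugate of [omega], in the
    coordinates of [freq]. *)
Definition turn q : int * int := (q.2, - q.1 - q.2).

(** The sign comes from the translation by [omega / 2] in the screw motion. *)
Lemma wave_gG (c : R) q p :
  wave q (act (gG c) p) = expi (pi * q.2%:~R) * wave (turn q) p.
Proof.
have s30 := lt0r_neq0 (@s3_gt0 R); have s3q : s3 ^+ 2 = 3 by rewrite expr2 s3_sqr.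
rewrite -[p]mkptE act_gG !waveE -expiD; congr expi.
rewrite /freq /turn /= rmorphB rmorphN /=; by field: s3q.
Qed.

Lemma Zbarop_wave q p : Zbarop (wave q) p = 'i%C * pi%:C * freq q * wave q p.
Proof.
rewrite ZbaropE !partial_wave; case: (freq q) => a b; move: (wave q p) => w /=.
have -> : a +i* b = a%:C + 'i%C * b%:C by exact: complexE.
rewrite !rmorphM rmorph_nat; set P := pi%:C; set A := a%:C; set B := b%:C.
have i2 : 'i%C ^+ 2 = -1 :> C by exact: sqr_i.
by move: 'i%C i2 => j i2; field: i2.
Qed.

Lemma Zop_wave q p : Zop (wave q) p = 'i%C * pi%:C * cfreq q * wave q p.
Proof.
rewrite ZopE !partial_wave /cfreq; case: (freq q) => a b; move: (wave q p) => w.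
have -> : Re (a +i* b) +i* (- Im (a +i* b)) = a%:C - 'i%C * b%:C by apply: complex_ext; rewrite /= ?creimE /=; ring.
rewrite /=.
rewrite !rmorphM rmorph_nat; set P := pi%:C; set A := a%:C; set B := b%:C.
have i2 : 'i%C ^+ 2 = -1 :> C by exact: sqr_i.
by move: 'i%C i2 => j i2; field: i2.
Qed.

Lemma laplace_freq q : ('i%C * pi%:C * cfreq q) * ('i%C * pi%:C * freq q) =
  (- (pi ^+ 2 * sqnorm (freq q)))%:C :> C.
Proof. by rewrite /cfreq; case: (freq q) => a b; apply: complex_ext; rewrite /= ?creimE /sqnorm /=; ring. Qed.

Lemma ZZ_wave q p : Zop (Zbarop (wave q)) p = (- (pi ^+ 2 * sqnorm (freq q)))%:C * wave q p.
Proof.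
have -> : Zbarop (wave q) = (fun p => 'i%C * pi%:C * freq q * wave q p).
  by apply/funext => p'; exact: Zbarop_wave.
rewrite (Zop_scale _ (smooth_wave q)) Zop_wave -laplace_freq; ring.
Qed.

Lemma torus_Zbarop f : torus_fun f -> torus_fun (Zbarop f).
Proof.
move=> [sf ft fA fB]; split.
- exact: smooth_Zbarop.
- by move=> p; rewrite (@partial_t_Zbarop _ f 0 sf) ?mul0r // => q; rewrite ft mul0r.
- by move=> p; exact: Zbarop_transl.
- by move=> p; exact: Zbarop_transl.
Qed.

Lemma coef_Zbarop q f : torus_fun f ->
  coef q.1 q.2 (Zbarop f) = 'i%C * pi%:C * freq q * coef q.1 q.2 f.
Proof.
move=> tf; have [sf ft _ _] := tf.
have -> : Zbarop f = (fun p => 2^-1 * partial axis_x f p + (2^-1 * 'i%C) * partial axis_y f p).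
  by rewrite ZbaropE; apply/funext => p; rewrite ft; ring.
rewrite (coef_lin _ _ _ _ (smooth_partial axis_x sf) (smooth_partial axis_y sf)) coef_x // coef_y //.
rewrite /freq; set b : R := (2 * q.2%:~R + q.1%:~R) / s3; set a : R := q.1%:~R; set w := coef _ _ f.
clearbody b a w.
have -> : a +i* b = a%:C + 'i%C * b%:C by exact: complexE.
rewrite !rmorphM rmorph_nat; set P := pi%:C; set A := a%:C; set B := b%:C.
have i2 : 'i%C ^+ 2 = -1 :> C by exact: sqr_i.
by move: 'i%C i2 => j i2; field: i2.
Qed.

Lemma coef_Zop q f : torus_fun f ->
  coef q.1 q.2 (Zop f) = 'i%C * pi%:C * cfreq q * coef q.1 q.2 f.
Proof.
move=> tf; have [sf ft _ _] := tf.
have -> : Zop f = (fun p => 2^-1 * partial axis_x f p + (2^-1 * - 'i%C) * partial axis_y f p).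
  by rewrite ZopE; apply/funext => p; rewrite ft; ring.
rewrite (coef_lin _ _ _ _ (smooth_partial axis_x sf) (smooth_partial axis_y sf)) coef_x // coef_y //.
rewrite /cfreq /freq; set b : R := (2 * q.2%:~R + q.1%:~R) / s3; set a : R := q.1%:~R; set w := coef _ _ f.
clearbody b a w.
have -> : Re (a +i* b) +i* (- Im (a +i* b)) = a%:C - 'i%C * b%:C by apply: complex_ext; rewrite /= ?creimE /=; ring.
rewrite !rmorphM rmorph_nat; set P := pi%:C; set A := a%:C; set B := b%:C.
have i2 : 'i%C ^+ 2 = -1 :> C by exact: sqr_i.
by move: 'i%C i2 => j i2; field: i2.
Qed.

Lemma coef_ZZ q f : torus_fun f ->
  coef q.1 q.2 (Zop (Zbarop f)) = (- (pi ^+ 2 * sqnorm (freq q)))%:C * coef q.1 q.2 f.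
Proof.
move=> tf; rewrite (coef_Zop _ (torus_Zbarop tf)) (coef_Zbarop _ tf) -laplace_freq; ring.
Qed.

End Waves.

(** * Orbits of frequencies *)

Section FlatSpectrum.
Context {R : realType}.
Local Notation C := R[i].
Local Notation s3 := (@s3 R).
Local Notation om := (@omega R).
Implicit Types (f g : heis R -> C) (p : heis R) (x y t : R) (q : int * int).

Lemma turn3 q : turn (turn (turn q)) = q.
Proof. by case: q => a b; rewrite /turn /=; congr pair; ring. Qed.

Lemma turn_inj : injective turn.
Proof. by move=> q q' h; rewrite -(turn3 q) h turn3. Qed.

(** A fundamental domain for [turn] on the nonzero frequencies. *)
Definition sector q : bool := (0 <= q.2) && (0 < q.1 + q.2).

Lemma sector_turn q : sector q -> (sector (turn q) = false) * (sector (turn (turn q)) = false).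
Proof. by case: q => a b; rewrite /sector /turn /= => h; split; apply/negP; lia. Qed.

Lemma sector_cover q : q != (0, 0) -> [|| sector q, sector (turn (turn q)) | sector (turn q)].
Proof. by case: q => a b; rewrite -pair_eqE /sector /turn /=; lia. Qed.

Lemma sqnorm_freq q : sqnorm (freq q : C) =
  4 / 3 * (q.1 ^+ 2 + q.1 * q.2 + q.2 ^+ 2)%:~R.
Proof.
have s3q : s3 ^+ 2 = 3 by rewrite expr2 s3_sqr.
rewrite /sqnorm /freq /= !rmorphD rmorphM !rmorphXn /= expr_div_n s3q.
by field.
Qed.

Lemma sqnorm_turn q : sqnorm (freq (turn q) : C) = sqnorm (freq q : C).
Proof. rewrite !sqnorm_freq; congr (_ * _%:~R); rewrite /turn /=; ring. Qed.

Definition wsum (I : Type) (s : seq I) (a : I -> C) (h : I -> int * int) p : C :=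
  \sum_(i <- s) a i * wave (h i) p.

Lemma torus_lin (a b : C) f g : torus_fun f -> torus_fun g -> torus_fun (fun p => a * f p + b * g p).
Proof.
move=> [sf ft fA fB] [sg gt gA gB].
have pf v := pder_add (pder_scale a (smooth_pder v sf)) (pder_scale b (smooth_pder v sg)).
split.
- exact: smooth_add (smooth_scale a sf) (smooth_scale b sg).
- by move=> p; rewrite (partialE (pf axis_t)) ft gt; ring.
- by move=> p; rewrite fA gA.
- by move=> p; rewrite fB gB.
Qed.

Lemma torus0 : torus_fun (fun=> 0 : C).
Proof.
have := torus_lin 0 0 (@torus_wave R (0, 0)) (torus_wave (0, 0)).
by rewrite (_ : (fun p => _) = (fun=> 0)) //; apply/funext => p; rewrite !mul0r addr0.
Qed.

Lemma wsum_cons (I : Type) i (s : seq I) a h :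
  wsum (i :: s) a h = fun p => a i * wave (h i) p + 1 * wsum s a h p.
Proof. by apply/funext => p; rewrite /wsum big_cons mul1r. Qed.

Lemma wsum_nil (I : Type) a h : wsum ([::] : seq I) a h = fun=> 0.
Proof. by apply/funext => p; rewrite /wsum big_nil. Qed.

Lemma torus_wsum (I : Type) (s : seq I) a h : torus_fun (wsum s a h).
Proof.
elim: s => [|i s IH]; first by rewrite wsum_nil; exact: torus0.
by rewrite wsum_cons; apply: torus_lin IH; exact: torus_wave.
Qed.

Lemma coef_lin_torus m j (a b : C) f g : torus_fun f -> torus_fun g ->
  coef m j (fun p => a * f p + b * g p) = a * coef m j f + b * coef m j g.
Proof. by move=> [sf _ _ _] [sg _ _ _]; exact: coef_lin. Qed.

Lemma coef_scale m j (a : C) f : torus_fun f -> coef m j (fun p => a * f p) = a * coef m j f.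
Proof.
move=> tf; rewrite -[RHS]addr0 -[0](mul0r (coef m j f)) -(coef_lin_torus _ _ _ _ tf tf).
by congr coef; apply/funext => p; rewrite mul0r addr0.
Qed.

Lemma coef_wsum (I : Type) (s : seq I) a h q :
  coef q.1 q.2 (wsum s a h) = \sum_(i <- s) a i * (h i == q)%:R.
Proof.
elim: s => [|i s IH].
  rewrite wsum_nil big_nil (_ : (fun=> 0) = (fun p => 0 * wave (0, 0) p)).
    by rewrite (coef_scale _ _ _ (torus_wave _)) mul0r.
  by apply/funext => p; rewrite mul0r.
rewrite wsum_cons (coef_lin_torus _ _ _ _ (torus_wave _) (torus_wsum _ _ _)) IH mul1r big_cons.
by rewrite coef_wave; case: q {IH}.
Qed.

Lemma sum_delta (s : seq (int * int)) (F : int * int -> C) q : uniq s ->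
  \sum_(i <- s) F i * (i == q)%:R = (q \in s)%:R * F q.
Proof.
move=> us; have [qs|qs] := boolP (q \in s).
  rewrite (bigD1_seq q) //= eqxx mulr1 big1 ?addr0 ?mul1r // => i /negbTE ->.
  by rewrite mulr0.
rewrite mul0r big1_seq // => i /= is_; have [iq|] := eqVneq i q; last by rewrite mulr0.
by rewrite iq (negbTE qs) in is_.
Qed.

Section Level.
Variables (c r kappa : R).
Hypothesis r0 : 0 < r.
Hypothesis kappa0 : 0 < kappa.

Definition on_level q : Prop := pi ^+ 2 * sqnorm (freq q : C) / r = kappa.

Definition flat_eigen : set (heis R -> C) := [set f | torus_fun f /\
  forall p, Zop (Zbarop f) p = (- (r * kappa))%:C * f p].

Lemma on_level_turn q : on_level (turn q) <-> on_level q.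
Proof. by rewrite /on_level sqnorm_turn. Qed.

Lemma on_level_neq0 q : on_level q -> q != (0, 0).
Proof.
move=> h; apply/eqP => q0; move: kappa0; rewrite -h q0 sqnorm_freq.
by rewrite (_ : _ + _ = 0 :> int) // !mulr0 mul0r ltxx.
Qed.

(** The operator multiplies the coefficient at [q] by a number which is the
    eigenvalue only on the level. *)
Lemma flat_eigen_coef f q : flat_eigen f -> ~ on_level q -> coef q.1 q.2 f = 0.
Proof.
move=> [tf fk] nq; have := coef_ZZ q tf.
have -> : Zop (Zbarop f) = (fun p => (- (r * kappa))%:C * f p) by apply/funext.
rewrite (coef_scale _ _ _ tf) => /eqP; rewrite -subr_eq0 -mulrBl mulf_eq0 => /orP[|/eqP //].
rewrite subr_eq0 => /eqP/complexI/oppr_inj h; case: nq; rewrite /on_level -h.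
by rewrite mulrC mulKf // gt_eqF.
Qed.

Lemma flat_eigen_lin (a : C) f g : flat_eigen f -> flat_eigen g -> flat_eigen (a *: f + g).
Proof.
move=> [tf fk] [tg gk]; have e : a *: f + g = (fun p => a * f p + 1 * g p).
  by apply/funext => p; rewrite mul1r.
have [sf _ _ _] := tf; have [sg _ _ _] := tg.
split=> [|p]; first by rewrite e; exact: torus_lin.
have Zb : Zbarop (a *: f + g) = (fun p => a * Zbarop f p + Zbarop g p).
  rewrite !ZbaropE; apply/funext => p'.
  by rewrite !(partialE (pder_add (pder_scale a (smooth_pder _ sf)) (smooth_pder _ sg))); ring.
rewrite Zb (Zop_add (smooth_scale a (smooth_Zbarop sf)) (smooth_Zbarop sg)).
by rewrite (Zop_scale a (smooth_Zbarop sf)) fk gk e; ring.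
Qed.

Lemma flat_eigen0 : flat_eigen 0.
Proof. by split=> [|p]; [exact: torus0 | rewrite Zbarop0 Zop0 mulr0]. Qed.

Lemma flat_eigen_wave q : on_level q -> flat_eigen (wave q).
Proof.
move=> hq; split=> [|p]; first exact: torus_wave.
by rewrite ZZ_wave -hq [r * _]mulrC divfK // gt_eqF.
Qed.

Section Orbits.
Variable S : seq (int * int).
Hypothesis S_uniq : uniq S.
Hypothesis S_mem : forall q, q \in S <-> on_level q /\ sector q.

Definition level_freqs : seq (int * int) := S ++ map turn S ++ map (turn \o turn) S.

Lemma mem_level_freqs q : q \in level_freqs <-> on_level q.
Proof.
rewrite !mem_cat; split.
  case/or3P => [/S_mem[]//|/mapP[q' /S_mem[h _] ->]|/mapP[q' /S_mem[h _] ->]] /=.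
    by rewrite on_level_turn.
  by rewrite !on_level_turn.
move=> h; have := sector_cover (on_level_neq0 h); case/or3P => hs.
- by rewrite (S_mem q).2.
- apply/or3P/Or32/mapP; exists (turn (turn q)); rewrite ?turn3 //.
  by apply/S_mem; rewrite !on_level_turn.
- apply/or3P/Or33/mapP; exists (turn q); rewrite /= ?turn3 //.
  by apply/S_mem; rewrite on_level_turn.
Qed.

Lemma uniq_level_freqs : uniq level_freqs.
Proof.
have t2 : injective (turn \o turn) by apply: inj_comp; exact: turn_inj.
rewrite !cat_uniq S_uniq (map_inj_uniq turn_inj) (map_inj_uniq t2) S_uniq andbT /=.
apply/andP; split; apply/hasPn => q.
  rewrite mem_cat => /orP[]/mapP[q' /S_mem[_ hq] ->]; apply/negP => /S_mem[_];
    by rewrite /= (sector_turn hq).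
move=> /mapP[q' /S_mem[_ hq] ->]; apply/negP => /mapP[q'' /S_mem[_ hq''] /= /turn_inj e].
by move: hq''; rewrite -e (sector_turn hq).
Qed.

(** Both sides have the same Fourier coefficients. *)
Lemma flat_eigen_expansion f : flat_eigen f ->
  f = wsum level_freqs (fun q => coef q.1 q.2 f) id.
Proof.
move=> ef; have [tf _] := ef; set w := wsum _ _ _; have tw : torus_fun w by exact: torus_wsum.
have h0 : forall p, (fun p => 1 * f p + (-1) * w p) p = 0.
  apply: coef_eq0 => [|m j]; first exact: torus_lin.
  rewrite (coef_lin_torus _ _ _ _ tf tw) (coef_wsum _ _ _ (m, j)) (sum_delta _ _ uniq_level_freqs) /=.
  case: (boolP ((m, j) \in level_freqs)) => hq; first by rewrite mulr1n; ring.
  rewrite (flat_eigen_coef (q := (m, j)) ef) ?mulr0 ?addr0 //.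
  by move=> /mem_level_freqs; apply/negP.
by apply/funext => p; have := h0 p; rewrite mul1r mulN1r => /eqP; rewrite subr_eq0 => /eqP.
Qed.

(** Invariance, read on the finite expansion of [f]: the screw motion permutes
    the exponentials up to signs. *)
Lemma coef_turn f q : flat_eigen f -> (forall p, f (act (gG c) p) = f p) -> on_level q ->
  coef (turn q).1 (turn q).2 f = expi (pi * q.2%:~R) * coef q.1 q.2 f.
Proof.
move=> ef fG /mem_level_freqs hq; have fE := flat_eigen_expansion ef.
have -> : coef (turn q).1 (turn q).2 f = coef (turn q).1 (turn q).2
    (wsum level_freqs (fun i => coef i.1 i.2 f * expi (pi * i.2%:~R)) turn).
  congr coef; apply/funext => p; rewrite -fG {1}fE; apply: eq_bigr => i _.
  by rewrite wave_gG mulrA.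
rewrite coef_wsum (eq_bigr (fun i => coef i.1 i.2 f * expi (pi * i.2%:~R) * (i == q)%:R)).
  by rewrite (sum_delta _ _ uniq_level_freqs) hq mul1r mulrC.
by move=> i _; rewrite (inj_eq turn_inj).
Qed.

(** The signs picked up along an orbit of [turn]; after three steps they cancel. *)
Definition orbit_phase q (k : nat) : C :=
  match k with 0%N => 1 | 1%N => expi (pi * q.2%:~R) | _ => expi (pi * q.1%:~R) end.

Definition orbit_wave q : heis R -> C := wsum (iota 0 3) (orbit_phase q) (fun k => iter k turn q).

Lemma orbit_wave_gG q p : orbit_wave q (act (gG c) p) = orbit_wave q p.
Proof.
have e2 (k : int) : expi (pi * k%:~R) * expi (pi * k%:~R) = 1 :> C.
  by rewrite -expiD -mulrDl -mulr2n -mulr_natl expi_2pi.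
rewrite /orbit_wave /wsum /= !big_cons !big_nil /= !wave_gG turn3.
have h1 : expi (pi * q.2%:~R) * expi (pi * (turn q).2%:~R) = expi (pi * q.1%:~R) :> C.
  rewrite -[LHS]mulr1 -(e2 q.1) -!expiD; congr expi.
  by rewrite /turn /= rmorphB rmorphN /=; ring.
have h2 : (turn (turn q)).2 = q.1 by rewrite /turn /=; ring.
rewrite h2 !mulrA h1 e2; ring.
Qed.

Lemma flat_eigen_orbit q : on_level q -> flat_eigen (orbit_wave q).
Proof.
move=> hq; rewrite /orbit_wave; have hk k : on_level (iter k turn q).
  by elim: k => //= k IH; rewrite on_level_turn.
elim: (iota 0 3) => [|k s IH]; first by rewrite wsum_nil; exact: flat_eigen0.
rewrite wsum_cons.
have := flat_eigen_lin (orbit_phase q k) (flat_eigen_wave (hk k)) IH.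
by congr flat_eigen; apply/funext => p; rewrite mul1r.
Qed.

Lemma coef_orbit q q' : sector q -> sector q' ->
  coef q'.1 q'.2 (orbit_wave q) = (q == q')%:R.
Proof.
move=> hq hq'; rewrite /orbit_wave coef_wsum /= !big_cons big_nil /=.
have nt q1 : sector q1 = false -> (q1 == q') = false.
  by move=> h; apply/negP => /eqP e; rewrite e hq' in h.
by rewrite (nt (turn q)) ?(nt (turn (turn q))) ?(sector_turn hq) //= !mulr0 !addr0 mul1r.
Qed.

(** The coefficients in the sector are coordinates: they are dual to the orbit
    sums, and by [coef_turn] they determine all coefficients. *)
Lemma flat_has_dim : has_dim [set f | flat_eigen f /\ forall p, f (act (gG c) p) = f p] (size S).
Proof.
pose E : set (heis R -> C) := [set f | flat_eigen f /\ forall p, f (act (gG c) p) = f p].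
pose q_ (i : 'I_(size S)) := nth (0, 0) S i.
have qS i : q_ i \in S by exact: mem_nth.
have qL i : on_level (q_ i) by case/S_mem: (qS i).
have qs i : sector (q_ i) by case/S_mem: (qS i).
have El (a : C) f g : E f -> E g -> E (a *: f + g).
  move=> [ef fG] [eg gG']; split; first exact: flat_eigen_lin.
  by move=> p; rewrite -[LHS]/(a * f _ + g _) fG gG'.
pose phi (f : heis R -> C) i := coef (q_ i).1 (q_ i).2 f.
have phil (a : C) f g i : E f -> E g -> phi (a *: f + g) i = a * phi f i + phi g i.
  move=> [[tf _] _] [[tg _] _]; rewrite /phi -[coef _ _ g]mul1r -(coef_lin_torus _ _ _ _ tf tg).
  by congr coef; apply/funext => p; rewrite mul1r.
have Ee i : E (orbit_wave (q_ i)) by split; [exact: flat_eigen_orbit | exact: orbit_wave_gG].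
have phie i j : phi (orbit_wave (q_ i)) j = (i == j)%:R.
  by rewrite /phi coef_orbit // nth_uniq.
have phi0 f : E f -> (forall i, phi f i = 0) -> f = 0.
  move=> [ef fG] h; have z q : on_level q -> coef q.1 q.2 f = 0.
    have zS q1 : q1 \in S -> coef q1.1 q1.2 f = 0.
      by move=> hS; have := hS; rewrite -index_mem => hi; have := h (Ordinal hi); rewrite /phi /q_ nth_index.
    move=> /mem_level_freqs; rewrite !mem_cat => /or3P[/zS //|/mapP[q' q'S ->]|/mapP[q' q'S ->]];
      have [hl _] := (S_mem q').1 q'S.
      by rewrite (coef_turn ef fG hl) (zS _ q'S) mulr0.
    have hl' := (on_level_turn q').2 hl.
    by rewrite /= (coef_turn ef fG hl') (coef_turn ef fG hl) (zS _ q'S) !mulr0.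
  rewrite (flat_eigen_expansion ef); apply/funext => p; rewrite /wsum big1_seq // => q /= hq.
  by rewrite z ?mul0r //; apply/mem_level_freqs.
have efree (a : 'I_(size S) -> C) : \sum_i a i *: orbit_wave (q_ i) = 0 -> forall i, a i = 0.
  have [_ cP _] := eigen_comb (V := heis R -> C) (ev := fun=> 1) (conj flat_eigen0 (fun=> erefl)) El phil
    (T := id) (fun _ _ _ _ _ => erefl) Ee (fun i => esym (scale1r _)) a.
  move=> a0 i; have := cP i; rewrite a0 (bigD1 i) //= phie eqxx mulr1 big1 ?addr0.
    move=> <-; have := phil (-1) _ _ i (conj flat_eigen0 (fun=> erefl)) (conj flat_eigen0 (fun=> erefl)).
    by rewrite scaler0 addr0 mulN1r addNr.
  by move=> j /negbTE ji; rewrite phie ji mulr0.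
have := @eigen_has_dim _ (heis R -> C) (size S) E phi id (fun i => orbit_wave (q_ i)) (fun=> 1) 1
  (conj flat_eigen0 (fun=> erefl)) El phil phi0 (fun _ _ _ _ _ => erefl) Ee efree
  (fun i => esym (scale1r _)).
have -> : #|[pred i : 'I_(size S) | 1 == 1 :> C]| = size S.
  by rewrite -[RHS]card_ord; apply: eq_card => i; rewrite !inE eqxx.
congr has_dim; apply/seteqP; split => f /=; first by case.
by move=> Ef; split; rewrite ?scale1r.
Qed.

End Orbits.
End Level.
End FlatSpectrum.

(** * The dual lattice and the theorem *)

Section Conclusion.
Context {R : realType}.
Local Notation C := R[i].
Local Notation s3 := (@s3 R).
Local Notation om := (@omega R).
Implicit Types (f : heis R -> C) (p : heis R) (q : int * int).

Lemma joint_flatE (c r kappa : R) : 0 < r -> joint_eigenspace (Gamma c) r kappa 0 =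
  [set f | flat_eigen r kappa f /\ forall p, f (act (gG c) p) = f p].
Proof.
move=> r0; have r0' := lt0r_neq0 r0; have rC0 : r%:C != 0 :> C.
  by apply/eqP => /complexI/eqP; rewrite (negbTE r0').
have i0 : 'i%C != 0 :> C by apply/eqP => /(congr1 (fun z : C => Im z))/= /eqP; rewrite oner_eq0.
have subE f p : smooth f -> (forall p, partial axis_t f p = 0) ->
    sublaplacian r f p = - (r%:C^-1) * Zop (Zbarop f) p.
  move=> sf ft; have ft' p' : partial axis_t f p' = 'i%C * 0%:C * f p' by rewrite ft mulr0 mul0r.
  rewrite /sublaplacian (commutator_char p sf ft') rmorphM rmorph_nat invfM mulr0 mul0r subr0.
  by field.
have rI : r%:C * - (r%:C)^-1 = -1 :> C by rewrite mulrN divff.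
apply/seteqP; split=> f /=.
  move=> [sf /Gamma_inv[fA fB fC fG] fa fb].
  have ft p : partial axis_t f p = 0.
    have /eqP := fb p; rewrite mul0r /reeb !mulf_eq0 !invr_eq0 (negbTE i0) (negbTE rC0).
    by move=> /eqP.
  split=> //; split=> // p; have := fa p; rewrite subE // => /(congr1 (fun z => r%:C * z)).
  rewrite [LHS]mulrA rI mulN1r mulrA -rmorphM => /(congr1 (fun z => - z)).
  by rewrite opprK rmorphN mulNr.
move=> [[tf fk] fG]; have [sf ft fA fB] := tf; split=> //.
- apply/Gamma_inv; split=> // p; rewrite -[p]mkptE act_gC; exact: torus_flat.
- by move=> p; rewrite subE // fk rmorphN rmorphM mulrA mulrNN mulrA mulVf ?mul1r.
- by move=> p; rewrite /reeb ft !mulr0 mul0r.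
Qed.

(** Since [4 (m^2 + m j + j^2) = 3 m^2 + (m + 2 j)^2], the frequencies on a level
    lie in a box. *)
Lemma sector_freqs (r kappa : R) : 0 < r -> 0 < kappa -> exists S : seq (int * int),
  uniq S /\ forall q, q \in S <-> on_level r kappa q /\ sector q.
Proof.
move=> r0 k0; pose B := Num.bound (r * kappa / pi ^+ 2).
pose rng := [seq (i%:Z - B%:Z : int) | i <- iota 0 (2 * B).+1].
have rngP (m : int) : m ^+ 2 < B%:Z -> m \in rng.
  move=> hm; have [h1 h2] : - B%:Z <= m /\ m <= B%:Z by split; nia.
  apply/mapP; exists (absz (m + B%:Z)); last by lia.
  by rewrite mem_iota; lia.
clearbody rng.
exists (undup [seq q <- [seq (m, j) | m <- rng, j <- rng] | `[< on_level r kappa q /\ sector q >]]).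
split=> [|q]; first exact: undup_uniq.
rewrite mem_undup mem_filter; split=> [/andP[/asboolP //]|h].
apply/andP; split; first exact/asboolP.
have [lq _] := h; pose Q := q.1 ^+ 2 + q.1 * q.2 + q.2 ^+ 2.
have QE : 4 / 3 * Q%:~R = r * kappa / pi ^+ 2 :> R.
  by rewrite -lq sqnorm_freq -/Q; move: (pi : R) (lt0r_neq0 (pi_gt0 R)) => P P0; field; rewrite P0 lt0r_neq0.
have QB : 4 * Q < 3 * B%:Z.
  rewrite -(ltr_int R) !rmorphM /=.
  have /archi_boundP : 0 <= r * kappa / pi ^+ 2 by rewrite divr_ge0 ?sqr_ge0 // mulr_ge0 // ltW.
  rewrite -/B -QE.
  by rewrite -[B%:R]/(B%:Z%:~R); move: (Q%:~R) (B%:Z%:~R : R) => u v; lra.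
move: QB; rewrite /Q {Q QE}; case: q {h lq} => m j /= QB.
have e1 : 4 * (m ^+ 2 + m * j + j ^+ 2) = 3 * m ^+ 2 + (m + 2 * j) ^+ 2 by ring.
have e2 : 4 * (m ^+ 2 + m * j + j ^+ 2) = 3 * j ^+ 2 + (j + 2 * m) ^+ 2 by ring.
apply: allpairs_f; apply: rngP; rewrite -(ltr_pM2l (isT : 0 < 3 :> int)).
  by apply: le_lt_trans QB; rewrite e1 lerDl sqr_ge0.
by apply: le_lt_trans QB; rewrite e2 lerDl sqr_ge0.
Qed.

Lemma freq_inj : injective (@freq R).
Proof.
have s30 := lt0r_neq0 (@s3_gt0 R).
move=> [a b] [a' b'] [/= /intr_inj -> /(mulIf (invr_neq0 s30)) /addIr].
by move=> /(mulfI (_ : 2 != 0 :> R))/intr_inj -> //; rewrite pnatr_eq0.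
Qed.

Lemma Re_conj_mul (z w : C) : Re (z * (w^*)%C) = Re z * Re w + Im z * Im w.
Proof. by case: z w => a b [a' b'] /=; ring. Qed.

Lemma Re_omega_mul (z : C) : Re (z * (om^*)%C) = - (Re z / 2) + Im z * s3 / 2.
Proof. by rewrite Re_conj_mul Re_omega Im_omega; field. Qed.

(** An element of the dual lattice is determined by its integral pairings with [1]
    and [omega]. *)
Lemma Lomega_dualE : Lomega_dual = range (@freq R).
Proof.
have s30 := lt0r_neq0 (@s3_gt0 R).
apply/seteqP; split => z /=.
  move=> hz.
  have /intrP[m mE] : Re (z * (1^*)%C) \is a Num.int.
    by apply: hz; exists 1, 0; rewrite mul0r addr0.
  have /intrP[j jE] : Re (z * (om^*)%C) \is a Num.int.
    by apply: hz; exists 0, 1; rewrite mul1r add0r.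
  rewrite Re_conj_mul /= mulr1 mulr0 addr0 in mE.
  rewrite Re_omega_mul mE in jE.
  exists (m, j) => //; rewrite /freq /= -jE -mE; case: z {hz mE jE} => a b /=.
  by congr (_ +i* _); field.
move=> [q _ <-] _ [a [b ->]]; apply/intrP; exists (a * q.1 + b * q.2).
rewrite Re_conj_mul !creimE; have e (k : int) : (k%:~R : C) = (k%:~R)%:C by rewrite rmorph_int.
by rewrite !e Re_omega Im_omega /freq /= !rmorphD !rmorphM /=; field.
Qed.

Lemma EkappaE (r kappa : R) : Ekappa r kappa = [set freq q | q in [set q | on_level r kappa q]].
Proof.
rewrite /Ekappa Lomega_dualE; apply/seteqP; split => z /=.
  by move=> [[q _ <-] h]; exists q.
by move=> [q h <-]; split=> //; exists q.
Qed.

Lemma card_Ekappa (r kappa : R) (L : seq (int * int)) : uniq L ->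
  (forall q, q \in L <-> on_level r kappa q) -> (Ekappa r kappa #= `I_(size L))%card.
Proof.
move=> uL Lm.
have -> : Ekappa r kappa = [set freq (nth (0, 0) L k) | k in `I_(size L)].
  rewrite EkappaE; apply/seteqP; split=> z /= [q hq <-].
    by have qL := (Lm q).2 hq; exists (index q L); rewrite /= ?index_mem ?nth_index.
  by exists (nth (0, 0) L q) => //; apply/Lm; exact: mem_nth.
apply: inj_card_eq => k l /set_mem /= kL /set_mem /= lL /freq_inj /eqP.
by rewrite nth_uniq // => /eqP.
Qed.

Lemma flat_multiplicity (c r kappa : R) : 0 < r -> 0 < kappa ->
  exists m e : nat, [/\ multiplicity (Gamma c) r kappa 0 m,
    (Ekappa r kappa #= `I_e)%card & m%:R = e%:R / 3 :> R].
Proof.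
move=> r0 k0; have [S [uS Sm]] := sector_freqs r0 k0.
exists (size S), (size (level_freqs S)); split.
- by rewrite /multiplicity joint_flatE //; exact: flat_has_dim.
- by apply: card_Ekappa; [exact: uniq_level_freqs Sm | exact: mem_level_freqs Sm].
- by rewrite !size_cat !size_map !natrD; field.
Qed.

End Conclusion.

Local Open Scope card_scope.

Theorem theorem7p2 (R : realType) (N : nat) (r c : R) :
  (0 < N)%N -> 0 < r -> c = 4 * complex.Im (omega : complex R) / N%:R ->
  heisenberg_bieberbach (Gamma c) ->
  (forall (n : int) (k : nat), n != 0 ->
     exists m : nat,
       multiplicity (Gamma c) r
         ((4 * k%:R + 2) * pi * `|n|%:~R / (c * r)) (2 * pi * n%:~R / (c * r)) m
       /\ m%:R = 3^-1 *
           (`|n|%:~R * N%:R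
            + 4 / Num.sqrt 3
              * cos (2 * pi * (`|n|%:~R - k%:R) / 3 + pi / 6)
            + 2 / Num.sqrt 3
              * cos (2 * pi * (`|n|%:~R - k%:R - `|n|%:~R * N%:R) / 3 + pi / 6))
           :> R)
  /\
  (forall kappa : R, 0 < kappa ->
     exists m e : nat,
       [/\ multiplicity (Gamma c) r kappa 0 m,
           Ekappa r kappa #= `I_e
         & m%:R = e%:R / 3 :> R]).
Proof.
move=> N0 r0 cE _; split; last by move=> kappa; exact: flat_multiplicity.
move=> n k n0; have a0 : (0 < absz n)%N by rewrite absz_gt0.
have [m mP mE] := multiplicity_pos k N0 a0 r0 cE.
have aE : `|n|%:~R = (absz n)%:R :> R by rewrite pmulrn -abszE.
exists m; rewrite aE; split; last exact: mE.
have [n_ge0|n_lt0] := lerP 0 n.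
  by rewrite -[in n%:~R](gez0_abs n_ge0) abszE.
have -> : 2 * pi * n%:~R / (c * r) = - (2 * pi * (absz n)%:R / (c * r)).
  by rewrite -aE ltr0_norm // mulrNz; ring.
by apply: multiplicity_conj => //; rewrite gt_eqF.
Qed.
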